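(* Let $1<p<\infty$, and let $\omega$ be a finite positive measure on $[0,1]$ such that $B^\omega_z$ admits the representation $$B^\omega_z(\zeta)=\frac{1}{(1-\overline{z}\zeta)^\gamma}\int_0^1\frac{d\nu(r)}{1-r\overline{z}\zeta},\qquad z,\zeta\in\mathbb D,$$ for some $\gamma\ge1$ and a positive measure $\nu$ supported on $[0,1]$. Let $v,u$ be $\omega$-weights and denote $\sigma=v^{1-p'}$, where $\frac1p+\frac1{p'}=1$. Then $P^+_\omega:L^p_\omega(v)\to L^p_\omega(u)$ is bounded if and only if there exist constants $C_0=C_0(p,v,u,\omega)>0$ and $C_0^\star=C_0^\star(p,v,u,\omega)>0$ such that $$\left\|\mathcal M_{u^{1/p}}P^+_\omega\mathcal M_{\sigma^{1/p'}}(1_S\sigma^{1/p})\right\|_{L^p_\omega}\le C_0\left\|1_S\sigma^{1/p}\right\|_{L^p_\omega}$$ and $$\left\|\mathcal M_{\sigma^{1/p'}}P^+_\omega\mathcal M_{u^{1/p}}(1_Su^{1/p'})\right\|_{L^{p'}_\omega}\le C_0^\star\left\|1_Su^{1/p'}\right\|_{L^{p'}_\omega}$$ for all Carleson squares $S\subset\mathbb D$. Moreover, there exists a constant $C_1=C_1(p,\omega)>0$ such that $$\left\|P^+_\omega\right\|_{L^p_\omega(v)\to L^p_\omega(u)}\le C_1(C_0+C_0^\star).$$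
   Context: $\mathbb D$ is the open unit disc. $\omega\otimes m$ is the measure on $\mathbb D$ with $d(\omega\otimes m)(re^{i\theta})=r\,d\omega(r)\,d\theta$. $A^2_\omega$ is the space of analytic functions $f$ in $\mathbb D$ with $\int_{\mathbb D}|f|^2d(\omega\otimes m)<\infty$, and $B^\omega_z$ is its reproducing kernel: $f(z)=\int_{\mathbb D}f(\zeta)\overline{B^\omega_z(\zeta)}\,d(\omega\otimes m)(\zeta)$ for $f\in A^2_\omega$ (its existence is part of the hypothesis on $\omega$). The maximal Bergman projection is $P^+_\omega(f)(z)=\int_{\mathbb D}f(\zeta)|B^\omega_z(\zeta)|\,d(\omega\otimes m)(\zeta)$. An $\omega$-weight is a positive $(\omega\otimes m)$-integrable function on $\mathbb D$. $\|f\|^p_{L^p_\omega(v)}=\int_{\mathbb D}|f|^pv\,d(\omega\otimes m)$ and $L^p_\omega=L^p_\omega(1)$. $1_E$ is the characteristic function of $E$, and $\mathcal M_h(f)=fh$ is multiplication by $h$. For an arc $I\subset\mathbb T$ with normalized arc-length $|I|$, the associated Carleson square is $S(I)=\{re^{i\theta}:1-|I|\le r<1,\ e^{i\theta}\in I\}$. *)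

(* Defs.v *)
From HB Require Import structures.
From mathcomp Require Import all_boot all_order all_algebra.
From mathcomp Require Import all_classical all_reals all_analysis.
From mathcomp Require Import measurable_realfun complex.

Set Implicit Arguments.
Unset Strict Implicit.
Unset Printing Implicit Defensive.

Import Order.TTheory GRing.Theory Num.Theory numFieldNormedType.Exports.
Export ComplexField.Normc(normc).

Local Open Scope classical_set_scope.
Local Open Scope ring_scope.
Local Open Scope complex_scope.

(* The Borel sigma-algebra of the plane, transported from R * R. *)
Definition reim (R : realType) (z : R[i]) : R * R := (complex.Re z, complex.Im z).

HB.instance Definition _ (R : realType) := isPointed.Build R[i] 0.
HB.instance Definition _ (R : realType) :=
  @isMeasurable.Build (preimage_display (@reim R)) R[i]
    (g_sigma_algebra_preimage (@reim R))
    (@measurable0 _ (g_sigma_algebra_preimageType (@reim R)))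
    (@measurableC _ (g_sigma_algebra_preimageType (@reim R)))
    (@bigcupT_measurable _ (g_sigma_algebra_preimageType (@reim R))).

Section plane.
Context {R : realType}.
Local Notation C := R[i].

Definition disc : set C := [set z | normc z < 1].

Definition expi (t : R) : C := cos t +i* sin t.

(* The angle ranges over [measurableTypeR R], the domain of [lebesgue_measure]. *)
Definition polar (q : R * measurableTypeR R) : C := q.1%:C * expi q.2.

Lemma measurable_polar : measurable_fun setT polar.
Proof.
move=> _ _ [A mA <-]; rewrite !setTI.
have -> : polar @^-1` (@reim R @^-1` A) =
    (fun q : R * measurableTypeR R => (q.1 * cos q.2, q.1 * sin q.2)) @^-1` A.
  apply/seteqP; split=> -[r t];
  by rewrite /polar /expi /reim /preimage /= !mul0r subr0 addr0.
rewrite -[X in measurable X]setTI.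
suff m : measurable_fun setT
    (fun q : R * measurableTypeR R => (q.1 * cos q.2, q.1 * sin q.2)).
  exact: m.
apply: measurable_fun_pair => /=.
  apply: measurable_funM; first exact: measurable_fst.
  apply: measurableT_comp; last exact: measurable_snd.
  by apply: continuous_measurable_fun; exact: continuous_cos.
apply: measurable_funM; first exact: measurable_fst.
apply: measurableT_comp; last exact: measurable_snd.
by apply: continuous_measurable_fun; exact: continuous_sin.
Qed.


Definition polar_cell : set (R * measurableTypeR R) :=
  `[0, 1[%classic `*` `[0, 2 * pi[%classic.

Section otimes.
Variable omega : {finite_measure set R -> \bar R}.

(* d(omega (x) m)(r e^{it}) = r domega(r) dt on the open unit disc *)
Definition omega_m (A : set C) : \bar R :=
  (\int[omega \x (@lebesgue_measure R)]_(q in polar_cell `&` polar @^-1` A)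
     (q.1)%:E)%E.

Let omega_m0 : omega_m set0 = 0%E.
Proof. by rewrite /omega_m preimage_set0 setI0 integral_set0. Qed.

Let omega_m_ge0 A : (0 <= omega_m A)%E.
Proof.
apply: integral_ge0 => -[r t] [] [] /=.
by rewrite in_itv /= => /andP[r0 _] _ _; rewrite lee_fin.
Qed.

Let measurable_cell A : measurable A -> measurable (polar_cell `&` polar @^-1` A).
Proof.
move=> mA; apply: measurableI.
  by apply: measurableX; exact: measurable_itv.
by rewrite -[X in measurable X]setTI; exact: measurable_polar.
Qed.

Let omega_m_additive : semi_sigma_additive omega_m.
Proof.
move=> F mF tF mUF; rewrite /omega_m preimage_bigcup setI_bigcupr.
rewrite ge0_integral_bigcup//.
- apply: is_cvg_nneseries => n _ _; exact: omega_m_ge0.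
- by move=> n; apply: measurable_cell.
- by apply/measurable_EFinP; apply: measurable_funTS; exact: measurable_fst.
- move=> [r t] [n _] [] [] /=.
  by rewrite in_itv /= => /andP[r0 _] _ _; rewrite lee_fin.
- apply/trivIsetP => i j _ _ ij; move/trivIsetP : tF => /(_ i j I I ij) Fij.
  by rewrite setIACA -preimage_setI Fij preimage_set0 setI0.
Qed.

HB.instance Definition _ := isMeasure.Build _ _ _ omega_m
  omega_m0 omega_m_ge0 omega_m_additive.

End otimes.

Section complex_integral.
Context d (T : measurableType d).
Variables (mu : {measure set T -> \bar R}) (D : set T).

Definition cintegrable (f : T -> C) : Prop :=
  mu.-integrable D (fun x => (complex.Re (f x))%:E) /\
  mu.-integrable D (fun x => (complex.Im (f x))%:E).

(* Meaningful only when [cintegrable f] holds. *)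
Definition cintegral (f : T -> C) : C :=
  (\int[mu]_(x in D) complex.Re (f x)) +i* (\int[mu]_(x in D) complex.Im (f x)).

End complex_integral.

(* Principal branch: [carg w] lies in ]-pi, pi] for w != 0. *)
Definition carg (w : C) : R :=
  if 0 <= complex.Im w then acos (complex.Re w / normc w)
  else - acos (complex.Re w / normc w).

Definition cpowR (w : C) (a : R) : C := (normc w `^ a)%:C * expi (a * carg w).

Section bergman.
Variable omega : {finite_measure set R -> \bar R}.
Local Notation mu := (omega_m omega).

(* The scalar field of the normed module C^o is C, so this is complex
   differentiability. *)
Definition analytic_disc (f : C -> C) : Prop :=
  forall z, disc z -> derivable (f : C^o -> C^o) z 1.

Definition bergman2 (f : C -> C) : Prop :=
  analytic_disc f /\ (\int[mu]_(z in disc) (normc (f z) ^+ 2)%:E < +oo)%E.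

(* [B z] stands for the function B_z. *)
Definition reproducing_kernel (B : C -> C -> C) : Prop :=
  forall z, disc z -> bergman2 (B z) /\
    forall f, bergman2 f ->
      f z = cintegral mu disc (fun zeta => f zeta * (B z zeta)^*).

Definition weight (v : C -> R) : Prop :=
  (forall z, disc z -> 0 < v z) /\ mu.-integrable disc (EFin \o v).

Definition wnorm (p : R) (v : C -> R) (f : C -> C) : \bar R :=
  ((\int[mu]_(z in disc) (normc (f z) `^ p * v z)%:E) `^ p^-1)%E.

Definition in_Lp (p : R) (v : C -> R) (f : C -> C) : Prop :=
  measurable_fun disc f /\ (wnorm p v f < +oo)%E.

Variable B : C -> C -> C.

Definition maxproj_integrand (f : C -> C) (z zeta : C) : C :=
  f zeta * (normc (B z zeta))%:C.

Definition maxproj (f : C -> C) (z : C) : C :=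
  cintegral mu disc (maxproj_integrand f z).

(* [K] is a norm bound for P^+ : L^p(v) -> L^p(u); the integral defining P^+ f
   is required to converge absolutely almost everywhere. *)
Definition maxproj_bound (p : R) (v u : C -> R) (K : R) : Prop :=
  0 <= K /\ forall f, in_Lp p v f ->
    [/\ {ae mu, forall z, disc z -> cintegrable mu disc (maxproj_integrand f z)},
        in_Lp p u (maxproj f)
      & (wnorm p u (maxproj f) <= K%:E * wnorm p v f)%E].

Definition maxproj_bounded (p : R) (v u : C -> R) : Prop :=
  exists K, maxproj_bound p v u K.

Definition maxproj_norm (p : R) (v u : C -> R) : \bar R :=
  ereal_inf [set K%:E | K in maxproj_bound p v u].

End bergman.

Definition kernel_representation (B : C -> C -> C) : Prop :=
  exists (gamma : R) (nu : {measure set R -> \bar R}),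
    [/\ 1 <= gamma, nu (~` `[0, 1]%classic) = 0%E &
      forall z zeta, disc z -> disc zeta ->
        let F := fun r : R => (1 - r%:C * z^* * zeta)^-1 in
        cintegrable nu `[0, 1]%classic F /\
        B z zeta =
          (cpowR (1 - z^* * zeta) gamma)^-1 * cintegral nu `[0, 1]%classic F].

(* [arc I l]: I is an arc of the unit circle, with or without either of its
   endpoints, of normalized length l. *)
Definition arc (I : set C) (l : R) : Prop :=
  exists (a b : R) (ca cb : bool),
    [/\ a < b <= a + 2 * pi, l = (b - a) / (2 * pi)
      & I = expi @` [set` Interval (BSide ca a) (BSide cb b)]].

Definition carleson_square (S : set C) : Prop :=
  exists I l, arc I l /\
    S = [set z | exists r e, [/\ 1 - l <= r < 1, I e & z = r%:C * e]].

Definition mulop (h : C -> R) (f : C -> C) : C -> C := fun z => (h z)%:C * f z.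

(* || M_{a^{1/p}} P^+ M_{b^{1/p'}} (1_S b^{1/p}) ||_{L^p}
     <= K || 1_S b^{1/p} ||_{L^p}  for all Carleson squares S.
   Should the integral defining P^+ diverge for some S, the right-hand side is
   +oo anyway, since B_z is bounded for each z. *)
Definition testing (omega : {finite_measure set R -> \bar R})
    (B : C -> C -> C) (p p' : R) (a b : C -> R) (K : R) : Prop :=
  forall S, carleson_square S ->
    let g : C -> C := fun z => (\1_S z * b z `^ p^-1)%:C in
    let h := mulop (fun z => a z `^ p^-1)
               (maxproj omega B (mulop (fun z => b z `^ p'^-1) g)) in
    (wnorm omega p (cst 1%R) h <= K%:E * wnorm omega p (cst 1%R) g)%E.

End plane.

(* Main.v *)
Require Import Defs.
From HB Require Import structures.
From mathcomp Require Import all_boot all_order all_algebra.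
From mathcomp Require Import all_classical all_reals all_analysis.
From mathcomp Require Import complex ring lra zify measurable_realfun.

Set Implicit Arguments.
Unset Strict Implicit.
Unset Printing Implicit Defensive.

Import Order.TTheory GRing.Theory Num.Theory numFieldNormedType.Exports.
Import ComplexField.Normc.
Local Open Scope classical_set_scope.
Local Open Scope ring_scope.

(** The representation of the kernel forbids cancellation: for [z], [w] in the
    disc the numbers [1 / (1 - r * conj z * w)] all lie in one quadrant, so the
    modulus of [B_z(w)] is comparable with a decreasing function of the distance
    from [conj z * w] to 1 ([model_kernel_le], [model_kernel_ge]). Because of
    the power [gamma >= 1], the values of this function at the points [2 ^- n]
    at least double from each [n] to the next. Consequently the kernel is
    comparable with positive dyadic kernels, sums over Carleson squares [Q] of a
    coefficient depending on the level of [Q] times the product of the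
    indicators of [Q] at [z] and [w]. It dominates the kernel of any dyadic
    grid of the circle, and it is dominated by the sum of two of them, since two
    points of the circle at distance less than a third of the mesh lie in one
    dyadic arc of the standard grid or of the grid shifted by a third of a turn
    ([one_third], [adjacent_squares], [dyadic_kernel_model]).

    Sufficiency is therefore a two-weight theorem for dyadic operators, which
    inherit the testing conditions. Up to a level [N] such an operator lives on
    finitely many atoms, and the problem becomes an inequality on a finite
    forest ([forest_two_weight]). The bilinear form in [f] and [g] is split
    according to which of the two quantities (mean of [f])^p * mass and
    (mean of [g])^q * mass is the larger at a node; the halves are symmetric. In
    the half governed by [f], nodes are grouped under stopping nodes, where the
    running maximum of the means of [f] reaches a new power of two. Within a
    group the mean of [f] is constant up to a factor, and the testing condition
    at the stopping node bounds the rest; on the next stopping nodes the partial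
    sum is constant, so [g] can be replaced by its mean, which the choice of the
    half bounds by the mean of [f] ([half_form]). The sum over stopping nodes is
    controlled by a Carleson embedding ([packing]). Young's inequality is used
    throughout, and the homogeneous bound is recovered at the end by scaling
    ([forest_operator]). Monotone convergence then removes the truncation at [N]
    ([two_weight_sufficiency]).

    The dual weight [sigma] is not assumed summable. When the kernel does not
    vanish it is bounded below on the disc, and the second testing condition on
    the disc itself forces the summability of [sigma] ([dual_weight_summable]).

    Necessity of the first condition is the norm inequality for [sigma] cut off
    to a square. For the second one, the image [G] of [u] cut off to a square is
    paired with truncations of [G^(q-1) * sigma]; the operator is self-adjoint,
    so the norm inequality applies to the truncations, and a finite quantity is
    absorbed ([dual_bound]). *)

(** * Measures restricted to sets of finite mass *)

(** Restricting an arbitrary measure to a set of finite mass gives a measure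
    whose finiteness is carried by its type, as Tonelli's theorem demands. *)
Definition finite_restriction d (T : measurableType d) (R : realType)
  (mu : {measure set T -> \bar R}) (D : set T) (mD : measurable D)
  (muD : (mu D < +oo)%E) : set T -> \bar R := mrestr mu mD.

HB.instance Definition _ d (T : measurableType d) (R : realType)
  (mu : {measure set T -> \bar R}) (D : set T) (mD : measurable D)
  (muD : (mu D < +oo)%E) :=
  Measure.copy (finite_restriction mD muD) (mrestr mu mD).

Lemma finite_restriction_fin d (T : measurableType d) (R : realType)
  (mu : {measure set T -> \bar R}) (D : set T) (mD : measurable D)
  (muD : (mu D < +oo)%E) : fin_num_fun (finite_restriction mD muD).
Proof.
move=> A mA; rewrite ge0_fin_numE ?measure_ge0//; apply: (@le_lt_trans _ _ (mu D)) => //.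
rewrite /finite_restriction /mrestr le_measure// ?inE//.
exact: measurableI.
Qed.

HB.instance Definition _ d (T : measurableType d) (R : realType)
  (mu : {measure set T -> \bar R}) (D : set T) (mD : measurable D)
  (muD : (mu D < +oo)%E) :=
  Measure_isFinite.Build _ _ _ (finite_restriction mD muD)
    (finite_restriction_fin mD muD).

Section product_of_sets.
Context d1 d2 (S : measurableType d1) (T : measurableType d2) (R : realType).
Variables (m1 : {measure set S -> \bar R}) (m2 : {measure set T -> \bar R}).
Variables (E : set S) (D : set T) (mE : measurable E) (mD : measurable D).
Hypotheses (m1E : (m1 E < +oo)%E) (m2D : (m2 D < +oo)%E).
Variable F : S * T -> \bar R.
Hypothesis mF : measurable_fun (E `*` D) F.
Hypothesis F0 : forall z, (E `*` D) z -> (0 <= F z)%E.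

Let G := F \_ (E `*` D).
Let mG : measurable_fun setT G.
Proof. by apply/(measurable_restrictT _ _).1 => //; exact: measurableX. Qed.
Let G0 z : (0 <= G z)%E.
Proof. by rewrite /G patchE; case: ifPn => //; rewrite inE => /F0. Qed.

Let restrE2 (f : T -> \bar R) : (\int[m2]_(y in D) f y =
   \int[finite_restriction mD m2D]_y (f \_ D) y)%E.
Proof.
rewrite -integral_mkcond; apply: eq_measure_integral => A mA AD.
by rewrite /= /finite_restriction /mrestr setIidl.
Qed.

Let restrE1 (f : S -> \bar R) : (\int[m1]_(y in E) f y =
   \int[finite_restriction mE m1E]_y (f \_ E) y)%E.
Proof.
rewrite -integral_mkcond; apply: eq_measure_integral => A mA AD.
by rewrite /= /finite_restriction /mrestr setIidl.
Qed.

Let G2 x : E x -> (fun y => F (x, y)) \_ D = (fun y => G (x, y)).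
Proof.
move=> Ex; apply/funext => y; rewrite /G !patchE.
by have [Dy|Dy] := pselect (D y); [rewrite !mem_set|rewrite !memNset// => -[]].
Qed.

Let G1 y : D y -> (fun x => F (x, y)) \_ E = (fun x => G (x, y)).
Proof.
move=> Dy; apply/funext => x; rewrite /G !patchE.
by have [Ex|Ex] := pselect (E x); [rewrite !mem_set|rewrite !memNset// => -[]].
Qed.

Lemma measurable_integral_param :
  measurable_fun E (fun x => \int[m2]_(y in D) F (x, y))%E.
Proof.
apply: (@eq_measurable_fun _ _ _ _ _
  (fun x => \int[finite_restriction mD m2D]_y G (x, y))%E).
  by move=> x; rewrite inE => Ex; rewrite restrE2 G2.
by apply: measurable_funTS; exact: measurable_fun_fubini_tonelli_F.
Qed.

Lemma tonelli_on : (\int[m1]_(x in E) \int[m2]_(y in D) F (x, y) =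
  \int[m2]_(y in D) \int[m1]_(x in E) F (x, y))%E.
Proof.
rewrite restrE1 restrE2.
transitivity (\int[finite_restriction mE m1E]_x
    \int[finite_restriction mD m2D]_y G (x, y))%E.
  apply: eq_integral => x _; rewrite patchE; case: ifPn.
    by rewrite inE => Ex; rewrite restrE2 G2.
  rewrite notin_setE => nEx; apply/esym/integral0_eq => y _.
  by rewrite /G patchE memNset// => -[].
rewrite fubini_tonelli//.
apply: eq_integral => y _; rewrite patchE; case: ifPn.
  by rewrite inE => Dy; rewrite restrE1 G1.
rewrite notin_setE => nDy; apply/integral0_eq => x _.
by rewrite /G patchE memNset// => -[].
Qed.

End product_of_sets.

(** * Powers of two and geometric sums *)

Section powers_of_two.
Context {R : realType}.
Implicit Types s t q L : R.

(** The weights 1/p and 1/q of the sharp inequality are bounded by 1: the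
    arguments below are insensitive to constants, and a plain sum of powers is
    what survives summation over a tree. *)
Lemma young (a b p q : R) : 0 <= a -> 0 <= b -> 0 < p -> 0 < q ->
  p^-1 + q^-1 = 1 -> a * b <= a `^ p + b `^ q.
Proof.
move=> a0 b0 p0 q0 pq; apply: (le_trans (conjugate_powR a0 b0 p0 q0 pq)).
have p1 : p^-1 <= 1 by rewrite -pq lerDl invr_ge0 ltW.
have q1 : q^-1 <= 1 by rewrite -pq lerDr invr_ge0 ltW.
by rewrite lerD// ler_piMr ?powR_ge0.
Qed.

Definition pow2_below t : R := 2 ^ Num.floor (ln t / ln 2).

Lemma pow2_below_gt0 t : 0 < pow2_below t.
Proof. by rewrite exprz_gt0. Qed.

Lemma ln2_gt0 : 0 < ln 2 :> R.
Proof. by rewrite ln_gt0// ltr1n. Qed.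

Lemma ln_pow2 (z : int) : ln (2 ^ z : R) = z%:~R * ln 2.
Proof. by rewrite -powR_intmul// ln_powR. Qed.

Lemma pow2_below_le t : 0 < t -> pow2_below t <= t.
Proof.
move=> t0; rewrite -ler_ln ?posrE ?pow2_below_gt0// ln_pow2.
by rewrite -ler_pdivlMr ?ln2_gt0// floor_le_tmp.
Qed.

Lemma pow2_belowS t : 2 * pow2_below t = 2 ^ (Num.floor (ln t / ln 2) + 1).
Proof. by rewrite expfzDr// mulrC expr1z. Qed.

Lemma pow2_below_gt t : 0 < t -> t < 2 * pow2_below t.
Proof.
move=> t0; rewrite pow2_belowS -ltr_ln ?posrE ?exprz_gt0//.
by rewrite ln_pow2 -ltr_pdivrMr ?ln2_gt0// floorD1_gt.
Qed.

Lemma le_pow2_below s t : 0 < s -> s <= t -> pow2_below s <= pow2_below t.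
Proof.
move=> s0 st; rewrite /pow2_below ler_eXz2l ?ltr1n//.
rewrite le_floor// ler_pM2r ?invr_gt0 ?ln2_gt0// ler_ln// posrE//.
exact: lt_le_trans st.
Qed.

Lemma pow2_below_gap s t :
  pow2_below s < pow2_below t -> 2 * pow2_below s <= pow2_below t.
Proof.
rewrite pow2_belowS /pow2_below ltr_eXz2l ?ltr1n// ler_eXz2l ?ltr1n//.
by rewrite lezD1.
Qed.

Lemma pow2N_lt1 q : 0 < q -> 2 `^ (- q) < 1.
Proof.
move=> q0; rewrite powRN invf_lt1 ?powR_gt0//.
have := @gt0_ltr_powR R q q0 1 2; rewrite powR1 => -> //; rewrite ?nnegrE//; lra.
Qed.

(** The largest term bounds the sum as in a geometric series: by the gap
    condition all other terms are at most half of it, and induction applies to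
    them. *)
Lemma sum_gap_powR (I : finType) (l : I -> R) (q L : R) (P : {set I}) :
  0 < q -> 0 <= L ->
  (forall i, i \in P -> 0 < l i <= L) ->
  (forall i j, i \in P -> j \in P -> i != j ->
    (2 * l i <= l j) || (2 * l j <= l i)) ->
  \sum_(i in P) l i `^ q <= L `^ q / (1 - 2 `^ (- q)).
Proof.
move=> q0 L0.
have h2 : (0 : R) < 2 `^ (- q) < 1 by rewrite powR_gt0//= pow2N_lt1.
set r := 2 `^ (- q) in h2 *.
have [n] := ubnP #|P|; elim: n P L L0 => // n IH P L L0 Pn Pl Pgap.
have [->|/finset.set0Pn[i0 i0P]] := eqVneq P finset.set0.
  by rewrite big_set0 divr_ge0 ?powR_ge0//; lra.
pose m := [arg max_(i > i0 | i \in P) l i]%O.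
have [mP mmax] : m \in P /\ forall j, j \in P -> l j <= l m.
  by rewrite /m; case: arg_maxP => // i iP h; split.
have [lm0 lmL] := andP (Pl _ mP).
rewrite (big_setD1 m)//=.
have : \sum_(i in P :\ m) l i `^ q <= (l m / 2) `^ q / (1 - r).
  apply: IH => [|| |i j]; first by rewrite divr_ge0 ?ltW.
  - by rewrite (cardsD1 m) mP in Pn.
  - move=> i; rewrite in_setD1 => /andP[im iP].
    have [li0 _] := andP (Pl _ iP); rewrite li0/=.
    have := mmax _ iP; have /orP[] := Pgap _ _ iP mP im; lra.
  - by rewrite !in_setD1 => /andP[_ iP] /andP[_ jP]; exact: Pgap.
rewrite powRM ?invr_ge0 ?(ltW lm0)// -[2^-1]powR_inv1// -powRrM mulN1r -/r.
move=> h; apply: (@le_trans _ _ (l m `^ q / (1 - r))).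
  apply: (le_trans (lerD (lexx _) h)).
  rewrite le_eqVlt; apply/orP; left; apply/eqP; field; lra.
rewrite ler_pM2r ?invr_gt0; last lra.
by rewrite ge0_ler_powR ?nnegrE ?(ltW q0)// ltW.
Qed.

End powers_of_two.

(** * The two-weight inequality on a finite forest *)

Section forest.
Variables (R : realType) (I : finType) (anc : rel I).
Hypothesis anc_refl : reflexive anc.
Hypothesis anc_trans : transitive anc.
Hypothesis anc_anti : antisymmetric anc.
Hypothesis anc_chain : forall i j x, anc i x -> anc j x -> anc i j || anc j i.

(** A node stands for the set of its descendants, which plays the role of a
    dyadic square; a weight puts a mass on each single node. *)
Definition mass (s : I -> R) (i : I) : R := \sum_(x | anc i x) s x.

Lemma mass_ge0 s i : (forall x, 0 <= s x) -> 0 <= mass s i.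
Proof. by move=> s0; apply: sumr_ge0. Qed.

Definition depth (i : I) : nat := #|[pred k | anc k i]|.

Lemma depth_le i j : anc i j -> (depth j <= depth i)%N -> i = j.
Proof.
move=> ij dji.
have sub : [pred k | anc k i] \subset [pred k | anc k j].
  by apply/fintype.subsetP => k; rewrite !inE => /anc_trans; exact.
have /subset_leqif_card[_ H] := sub.
have : [pred k | anc k j] \subset [pred k | anc k i].
  by rewrite -H eqn_leq dji (subset_leq_card sub).
move=> /fintype.subsetP/(_ j); rewrite !inE => /(_ (anc_refl j)) ji.
by apply: anc_anti; rewrite ij.
Qed.

Section layers.
Variables (A : pred I) (h : I -> R).
Hypothesis h_gt0 : forall i, A i -> 0 < h i.

Definition peak (j : I) : I := [arg max_(i > j | A i && anc i j) h i]%O.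

Lemma peakP j : A j ->
  [/\ A (peak j), anc (peak j) j & forall i, A i -> anc i j -> h i <= h (peak j)].
Proof.
move=> Aj; rewrite /peak; case: arg_maxP => [|i /andP[Ai ij] hi].
  by rewrite Aj anc_refl.
by split=> // k Ak kj; apply: hi; rewrite Ak kj.
Qed.

(** Rounding the running maximum of [h] to a power of two makes it jump by a
    factor at least 2 each time it changes along a branch. *)
Definition layer (j : I) : R := pow2_below (h (peak j)).

Lemma le_layer i j : A i -> A j -> anc i j -> layer i <= layer j.
Proof.
move=> Ai Aj ij; have [Api pii _] := peakP Ai; have [_ _ pj] := peakP Aj.
by apply: le_pow2_below; [exact: h_gt0|apply: pj => //; exact: anc_trans ij].
Qed.

Definition same (i j : I) : bool := [&& A i, anc i j & layer i == layer j].

(** The oldest node of the layer of [j]; these nodes are the stopping nodes of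
    the corona decomposition. *)
Definition top (j : I) : I := [arg min_(i < j | same i j) depth i].

Lemma topP j : A j ->
  same (top j) j /\ forall i, same i j -> anc (top j) i.
Proof.
move=> Aj; rewrite /top; case: arg_minnP => [|i sij hi].
  by rewrite /same Aj anc_refl eqxx.
split=> // k skj; have := hi _ skj; case/and3P: sij => Ai ij _.
case/and3P: skj => Ak kj _; have /orP[//|ki] := anc_chain ij kj.
by move=> /(depth_le ki) ->.
Qed.

Lemma topA j : A j -> A (top j).
Proof. by move=> /topP[/and3P[]]. Qed.

Lemma top_le j : A j -> anc (top j) j.
Proof. by move=> /topP[/and3P[]]. Qed.

Lemma layer_top j : A j -> layer (top j) = layer j.
Proof. by move=> /topP[/and3P[_ _ /eqP]]. Qed.

Definition is_top (j : I) : bool := A j && (top j == j).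

Lemma is_topA j : is_top j -> A j.
Proof. by case/andP. Qed.

Lemma top_eq H i : is_top H -> same i H -> i = H.
Proof.
case/andP => AH /eqP tH sam; have [_ /(_ _ sam)] := topP AH; rewrite tH => Hi.
by case/and3P: sam => _ iH _; apply: anc_anti; rewrite iH.
Qed.

Lemma is_top_top j : A j -> is_top (top j).
Proof.
move=> Aj; rewrite /is_top topA//=; apply/eqP.
have AT := topA Aj; have [/and3P[A1 l1 /eqP e1] _] := topP AT.
have [_ /(_ (top (top j)))] := topP Aj.
rewrite /same A1 e1 layer_top// eqxx (anc_trans l1 (top_le Aj)) => /(_ erefl) l2.
by apply: anc_anti; rewrite l1.
Qed.

(** A strict ancestor carrying the running maximum at [H] would belong to the
    layer of [H], whose oldest node is [H] itself. *)
Lemma peak_top H : is_top H -> peak H = H.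
Proof.
move=> tH; have AH := is_topA tH; have [AP PH hP] := peakP AH.
apply: top_eq => //; rewrite /same AP PH /=; apply/eqP/le_anti.
rewrite le_layer//=.
have [_ _ /(_ _ AP (anc_refl _))] := peakP AP => le1.
by apply: le_pow2_below => //; exact: h_gt0.
Qed.

Lemma layer_le_top H : is_top H -> layer H <= h H.
Proof.
by move=> tH; rewrite /layer peak_top// pow2_below_le// h_gt0// is_topA.
Qed.

Lemma top_lt_layer H : is_top H -> h H < 2 * layer H.
Proof.
by move=> tH; rewrite /layer peak_top// pow2_below_gt// h_gt0// is_topA.
Qed.

(** Inside a layer the values of [h] can be replaced by the one at the top. *)
Lemma le_h_top j : A j -> h j <= 2 * h (top j).
Proof.
move=> Aj; have [AP PH /(_ _ Aj (anc_refl _)) hj] := peakP Aj.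
apply: (le_trans hj).
apply/ltW; apply: (lt_le_trans (pow2_below_gt (h_gt0 AP))).
by rewrite ler_pM2l// -/(layer j) -layer_top// layer_le_top// is_top_top.
Qed.

(** Two tops of one branch lie in different layers, since each is the oldest
    node of its own layer. *)
Lemma layer_gap F H x : is_top F -> is_top H -> anc F x -> anc H x -> F != H ->
  (2 * layer F <= layer H) || (2 * layer H <= layer F).
Proof.
wlog FH : F H / anc F H.
  move=> wl tF tH Fx Hx FH; have /orP[?|?] := anc_chain Fx Hx; first exact: wl.
  by rewrite orbC wl// eq_sym.
move=> tF tH Fx Hx neq; apply/orP; left; apply: pow2_below_gap.
rewrite -/(layer F) -/(layer H) lt_neqAle le_layer ?is_topA// andbT.
apply: contra neq => /eqP e; apply/eqP/top_eq => //.
by rewrite /same is_topA//= FH e eqxx.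
Qed.

(** Layers increase along a branch, so a node of the layer of [F] cannot lie
    below another top under [F]. Hence a sum over the ancestors of [x] that
    lie in the layer of [F] does not depend on [x] below such a top. *)
Lemma below_top j H x : A j -> is_top H -> anc (top j) H -> H != top j ->
  anc H x -> anc j x -> anc j H.
Proof.
move=> Aj tH jH neq Hx jx; have /orP[//|Hj] := anc_chain jx Hx.
case/eqP: neq; apply/esym/top_eq => //; rewrite /same topA//= jH/=.
have AH := is_topA tH.
by apply/eqP/le_anti; rewrite le_layer ?topA//= layer_top// le_layer.
Qed.

Definition child (F H : I) : bool :=
  [&& is_top H, anc F H, H != F &
   [forall K, (is_top K && anc F K && (K != F) && anc K H) ==> (K == H)]].

Definition exposed (F x : I) : bool :=
  anc F x && [forall K, (is_top K && anc F K && (K != F)) ==> ~~ anc K x].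

Lemma child_uniq F H H' x : child F H -> child F H' -> anc H x -> anc H' x ->
  H = H'.
Proof.
wlog HH : H H' / anc H H'.
  move=> wl c c' l l'; have /orP[h1|h1] := anc_chain l l'; first exact: wl.
  by apply/esym/wl.
move=> /and4P[tH FH nH _] /and4P[_ _ _ /forallP/(_ H)] + _ _.
by rewrite tH FH nH HH => /eqP.
Qed.

Lemma child_exists F x : anc F x -> ~~ exposed F x ->
  exists2 H, child F H & anc H x.
Proof.
move=> Fx; rewrite /exposed Fx/= negb_forall => /existsP[K].
rewrite negb_imply negbK => /andP[hK Kx].
pose P H := is_top H && anc F H && (H != F) && anc H x.
have PK : P K by rewrite /P hK.
pose H := [arg min_(i < K | P i) depth i].
have [PH Hmin] : P H /\ forall j, P j -> (depth H <= depth j)%N.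
  by rewrite /H; case: arg_minnP => // i ? ?; split.
case/andP: PH => /andP[/andP[tH FH] HF] Hx; exists H => //.
rewrite /child tH FH HF/=; apply/forallP => L; apply/implyP.
move=> /andP[/andP[/andP[tL FL] LF] LH]; apply/eqP/depth_le => //.
by apply: Hmin; rewrite /P tL FL LF (anc_trans LH).
Qed.

Lemma child_parent_uniq F F' H : is_top F -> is_top F' ->
  child F H -> child F' H -> F = F'.
Proof.
move=> + + c c'; have /and4P[_ FH _ _] := c; have /and4P[_ FH' _ _] := c'.
wlog FF : F F' c c' FH FH' / anc F F'.
  move=> wl t t'; have /orP[?|?] := anc_chain FH FH'; first exact: wl.
  by apply/esym/wl.
move=> t t'; apply/eqP/negPn/negP => ne.
have /and4P[_ _ _ /forallP/(_ F')] := c.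
rewrite t' FF eq_sym ne FH' /= => /eqP e.
by case/and4P: c' => _ _; rewrite e eqxx.
Qed.

Lemma exposed_uniq F F' x : is_top F -> is_top F' ->
  exposed F x -> exposed F' x -> F = F'.
Proof.
move=> + + c c'; have /andP[Fx _] := c; have /andP[Fx' _] := c'.
wlog FF : F F' c c' Fx Fx' / anc F F'.
  move=> wl t t'; have /orP[?|?] := anc_chain Fx Fx'; first exact: wl.
  by apply/esym/wl.
move=> t t'; apply/eqP/negPn/negP => ne.
have /andP[_ /forallP/(_ F')] := c.
by rewrite t' FF eq_sym ne Fx'.
Qed.

Lemma child_split F (phi : I -> R) :
  \sum_(x | anc F x) phi x = \sum_(x | exposed F x) phi x +
    \sum_(H | child F H) \sum_(x | anc H x) phi x.
Proof.
rewrite (bigID (exposed F))/=; congr (_ + _).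
  by apply: eq_bigl => x; rewrite andb_idl// => /andP[].
rewrite (exchange_big_dep (fun x => anc F x && ~~ exposed F x))/=; last first.
  move=> H x /and4P[tH FH nH _] Hx; rewrite (anc_trans FH Hx)/=.
  rewrite /exposed (anc_trans FH Hx)/= negb_forall; apply/existsP; exists H.
  by rewrite tH FH nH Hx.
apply: eq_bigr => x /andP[Fx nex]; have [H cH Hx] := child_exists Fx nex.
rewrite (big_pred1 H)// => K; apply/andP/eqP => [[cK Kx]|->]; last by split.
exact: child_uniq cK cH Kx Hx.
Qed.

End layers.

Definition mean (s f : I -> R) (i : I) : R :=
  mass (fun x => f x * s x) i / mass s i.

Lemma mean_ge0 s f i : (forall x, 0 <= s x) -> (forall x, 0 <= f x) ->
  0 <= mean s f i.
Proof.
move=> s0 f0; rewrite divr_ge0 ?mass_ge0// => x; exact: mulr_ge0.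
Qed.

Lemma mean_mass s f i : (forall x, 0 <= s x) -> (forall x, 0 <= f x) ->
  mean s f i * mass s i = mass (fun x => f x * s x) i.
Proof.
move=> s0 f0; rewrite /mean; have [s1|s1] := eqVneq (mass s i) 0; last first.
  by rewrite divfK.
rewrite s1 mulr0; apply/esym/big1 => x ix.
have /psumr_eq0P : mass s i = 0 by [].
by move=> /(_ (fun x _ => s0 x))/(_ x ix) ->; rewrite mulr0.
Qed.

Definition packing_cst (p : R) : R :=
  2 * (4 `^ (p - 1) / (1 - 2 `^ (- (p - 1)))).

Lemma packing_cst_ge0 p : 1 < p -> 0 <= packing_cst p.
Proof.
move=> p1; have := @pow2N_lt1 R (p - 1); rewrite subr_gt0 => /(_ p1) h.
by rewrite mulr_ge0// divr_ge0 ?powR_ge0// subr_ge0 ltW.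
Qed.

Section packing.
Variables (p : R) (s f : I -> R) (A : pred I).
Hypothesis p_gt1 : 1 < p.
Hypothesis s_ge0 : forall x, 0 <= s x.
Hypothesis f_ge0 : forall x, 0 <= f x.
Hypothesis A_gt0 : forall i, A i -> 0 < mean s f i.
Local Notation fs := (fun x => f x * s x).
Local Notation is_top := (is_top A (mean s f)).

(** The points where [2 * f] stays below the mean carry at most half of the
    integral of [f]. *)
Lemma mass_le_large F : mass fs F <=
  2 * \sum_(x | anc F x && (mean s f F < 2 * f x)) fs x.
Proof.
rewrite {1}/mass (bigID (fun x => mean s f F < 2 * f x))/=.
set a := \sum_(_ | _) _; set b := \sum_(_ | _) _.
have h1 : a + b = mass fs F by rewrite /a /b /mass -bigID.
suff h2 : b <= mass fs F / 2 by lra.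
rewrite -mean_mass// mulrAC /mass mulr_sumr.
apply: (@le_trans _ _
  (\sum_(x | anc F x && ~~ (mean s f F < 2 * f x)) mean s f F / 2 * s x)).
  by apply: ler_sum => x /andP[_]; rewrite -leNgt => h; rewrite ler_wpM2r//; lra.
rewrite [leRHS](bigID (fun x => mean s f F < 2 * f x))/= lerDr sumr_ge0// => x _.
by rewrite mulr_ge0// divr_ge0// mean_ge0.
Qed.

(** A Carleson embedding for the tops. After exchanging the sums, the tops
    through a point [x] that see a large value of [f] at [x] have means that
    grow geometrically and stay below [2 * f x]. *)
Lemma packing : \sum_(F | is_top F) mean s f F `^ p * mass s F <=
  packing_cst p * \sum_x f x `^ p * s x.
Proof.
have p10 : 0 < p - 1 by rewrite subr_gt0.
have p0 : 0 < p by lra.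
apply: (@le_trans _ _ (\sum_(F | is_top F)
    \sum_(x | anc F x && (mean s f F < 2 * f x))
      mean s f F `^ (p - 1) * (2 * fs x))).
  apply: ler_sum => F tF; have m0 := A_gt0 (is_topA tF).
  rewrite -(mulr_powRB1 (ltW m0) p0) mulrAC mean_mass// mulrC -mulr_sumr ler_wpM2l ?powR_ge0// -mulr_sumr.
  exact: mass_le_large.
rewrite (exchange_big_dep predT)//= mulr_sumr; apply: ler_sum => x _.
rewrite -mulr_suml.
have [fx0|fx0] := eqVneq (f x) 0.
  rewrite big_pred0 ?mul0r; last first.
    move=> F; apply/negP => /and3P[tF _]; rewrite fx0 mulr0 ltNge.
    by rewrite mean_ge0.
  by rewrite mulr_ge0 ?packing_cst_ge0// mulr_ge0// powR_ge0.
have fx : 0 < f x by rewrite lt_neqAle eq_sym fx0 f_ge0.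
have -> : packing_cst p * (f x `^ p * s x) =
   4 `^ (p - 1) * f x `^ (p - 1) / (1 - 2 `^ (- (p - 1))) * (2 * fs x).
  rewrite -(mulr_powRB1 (f_ge0 x) p0) /packing_cst/=.
  have := pow2N_lt1 p10 => h; field; lra.
rewrite ler_wpM2r ?mulr_ge0//.
have -> : 4 = 2 * 2 :> R by ring.
rewrite -powRM// ?mulr_ge0// -mulrA powRM// ?mulr_ge0//.
apply: (@le_trans _ _ (2 `^ (p - 1) *
   \sum_(F in [set F | [&& is_top F, anc F x & mean s f F < 2 * f x]]%SET)
     layer A (mean s f) F `^ (p - 1))).
  rewrite mulr_sumr big_mkcond [leRHS]big_mkcond/=; apply: ler_sum => F _.
  rewrite inE; case: ifPn => // /and3P[tF Fx Ff].
  rewrite -powRM// ?(ltW (pow2_below_gt0 _))//.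
  rewrite ge0_ler_powR ?nnegrE ?mean_ge0 ?mulr_ge0 ?(ltW (pow2_below_gt0 _))//.
    exact: ltW.
  exact/ltW/top_lt_layer.
rewrite -mulrA ler_wpM2l ?powR_ge0//; apply: sum_gap_powR => //.
- by rewrite mulr_ge0.
- move=> F; rewrite inE => /and3P[tF Fx Ff]; rewrite pow2_below_gt0/=.
  by apply: (le_trans (layer_le_top _ tF)) => //; exact: ltW.
- move=> F H; rewrite !inE => /and3P[tF Fx _] /and3P[tH Hx _].
  move=> nFH; exact: (layer_gap A_gt0 tF tH Fx Hx nFH).
Qed.

End packing.

Section half.
Variables (p q : R) (al s u f g : I -> R) (A : pred I) (C : R).
Hypothesis p_gt1 : 1 < p.
Hypothesis q_gt1 : 1 < q.
Hypothesis pq : p^-1 + q^-1 = 1.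
Hypothesis C_gt0 : 0 < C.
Hypothesis al_ge0 : forall x, 0 <= al x.
Hypothesis s_ge0 : forall x, 0 <= s x.
Hypothesis u_ge0 : forall x, 0 <= u x.
Hypothesis f_ge0 : forall x, 0 <= f x.
Hypothesis g_ge0 : forall x, 0 <= g x.
Hypothesis test : forall i, \sum_(x | anc i x)
    u x * (\sum_(j | anc i j && anc j x) al j * mass s j) `^ p
  <= C `^ p * mass s i.
Hypothesis A_gt0 : forall i, A i -> 0 < mean s f i.
Hypothesis A_dom : forall i, A i ->
  mean u g i `^ q * mass u i <= mean s f i `^ p * mass s i.
Local Notation fs := (fun x => f x * s x).
Local Notation gu := (fun x => g x * u x).
Local Notation is_top := (is_top A (mean s f)).
Local Notation top := (top A (mean s f)).
Local Notation child := (child A (mean s f)).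
Local Notation exposed := (exposed A (mean s f)).

Let p0 : 0 < p. Proof. exact: lt_trans p_gt1. Qed.
Let q0 : 0 < q. Proof. exact: lt_trans q_gt1. Qed.

Definition local_sum (F x : I) : R :=
  \sum_(j | [&& A j, top j == F & anc j x]) al j * mass s j.

Lemma local_sum_ge0 F x : 0 <= local_sum F x.
Proof. by apply: sumr_ge0 => j _; rewrite mulr_ge0// mass_ge0. Qed.

Lemma local_sum_test F : \sum_(x | anc F x) u x * local_sum F x `^ p
  <= C `^ p * mass s F.
Proof.
apply: (le_trans _ (test F)).
apply: ler_sum => x Fx; rewrite ler_wpM2l// ge0_ler_powR ?(ltW p0)//.
- by rewrite nnegrE local_sum_ge0.
- by rewrite nnegrE sumr_ge0// => j _; rewrite mulr_ge0// mass_ge0.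
rewrite /local_sum big_mkcond [leRHS]big_mkcond; apply: ler_sum => j _.
case: ifPn => [/and3P[Aj /eqP <- jx]|_]; first by rewrite top_le// jx.
by case: ifP => // _; rewrite mulr_ge0// mass_ge0.
Qed.

Lemma local_sum_child F H x : is_top F -> child F H -> anc H x ->
  local_sum F x = local_sum F H.
Proof.
move=> tF /and4P[tH FH HF _] Hx; apply: eq_bigl => j.
case Aj : (A j) => //=; case: eqP => //= jF; subst F.
apply/idP/idP => [jx|jH]; last exact: anc_trans Hx.
exact: (below_top A_gt0 Aj tH FH HF Hx jx).
Qed.

Lemma scaled_young (a b t : R) : 0 <= a -> 0 <= b -> 0 <= t ->
  t * (a * b) <= C * (t * (a / C) `^ p + t * b `^ q).
Proof.
move=> a0 b0 t0; have := @young _ (a / C) b p q.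
rewrite divr_ge0 ?(ltW C_gt0)// => /(_ erefl b0 p0 q0 pq) h.
rewrite -mulrDr [leRHS]mulrCA ler_wpM2l//.
have -> : a * b = C * (a / C * b) by field; rewrite gt_eqF.
by rewrite ler_wpM2l// ltW.
Qed.

(** Below a child [H] the local sum is constant, so [g] may be replaced there by
    its mean over [H]. Young's inequality then applies both on the exposed
    points and under the children, and the powers of the local sum recombine
    into a single sum below [F], which the testing condition bounds. *)
Lemma block_bound F : is_top F ->
  \sum_(x | anc F x) gu x * (mean s f F * local_sum F x) <=
  C * (mean s f F `^ p * mass s F + \sum_(x | exposed F x) g x `^ q * u x
       + \sum_(H | child F H) mean u g H `^ q * mass u H).
Proof.
move=> tF; have m0 : 0 <= mean s f F by rewrite mean_ge0.
have mC0 : 0 <= mean s f F / C by rewrite divr_ge0// ltW.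
pose phi x := u x * (mean s f F * local_sum F x / C) `^ p.
have phiF : \sum_(x | anc F x) phi x <= mean s f F `^ p * mass s F.
  have -> : \sum_(x | anc F x) phi x = (mean s f F / C) `^ p *
      \sum_(x | anc F x) u x * local_sum F x `^ p.
    rewrite mulr_sumr; apply: eq_bigr => x _.
    by rewrite /phi mulrAC [in LHS]powRM ?mC0 ?local_sum_ge0// mulrCA.
  apply: (le_trans
    (ler_wpM2l (powR_ge0 _ _) (local_sum_test F))).
  rewrite powRM ?invr_ge0 ?(ltW C_gt0)// mulrA -[X in X * _ <= _]mulrA.
  by rewrite -powRM ?invr_ge0 ?(ltW C_gt0)// mulVf ?gt_eqF// powR1 mulr1.
apply: (@le_trans _ _
  (C * (\sum_(x | anc F x) phi x + \sum_(x | exposed F x) g x `^ q * u x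
       + \sum_(H | child F H) mean u g H `^ q * mass u H))); last first.
  by rewrite ler_wpM2l ?(ltW C_gt0)// !lerD2r.
rewrite (child_split A (mean s f) F).
rewrite (child_split A (mean s f) F phi).
rewrite -addrA addrACA mulrDr lerD//.
  rewrite -big_split mulr_sumr; apply: ler_sum => x _.
  rewrite /phi [g x `^ q * _]mulrC.
  apply: (le_trans _ (scaled_young _ _ _)) => //.
    by rewrite le_eqVlt; apply/orP; left; apply/eqP; ring.
  by rewrite mulr_ge0 ?local_sum_ge0.
rewrite -big_split mulr_sumr; apply: ler_sum => H cH.
have -> : \sum_(x | anc H x) gu x * (mean s f F * local_sum F x) =
    \sum_(x | anc H x) u x * ((mean s f F * local_sum F x) * mean u g H).
  transitivity (mass gu H * (mean s f F * local_sum F H)).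
    rewrite mulr_suml; apply: eq_bigr => x Hx.
    by rewrite (local_sum_child tF cH Hx).
  transitivity (\sum_(x | anc H x)
      u x * (mean s f F * local_sum F H * mean u g H)).
    by rewrite -mulr_suml -/(mass u H) -mean_mass//; ring.
  by apply: eq_bigr => x Hx; rewrite (local_sum_child tF cH Hx).
have -> : mean u g H `^ q * mass u H =
    \sum_(x | anc H x) u x * mean u g H `^ q.
  by rewrite -mulr_suml mulrC.
rewrite -big_split mulr_sumr /=; apply: ler_sum => x _.
rewrite /phi; apply: scaled_young => //.
  by rewrite mulr_ge0 ?local_sum_ge0.
by rewrite mean_ge0.
Qed.

(** Summing over the tops, [A_dom] turns the means of [g] over the children into
    means of [f], and every top is the child of at most one other top, so that
    [packing] bounds everything by the integrals of the powers. *)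
Lemma half_form : \sum_(j | A j) al j * (mass fs j * mass gu j) <=
  2 * C * (2 * packing_cst p * \sum_x f x `^ p * s x
           + \sum_x g x `^ q * u x).
Proof.
have f_ge1 : forall x, 0 <= gu x by move=> x; rewrite mulr_ge0.
set E := \sum_(F | is_top F) mean s f F `^ p * mass s F.
have EP : E <= packing_cst p * \sum_x f x `^ p * s x by exact: packing.
apply: (@le_trans _ _ (2 * \sum_(F | is_top F)
    \sum_(x | anc F x) gu x * (mean s f F * local_sum F x))).
  rewrite (partition_big top is_top) => [|j Aj]; last exact: is_top_top.
  rewrite mulr_sumr; apply: ler_sum => F tF.
  under [X in _ <= 2 * X]eq_bigr do rewrite mulr_sumr mulr_sumr.
  rewrite (exchange_big_dep (fun j => A j && (top j == F)))/=; last first.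
    by move=> x j Fx /and3P[-> ->].
  rewrite mulr_sumr; apply: ler_sum => j /andP[Aj /eqP jF].
  have -> : \sum_(x | anc F x && [&& A j, top j == F & anc j x])
      gu x * (mean s f F * (al j * mass s j)) =
      mass gu j * (mean s f F * (al j * mass s j)).
    rewrite mulr_suml; apply: eq_bigl => x; rewrite Aj jF eqxx/=.
    by rewrite andb_idl// => jx; apply: anc_trans jx; rewrite -jF top_le.
  rewrite -(mean_mass _ s_ge0 f_ge0).
  rewrite [leLHS](_ : _ = mean s f j * (al j * mass s j * mass gu j)); last ring.
  rewrite [leRHS](_ : _ = 2 * mean s f F * (al j * mass s j * mass gu j)).
    rewrite ler_wpM2r ?mulr_ge0 ?mass_ge0// -jF.
    exact: le_h_top.
  by ring.
rewrite -mulrA ler_pM2l//.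
apply: (@le_trans _ _ (C * (E +
   \sum_(F | is_top F) \sum_(x | exposed F x) g x `^ q * u x +
   \sum_(F | is_top F) \sum_(H | child F H) mean u g H `^ q * mass u H))).
  rewrite /E -!big_split mulr_sumr; apply: ler_sum => F tF /=.
  exact: block_bound.
rewrite ler_pM2l// -addrA addrC -addrA.
have h1 : \sum_(F | is_top F) \sum_(x | exposed F x) g x `^ q * u x <=
    \sum_x g x `^ q * u x.
  rewrite (exchange_big_dep predT)//=; apply: ler_sum => x _.
  case: (pickP (fun F => is_top F && exposed F x)) => [F0 h|h]; last first.
    by rewrite big_pred0// mulr_ge0 ?powR_ge0.
  rewrite (big_pred1 F0)// => F; apply/idP/eqP => [h'|->//].
  case/andP: h => t e; case/andP: h' => t' e'.
  exact: (exposed_uniq t' t e' e).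
have h2 : \sum_(F | is_top F) \sum_(H | child F H) mean u g H `^ q * mass u H
    <= E.
  rewrite (exchange_big_dep is_top)/=; last by move=> F H _ /and4P[].
  apply: ler_sum => H tH.
  apply: (le_trans _ (A_dom (is_topA tH))).
  case: (pickP (fun F => is_top F && child F H)) => [F0 h|h]; last first.
    by rewrite big_pred0// mulr_ge0 ?powR_ge0 ?mass_ge0.
  rewrite (big_pred1 F0)// => F; apply/idP/eqP => [h'|->//].
  case/andP: h => t e; case/andP: h' => t' e'.
  exact: (child_parent_uniq t' t e' e).
lra.
Qed.

End half.

Definition testing_on (p : R) (al s u : I -> R) (C : R) : Prop :=
  forall i, \sum_(x | anc i x)
    u x * (\sum_(j | anc i j && anc j x) al j * mass s j) `^ p
  <= C `^ p * mass s i.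

Definition form_cst (p q : R) : R :=
  2 * (2 * packing_cst p + 1) + 2 * (2 * packing_cst q + 1).

Lemma form_cst_gt0 p q : 1 < p -> 1 < q -> 0 < form_cst p q.
Proof.
move=> p1 q1; rewrite /form_cst.
have := packing_cst_ge0 p1; have := packing_cst_ge0 q1; lra.
Qed.

Section two_weight.
Variables (p q : R) (al s u : I -> R) (C C' : R).
Hypothesis p_gt1 : 1 < p.
Hypothesis q_gt1 : 1 < q.
Hypothesis pq : p^-1 + q^-1 = 1.
Hypothesis C_gt0 : 0 < C.
Hypothesis C'_gt0 : 0 < C'.
Hypothesis al_ge0 : forall x, 0 <= al x.
Hypothesis s_ge0 : forall x, 0 <= s x.
Hypothesis u_ge0 : forall x, 0 <= u x.
Hypothesis test : testing_on p al s u C.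
Hypothesis test' : testing_on q al u s C'.

(** At every node one of the two quantities compared in [A_dom] dominates the
    other. The form is symmetric in [(f, s, p)] and [(g, u, q)], so each of the
    two resulting sums is an instance of [half_form]. *)
Lemma forest_form (f g : I -> R) :
  (forall x, 0 <= f x) -> (forall x, 0 <= g x) ->
  \sum_j al j * (mass (fun x => f x * s x) j * mass (fun x => g x * u x) j) <=
  form_cst p q * (C + C') * (\sum_x f x `^ p * s x + \sum_x g x `^ q * u x).
Proof.
move=> f0 g0; set X := \sum_x f x `^ p * s x; set Y := \sum_x g x `^ q * u x.
have X0 : 0 <= X by apply: sumr_ge0 => x _; rewrite mulr_ge0 ?powR_ge0.
have Y0 : 0 <= Y by apply: sumr_ge0 => x _; rewrite mulr_ge0 ?powR_ge0.
pose dom j :=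
  mean u g j `^ q * mass u j <= mean s f j `^ p * mass s j.
pose A j := (0 < mean s f j) && dom j.
pose B j := (0 < mean u g j) && ~~ dom j.
have qp : q^-1 + p^-1 = 1 by rewrite addrC.
have HA := @half_form p q al s u f g A C p_gt1 q_gt1 pq C_gt0 al_ge0 s_ge0
  u_ge0 f0 g0 test.
have HB := @half_form q p al u s g f B C' q_gt1 p_gt1 qp C'_gt0 al_ge0 u_ge0
  s_ge0 g0 f0 test'.
have {}HA : _ := HA (fun i Ai => proj1 (andP Ai)) (fun i Ai => proj2 (andP Ai)).
have {}HB : _ := HB (fun i Ai => proj1 (andP Ai)).
have {HB} /HB : forall i, B i ->
    mean s f i `^ p * mass s i <= mean u g i `^ q * mass u i.
  by move=> i /andP[_]; rewrite -ltNge => /ltW.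
rewrite -/X -/Y in HA * => HB.
apply: (@le_trans _ _
  (\sum_(j | A j) al j * (mass (fun x => f x * s x) j * mass (fun x => g x * u x) j)
  + \sum_(j | B j) al j * (mass (fun x => g x * u x) j * mass (fun x => f x * s x) j))).
  rewrite [X in _ <= X + _]big_mkcond [X in _ <= _ + X]big_mkcond -big_split.
  apply: ler_sum => j _ /=.
  have m1 : 0 <= mass (fun x => f x * s x) j.
    by apply: mass_ge0 => x; rewrite mulr_ge0.
  have m2 : 0 <= mass (fun x => g x * u x) j.
    by apply: mass_ge0 => x; rewrite mulr_ge0.
  rewrite [_ * mass (fun x => f x * s x) j]mulrC.
  have := mulr_ge0 (al_ge0 j) (mulr_ge0 m1 m2) => m3.
  rewrite /A /B; case: (dom j); rewrite ?andbT ?andbF.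
    case: ltP => h; first by rewrite addr0.
    rewrite -(mean_mass _ s_ge0 f0); suff -> : mean s f j = 0 by rewrite !mul0r mulr0 addr0.
    by apply/le_anti; rewrite h mean_ge0.
  case: ltP => h; first by rewrite add0r.
  rewrite -(mean_mass _ u_ge0 g0); suff -> : mean u g j = 0 by rewrite !mul0r !mulr0 addr0.
  by apply/le_anti; rewrite h mean_ge0.
apply: (le_trans (lerD HA HB)).
have cp := packing_cst_ge0 p_gt1; have cq := packing_cst_ge0 q_gt1.
have h1 : 2 * packing_cst p * X + Y <= (2 * packing_cst p + 1) * (X + Y).
  have := mulr_ge0 cp Y0; lra.
have h2 : 2 * packing_cst q * Y + X <= (2 * packing_cst q + 1) * (X + Y).
  have := mulr_ge0 cq X0; lra.
have XY : 0 <= X + Y by exact: addr_ge0.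
have g1 : 2 * C * (2 * packing_cst p * X + Y) <=
    2 * C * ((2 * packing_cst p + 1) * (X + Y)) by rewrite ler_pM2l// mulr_gt0.
have g2 : 2 * C' * (2 * packing_cst q * Y + X) <=
    2 * C' * ((2 * packing_cst q + 1) * (X + Y)) by rewrite ler_pM2l// mulr_gt0.
apply: (le_trans (lerD g1 g2)).
rewrite /form_cst.
have k1 : 0 <= C * (2 * (2 * packing_cst q + 1)) * (X + Y).
  by rewrite !mulr_ge0 ?(ltW C_gt0)//; lra.
have k2 : 0 <= C' * (2 * (2 * packing_cst p + 1)) * (X + Y).
  by rewrite !mulr_ge0 ?(ltW C'_gt0)//; lra.
lra.
Qed.

(** The form is tested on a multiple of the power [p - 1] of the operator
    applied to [f], with a constant small enough for the term in [g] to absorb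
    only half of the left-hand side. *)
Lemma forest_operator (f : I -> R) : (forall x, 0 <= f x) ->
  \sum_x u x * (\sum_(i | anc i x) al i * mass (fun x => f x * s x) i) `^ p <=
  (2 * (form_cst p q * (C + C'))) `^ p * \sum_x f x `^ p * s x.
Proof.
move=> f0; set K := form_cst p q * (C + C').
have K0 : 0 < K by rewrite mulr_gt0 ?form_cst_gt0// addr_gt0.
pose T x := \sum_(i | anc i x) al i * mass (fun x => f x * s x) i.
have T0 x : 0 <= T x.
  apply: sumr_ge0 => i _; rewrite mulr_ge0// mass_ge0// => y; exact: mulr_ge0.
rewrite -/T; set W := \sum_x u x * _; set X := \sum_x _.
have p0 : 0 < p := lt_trans ltr01 p_gt1.
have q0 : 0 < q := lt_trans ltr01 q_gt1.
have p10 : 0 < p - 1 by rewrite subr_gt0.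
have pq1 : (p - 1) * q = p.
  have : (p^-1 + q^-1) * (p * q) = p * q by rewrite pq mul1r.
  have -> : (p^-1 + q^-1) * (p * q) = p + q by field; rewrite !gt_eqF.
  by move=> h; rewrite mulrBl -h mul1r addrK.
have K20 : 0 < 2 * K by rewrite mulr_gt0.
(* This constant satisfies [K * c `^ q = c / 2]. *)
pose c := (2 * K) `^ (- (p - 1)).
have c0 : 0 < c by rewrite powR_gt0.
have := @forest_form f (fun x => c * T x `^ (p - 1)) f0.
rewrite -/K -/X => /(_ (fun x => mulr_ge0 (ltW c0) (powR_ge0 _ _))).
have -> : \sum_x (c * T x `^ (p - 1)) `^ q * u x = c `^ q * W.
  rewrite mulr_sumr; apply: eq_bigr => x _.
  by rewrite powRM ?powR_ge0 ?(ltW c0)// -powRrM pq1 -mulrA [_ * u x]mulrC.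
have -> : \sum_j al j * (mass (fun x => f x * s x) j *
    mass (fun x => c * T x `^ (p - 1) * u x) j) = c * W.
  rewrite mulr_sumr.
  under eq_bigr do rewrite mulrA {2}/mass mulr_sumr.
  rewrite (exchange_big_dep predT)//=; apply: eq_bigr => x _.
  rewrite -mulr_suml -/(T x) -(mulr_powRB1 (T0 x) p0); ring.
have cq : K * c `^ q = c / 2.
  rewrite /c -powRrM mulNr pq1 powRN powRN -(mulr_powRB1 (ltW K20) p0).
  by field; rewrite !gt_eqF// powR_gt0.
rewrite mulrDr mulrA cq => h.
have h2 : c * W <= 2 * K * X by lra.
rewrite -(ler_pM2l c0); apply: (le_trans h2).
suff ck : c * (2 * K) `^ p = 2 * K by rewrite [leRHS]mulrA ck.
rewrite /c powRN -(mulr_powRB1 (ltW K20) p0) mulrCA mulVf ?mulr1//.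
by rewrite gt_eqF// powR_gt0.
Qed.

(** The form needed when nodes are atoms of a partition: a function enters only
    through its masses [a], and Hoelder's inequality on an atom bounds [a] by
    the mass [e] of its power and by the mass [s] of the dual weight. *)
Theorem forest_two_weight (a e : I -> R) :
  (forall x, 0 <= a x) -> (forall x, 0 <= e x) ->
  (forall x, a x `^ p <= e x * s x `^ (p - 1)) ->
  \sum_x u x * (\sum_(i | anc i x) al i * mass a i) `^ p <=
  (2 * (form_cst p q * (C + C'))) `^ p * \sum_x e x.
Proof.
move=> a0 e0 ae.
have p0 : 0 < p := lt_trans ltr01 p_gt1.
have p10 : p - 1 != 0 by rewrite gt_eqF// subr_gt0.
have fs : (fun x => a x / s x * s x) = a.
  apply/funext => x; have [sx|sx] := eqVneq (s x) 0; last by rewrite divfK.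
  rewrite sx mulr0; apply/esym/(@powR_eq0_eq0 _ _ p)/le_anti.
  by rewrite powR_ge0 (le_trans (ae x))// sx powR0// mulr0.
have := @forest_operator (fun x => a x / s x).
rewrite fs => /(_ (fun x => divr_ge0 (a0 x) (s_ge0 x))) h.
apply: (le_trans h).
rewrite ler_wpM2l ?powR_ge0//; apply: ler_sum => x _.
have [sx|sx] := eqVneq (s x) 0; first by rewrite sx mulr0.
have sx0 : 0 < s x by rewrite lt_neqAle eq_sym sx s_ge0.
rewrite powRM ?invr_ge0// -(ler_pM2r (powR_gt0 (p - 1) sx0)).
apply: (le_trans _ (ae x)).
suff -> : a x `^ p * (s x)^-1 `^ p * s x * s x `^ (p - 1) = a x `^ p by [].
rewrite -[LHS]mulrA mulr_powRB1// -[LHS]mulrA -powRM ?invr_ge0//.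
by rewrite mulVf// powR1 mulr1.
Qed.

End two_weight.
End forest.

(** * The kernel on the disc *)

Section complex_plane.
Context {R : realType}.
Local Notation C := R[i].
Implicit Types z w : C.

Lemma measurable_reim : measurable_fun setT (@reim R).
Proof.
move=> _ A mA; rewrite setTI; exists A => //; by rewrite setTI.
Qed.

Lemma measurable_Re : measurable_fun setT (@complex.Re R).
Proof.
have -> : @complex.Re R = fst \o @reim R by [].
exact: measurableT_comp measurable_reim.
Qed.

Lemma measurable_Im : measurable_fun setT (@complex.Im R).
Proof.
have -> : @complex.Im R = snd \o @reim R by [].
exact: measurableT_comp measurable_reim.
Qed.

(** The Borel structure of the plane is pulled back from the real plane, so it
    suffices to pair the two coordinates, extended by zero outside [D]. *)
Lemma measurable_complex d (T : measurableType d) (D : set T) (f : T -> C) :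
  measurable_fun D (fun x => complex.Re (f x)) ->
  measurable_fun D (fun x => complex.Im (f x)) -> measurable_fun D f.
Proof.
move=> mRe mIm mD.
pose re := (fun x => complex.Re (f x)) \_ D.
pose im := (fun x => complex.Im (f x)) \_ D.
have mre : measurable_fun setT re by apply/(measurable_restrictT _ _).1.
have mim : measurable_fun setT im by apply/(measurable_restrictT _ _).1.
have mp : measurable_fun D (fun x => (re x, im x)).
  exact: measurable_funTS (measurable_fun_pair mre mim).
move=> _ [A mA <-]; rewrite setTI.
rewrite [X in measurable X](_ : _ = D `&` (fun x => (re x, im x)) @^-1` A).
  exact: mp.
rewrite /re /im; apply/seteqP; split=> x [Dx] /=; rewrite !patchE !mem_set//.
Qed.

Lemma normc_sqrt z : normc z = Num.sqrt (complex.Re z ^+ 2 + complex.Im z ^+ 2).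
Proof. by case: z. Qed.

Lemma measurable_normc : measurable_fun setT (@normc R).
Proof.
rewrite (_ : @normc R = fun z => Num.sqrt (complex.Re z ^+ 2 + complex.Im z ^+ 2)).
  apply: (measurableT_comp (continuous_measurable_fun (@sqrt_continuous R))).
  apply: measurable_funD; apply: measurable_funX.
    exact: measurable_Re.
  exact: measurable_Im.
by apply/funext => z; exact: normc_sqrt.
Qed.

Lemma normc_ge0 z : 0 <= normc z.
Proof. by rewrite normc_sqrt sqrtr_ge0. Qed.

Lemma normc_real (a : R) : normc a%:C%C = `|a|.
Proof. by rewrite normc_sqrt /= expr0n/= addr0 sqrtr_sqr. Qed.

Lemma normc_conj z : normc (z^*)%C = normc z.
Proof. by case: z => a b; rewrite !normc_sqrt /= sqrrN. Qed.

Lemma normc_le z : normc z <= `|complex.Re z| + `|complex.Im z|.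
Proof.
rewrite normc_sqrt -[leRHS]ger0_norm ?addr_ge0// -sqrtr_sqr ler_wsqrtr//.
rewrite -(real_normK (num_real (complex.Re z))).
rewrite -(real_normK (num_real (complex.Im z))).
have := normr_ge0 (complex.Re z); have := normr_ge0 (complex.Im z); nra.
Qed.

Lemma Re_le_normc z : `|complex.Re z| <= normc z.
Proof. by rewrite normc_sqrt -sqrtr_sqr ler_wsqrtr// lerDl sqr_ge0. Qed.

Lemma Im_le_normc z : `|complex.Im z| <= normc z.
Proof. by rewrite normc_sqrt -sqrtr_sqr ler_wsqrtr// lerDr sqr_ge0. Qed.

Lemma normcD z w : normc (z + w) <= normc z + normc w.
Proof. exact: (@le_normcD R z w). Qed.

Lemma normc_dist z w : normc z - normc w <= normc (z - w).
Proof. by rewrite lerBlDr (le_trans _ (normcD _ _))// subrK. Qed.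

Lemma measurable_invr : measurable_fun setT (fun x : R => x^-1).
Proof.
rewrite (_ : (fun x : R => x^-1) = fun x => x * (x ^+ 2) `^ (-1)).
  apply: measurable_funM => //; apply: (measurableT_comp (measurable_powR (-1))).
  exact: measurable_funX.
apply/funext => x; rewrite powR_inv1 ?sqr_ge0//.
by have [->|x0] := eqVneq x 0; [rewrite invr0 mul0r|field].
Qed.

Lemma measurable_disc : measurable (@disc R).
Proof.
rewrite (_ : disc = (@normc R) @^-1` `]-oo, 1[%classic).
  by rewrite -[X in measurable X]setTI; exact: measurable_normc.
by apply/seteqP; split=> z; rewrite /disc /= in_itv.
Qed.

End complex_plane.

Section kernel.
Context {R : realType}.
Local Notation C := R[i].
Variables (gamma : R) (nu : {measure set R -> \bar R}).
Hypothesis gamma_ge1 : 1 <= gamma.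
Local Notation I01 := (`[(0:R), (1:R)]%classic : set R).

Definition resolvent (w : C) (r : R) : C := (1 - r%:C%C * w)^-1.

Section at_w.
Variable w : C.
Hypothesis w_lt1 : normc w < 1.
Let t := normc (1 - w).

Lemma dist1_gt0 : 0 < normc (1 - w).
Proof.
rewrite lt_neqAle normc_ge0 andbT eq_sym; apply/eqP => /eq0_normc.
move/eqP; rewrite subr_eq0 => /eqP w1; move: w_lt1.
by rewrite -w1 normc1 ltxx.
Qed.

Lemma dist1_le2 : normc (1 - w) <= 2.
Proof.
rewrite (le_trans (normcD _ _))// normcN normc1.
by have := ltW w_lt1; lra.
Qed.

Lemma denom_le r : 0 <= r <= 1 -> normc (1 - r%:C%C * w) <= 1 - r + t.
Proof.
move=> /andP[r0 r1].
have -> : 1 - r%:C%C * w = (1 - r)%:C%C + r%:C%C * (1 - w).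
  by rewrite rmorphB rmorph1; ring.
rewrite (le_trans (normcD _ _))// normcM !normc_real.
rewrite ger0_norm ?subr_ge0// ger0_norm// lerD2l.
by rewrite ler_piMl// normc_ge0.
Qed.

(** [1 - r] is a lower bound because [w] lies in the disc, and then the triangle
    inequality bounds [|1 - w|] by twice [|1 - r w|]. *)
Lemma denom_ge r : 0 <= r <= 1 -> (1 - r + t) / 3 <= normc (1 - r%:C%C * w).
Proof.
move=> /andP[r0 r1].
have h1 : 1 - r <= normc (1 - r%:C%C * w).
  have := normc_dist 1 (r%:C%C * w).
  rewrite normc1 normcM normc_real.
  rewrite ger0_norm//; apply: le_trans; rewrite lerD2l lerN2.
  by rewrite ler_piMr// ltW.
have h2 : t <= normc (1 - r%:C%C * w) + (1 - r).
  rewrite /t; have -> : 1 - w = (1 - r%:C%C * w) + - ((1 - r)%:C%C * w).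
    by rewrite rmorphB rmorph1; ring.
  rewrite (le_trans (normcD _ _))// normcN normcM normc_real.
  rewrite ger0_norm ?subr_ge0// lerD2l ler_piMr ?subr_ge0//.
  exact: ltW.
lra.
Qed.

Lemma denom_gt0 r : 0 <= r <= 1 -> 0 < normc (1 - r%:C%C * w).
Proof.
move=> r01; apply: lt_le_trans (denom_ge r01).
by have := dist1_gt0; rewrite -/t; move: r01 => /andP[]; lra.
Qed.

Lemma resolventE r : resolvent w r =
  let N := (1 - r * complex.Re w) ^+ 2 + (r * complex.Im w) ^+ 2 in
  ((1 - r * complex.Re w) / N +i* (r * complex.Im w / N))%C.
Proof.
rewrite /resolvent; case: w => a b /=.
have -> : 1 - r%:C%C * (a +i* b)%C = ((1 - r * a) +i* (- (r * b)))%C.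
  apply/eqP; rewrite eq_complex /=; apply/andP; split; apply/eqP; ring.
rewrite /GRing.inv/= sqrrN; apply/eqP; rewrite eq_complex /= eqxx /=.
by rewrite mulNr opprK.
Qed.

Lemma resolvent_Re_ge0 r : 0 <= r <= 1 -> 0 <= complex.Re (resolvent w r).
Proof.
move=> /andP[r0 r1]; rewrite resolventE /= divr_ge0//; last first.
  by rewrite addr_ge0 ?sqr_ge0.
rewrite subr_ge0.
have h : complex.Re w <= 1.
  by rewrite (le_trans (ler_norm _))// (le_trans (Re_le_normc _))// ltW.
nra.
Qed.

Lemma resolvent_norm r : normc (resolvent w r) = (normc (1 - r%:C%C * w))^-1.
Proof. exact: normcV. Qed.

Lemma resolvent_le r : 0 <= r <= 1 -> normc (resolvent w r) <= 3 * (1 - r + t)^-1.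
Proof.
move=> r01; have := denom_ge r01; have := denom_gt0 r01; rewrite resolvent_norm.
have := dist1_gt0; rewrite -/t; move: r01 => /andP[r0 r1].
move=> t0 m0 h; rewrite -[3]invrK -invfM lef_pV2 ?posrE//; first lra.
by rewrite mulr_gt0//; lra.
Qed.

Lemma resolvent_ge r : 0 <= r <= 1 -> (1 - r + t)^-1 <= normc (resolvent w r).
Proof.
move=> r01; have := denom_le r01; have := denom_gt0 r01; rewrite resolvent_norm.
by move=> m0 h; rewrite lef_pV2 ?posrE//; apply: lt_le_trans h.
Qed.

End at_w.

Definition resolvent_mass (t : R) : R := \int[nu]_(r in I01) (1 - r + t)^-1.

Section finite_nu.
Hypothesis nu_fin : (nu I01 < +oo)%E.

Lemma measurable_I01 : measurable (I01 : set R).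
Proof. exact: measurable_itv. Qed.

Lemma measurable_dist (t : R) : measurable_fun I01 (fun r : R => (1 - r + t)^-1).
Proof.
apply: (measurableT_comp measurable_invr).
by apply: measurable_funD => //; apply: measurable_funB.
Qed.

Lemma bounded_integrable (f : R -> R) (M : R) : measurable_fun I01 f ->
  (forall r, 0 <= r <= 1 -> `|f r| <= M) -> nu.-integrable I01 (EFin \o f).
Proof.
move=> mf fM; apply: measurable_bounded_integrable => //.
exists M; split; first exact: num_real.
move=> K MK r /=; rewrite in_itv /= => r01; exact: le_trans (fM _ r01) (ltW MK).
Qed.

Lemma dist_integrable (t : R) : 0 < t ->
  nu.-integrable I01 (EFin \o (fun r : R => (1 - r + t)^-1)).
Proof.
move=> t0; apply: (@bounded_integrable _ t^-1) => [|r /andP[r0 r1]].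
  exact: measurable_dist.
have h : 0 < 1 - r + t by lra.
by rewrite ger0_norm ?invr_ge0 ?(ltW h)// lef_pV2 ?posrE//; lra.
Qed.

Lemma resolvent_mass_ge0 t : 0 < t -> 0 <= resolvent_mass t.
Proof.
move=> t0; apply: Rintegral_ge0 => r /=; rewrite in_itv /= => /andP[r0 r1].
by rewrite invr_ge0; lra.
Qed.

Lemma resolvent_mass_anti t t' : 0 < t -> t <= t' ->
  resolvent_mass t' <= resolvent_mass t.
Proof.
move=> t0 tt'; apply: le_Rintegral => //.
- by apply: dist_integrable; lra.
- exact: dist_integrable.
move=> r /=; rewrite in_itv /= => /andP[r0 r1].
by rewrite lef_pV2 ?posrE; lra.
Qed.

Lemma resolvent_mass_dilate t l : 0 < t -> 1 <= l ->
  l^-1 * resolvent_mass t <= resolvent_mass (l * t).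
Proof.
move=> t0 l1; rewrite -RintegralZl//; last exact: dist_integrable.
apply: le_Rintegral => //.
- rewrite (_ : EFin \o _ = (fun x => l^-1%:E * ((1 - x + t)^-1)%:E)%E).
    by apply: integrableZl => //; exact: dist_integrable.
  by apply/funext => x.
- by apply: dist_integrable; rewrite mulr_gt0//; lra.
move=> r /=; rewrite in_itv /= => /andP[r0 r1].
have lt0 : 0 < l * t by rewrite mulr_gt0//; lra.
have : 0 <= (l - 1) * (1 - r) by rewrite mulr_ge0; lra.
by rewrite -invfM lef_pV2 ?posrE ?mulr_gt0//; lra.
Qed.

(** The modulus of the kernel is comparable with the value of this decreasing
    function at the distance of [conj z * w] to 1. *)
Definition kernel_profile (t : R) : R := t `^ (- gamma) * resolvent_mass t.

Lemma kernel_profile_ge0 t : 0 < t -> 0 <= kernel_profile t.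
Proof. by move=> t0; rewrite mulr_ge0 ?powR_ge0 ?resolvent_mass_ge0. Qed.

Lemma kernel_profile_anti t t' : 0 < t -> t <= t' ->
  kernel_profile t' <= kernel_profile t.
Proof.
move=> t0 tt'; rewrite ler_pM ?powR_ge0 ?resolvent_mass_ge0 //; first lra.
  rewrite !powRN lef_pV2 ?posrE ?powR_gt0//; last lra.
  rewrite ge0_ler_powR ?nnegrE//; [exact: le_trans gamma_ge1|exact: ltW|exact: le_trans (ltW t0) _].
exact: resolvent_mass_anti.
Qed.

Lemma kernel_profile_dilate t l : 0 < t -> 1 <= l ->
  kernel_profile t <= l `^ (gamma + 1) * kernel_profile (l * t).
Proof.
move=> t0 l1; have l0 : 0 < l by lra.
rewrite /kernel_profile powRM ?(ltW l0) ?(ltW t0)//.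
have := ler_wpM2l (powR_ge0 t (- gamma)) (resolvent_mass_dilate t0 l1).
set a := t `^ _; set J := resolvent_mass t; set J' := resolvent_mass _.
move=> h; have := ler_wpM2l (ltW l0) h.
have -> : l * (a * (l^-1 * J)) = a * J by field; rewrite gt_eqF.
move=> {}h.
apply: (le_trans h).
have -> : l `^ (gamma + 1) = l * l `^ gamma.
  rewrite -mulr_powRB1 ?addrK ?(ltW l0)//.
  by rewrite addr_gt0// (lt_le_trans ltr01).
rewrite powRN le_eqVlt; apply/orP; left; apply/eqP; field.
by rewrite gt_eqF// powR_gt0.
Qed.

(** The factor 2 comes from the power of [t] alone, as [gamma >= 1]. It makes
    the partial sums of the dyadic coefficients behave like their last term. *)
Lemma kernel_profile_halve t : 0 < t ->
  2 * kernel_profile (2 * t) <= kernel_profile t.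
Proof.
move=> t0; have h1 : resolvent_mass (2 * t) <= resolvent_mass t.
  by apply: resolvent_mass_anti; lra.
rewrite /kernel_profile powRM ?(ltW t0)// mulrA mulrA.
rewrite ler_pM ?mulr_ge0 ?powR_ge0 ?resolvent_mass_ge0 ?mulr_gt0//.
rewrite ler_piMl ?powR_ge0// powRN ler_pdivrMr ?powR_gt0// mul1r.
by rewrite le1r_powR// ler1n.
Qed.

Definition dyadic_coef (n : nat) : R := kernel_profile (2 ^- n).

Lemma dyadic_coef_ge0 n : 0 <= dyadic_coef n.
Proof. by rewrite kernel_profile_ge0// invr_gt0 exprn_gt0. Qed.

Lemma sum_dyadic_coef m :
  \sum_(n < m.+1) dyadic_coef n <= 2 * dyadic_coef m.
Proof.
elim: m => [|m IH].
  by rewrite big_ord1; have := dyadic_coef_ge0 0; lra.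
rewrite big_ord_recr /=; have := @kernel_profile_halve (2 ^- m.+1).
rewrite invr_gt0 exprn_gt0// => /(_ erefl).
have -> : 2 * 2 ^- m.+1 = 2 ^- m :> R by rewrite exprS invfM mulrA divff ?mul1r.
by rewrite -!/(dyadic_coef _); lra.
Qed.


Lemma measurable_resolvent_Re (w : C) :
  measurable_fun I01 (fun r => complex.Re (resolvent w r)).
Proof.
rewrite (_ : (fun r => _) = (fun r => (1 - r * complex.Re w) *
   ((1 - r * complex.Re w) ^+ 2 + (r * complex.Im w) ^+ 2)^-1)); last first.
  by apply/funext => r; rewrite resolventE.
apply: measurable_funM.
  by apply: measurable_funB => //; exact: measurable_funM.
apply: (measurableT_comp measurable_invr); apply: measurable_funD => //.
  apply: measurable_funX.
  by apply: measurable_funB => //; exact: measurable_funM.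
by apply: measurable_funX; exact: measurable_funM.
Qed.

Lemma measurable_resolvent_Im (w : C) :
  measurable_fun I01 (fun r => complex.Im (resolvent w r)).
Proof.
rewrite (_ : (fun r => _) = (fun r => (r * complex.Im w) *
   ((1 - r * complex.Re w) ^+ 2 + (r * complex.Im w) ^+ 2)^-1)); last first.
  by apply/funext => r; rewrite resolventE.
apply: measurable_funM.
  exact: measurable_funM.
apply: (measurableT_comp measurable_invr); apply: measurable_funD => //.
  apply: measurable_funX.
  by apply: measurable_funB => //; exact: measurable_funM.
by apply: measurable_funX; exact: measurable_funM.
Qed.

Section cint.
Variable w : C.
Hypothesis w_lt1 : normc w < 1.
Let t := normc (1 - w).
Let t_gt0 : 0 < t. Proof. exact: dist1_gt0. Qed.

Lemma dist_resolvent_mass (k : R) :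
  \int[nu]_(r in I01) (k * (1 - r + t)^-1) = k * resolvent_mass t.
Proof. by rewrite RintegralZl//; exact: dist_integrable. Qed.

Lemma dist_integrableZ (k : R) :
  nu.-integrable I01 (EFin \o (fun r : R => k * (1 - r + t)^-1)).
Proof.
rewrite (_ : EFin \o _ = (fun x => k%:E * ((1 - x + t)^-1)%:E)%E).
  by apply: integrableZl => //; exact: dist_integrable.
by apply/funext => x.
Qed.

Lemma dominated_resolvent (f : R -> R) : measurable_fun I01 f ->
  (forall r, 0 <= r <= 1 -> `|f r| <= normc (resolvent w r)) ->
  nu.-integrable I01 (EFin \o f).
Proof.
move=> mf fN; apply: (@bounded_integrable _ (3 * t^-1)) => // r r01.
apply: (le_trans (fN _ r01)); apply: (le_trans (resolvent_le w_lt1 r01)).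
rewrite ler_pM2l// -/t; move: r01 => /andP[r0 r1].
have h : 0 < 1 - r + t by have := t_gt0; lra.
by rewrite lef_pV2 ?posrE//; lra.
Qed.

Lemma Re_integrable :
  nu.-integrable I01 (EFin \o (fun r => complex.Re (resolvent w r))).
Proof.
apply: dominated_resolvent => [|r _]; last exact: Re_le_normc.
exact: measurable_resolvent_Re.
Qed.

Lemma Im_integrable :
  nu.-integrable I01 (EFin \o (fun r => complex.Im (resolvent w r))).
Proof.
apply: dominated_resolvent => [|r _]; last exact: Im_le_normc.
exact: measurable_resolvent_Im.
Qed.

Lemma absIm_integrable :
  nu.-integrable I01 (EFin \o (fun r => `|complex.Im (resolvent w r)|)).
Proof.
apply: dominated_resolvent => [|r _]; last by rewrite normr_id Im_le_normc.
by apply: measurableT_comp => //; exact: measurable_resolvent_Im.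
Qed.

(** The imaginary part of [1 / (1 - r w)] has the sign of that of [w] for every
    [r], so there is no cancellation in its integral. *)
Lemma integral_abs_Im : `|\int[nu]_(r in I01) complex.Im (resolvent w r)| =
  \int[nu]_(r in I01) `|complex.Im (resolvent w r)|.
Proof.
have [w0|w0] := leP 0 (complex.Im w).
  rewrite ger0_norm.
    apply: eq_Rintegral => r; rewrite inE/= in_itv /= => /andP[r0 r1].
    by rewrite ger0_norm// resolventE /= divr_ge0 ?mulr_ge0// addr_ge0 ?sqr_ge0.
  apply: Rintegral_ge0 => r; rewrite /= in_itv /= => /andP[r0 r1].
  by rewrite resolventE /= divr_ge0 ?mulr_ge0// addr_ge0 ?sqr_ge0.
have ImN r : 0 <= r -> complex.Im (resolvent w r) <= 0.
  move=> r0; rewrite resolventE /= mulr_le0_ge0 ?invr_ge0 ?addr_ge0 ?sqr_ge0//.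
  by rewrite mulr_ge0_le0// ltW.
have -> : \int[nu]_(r in I01) `|complex.Im (resolvent w r)| =
   - \int[nu]_(r in I01) complex.Im (resolvent w r).
  rewrite -mulN1r -RintegralZl//; last exact: Im_integrable.
  apply: eq_Rintegral => r; rewrite inE/= in_itv /= => /andP[r0 r1].
  by rewrite mulN1r ler0_norm// ImN.
apply: ler0_norm; rewrite -oppr_ge0 -mulN1r -RintegralZl//; last exact: Im_integrable.
apply: Rintegral_ge0 => r; rewrite /= in_itv /= => /andP[r0 r1].
by rewrite mulN1r oppr_ge0 ImN.
Qed.

Lemma cintegral_resolvent_le :
  normc (cintegral nu I01 (resolvent w)) <= 6 * resolvent_mass t.
Proof.
apply: (le_trans (normc_le _)); rewrite /= integral_abs_Im.
have h1 : `|\int[nu]_(r in I01) complex.Re (resolvent w r)| <=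
    3 * resolvent_mass t.
  rewrite ger0_norm; last first.
    apply: Rintegral_ge0 => r; rewrite /= in_itv /= => r01.
    exact: resolvent_Re_ge0.
  rewrite -dist_resolvent_mass; apply: le_Rintegral => //.
  - exact: Re_integrable.
  - exact: dist_integrableZ.
  move=> r /=; rewrite in_itv /= => r01.
  rewrite (le_trans _ (resolvent_le w_lt1 r01))//.
  by rewrite (le_trans (ler_norm _))// Re_le_normc.
have h2 : \int[nu]_(r in I01) `|complex.Im (resolvent w r)| <=
    3 * resolvent_mass t.
  rewrite -dist_resolvent_mass; apply: le_Rintegral => //.
  - exact: absIm_integrable.
  - exact: dist_integrableZ.
  move=> r /=; rewrite in_itv /= => r01.
  by rewrite (le_trans _ (resolvent_le w_lt1 r01))// Im_le_normc.
by lra.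
Qed.

(** The values of the resolvent all lie in one quadrant; the modulus of their
    integral is then comparable with the integral of their moduli. *)
Lemma cintegral_resolvent_ge :
  resolvent_mass t <= 2 * normc (cintegral nu I01 (resolvent w)).
Proof.
have h : resolvent_mass t <=
    \int[nu]_(r in I01) complex.Re (resolvent w r) +
    \int[nu]_(r in I01) `|complex.Im (resolvent w r)|.
  rewrite -RintegralD//; [|exact: Re_integrable|exact: absIm_integrable].
  apply: le_Rintegral => //.
  - exact: dist_integrable.
  - have := integrableD measurable_I01 Re_integrable absIm_integrable.
    by apply: eq_integrable => // x _ /=; rewrite EFinD.
  move=> r /=; rewrite in_itv /= => r01.
  rewrite (le_trans (resolvent_ge w_lt1 r01))// (le_trans (normc_le _))//.
  by rewrite ger0_norm// resolvent_Re_ge0.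
rewrite -integral_abs_Im in h.
have := Re_le_normc (cintegral nu I01 (resolvent w)).
have := Im_le_normc (cintegral nu I01 (resolvent w)).
rewrite /= => h2 h3.
have := ler_norm (\int[nu]_(r in I01) complex.Re (resolvent w r)).
by lra.
Qed.

End cint.

Lemma normc_expi (x : R) : normc (expi x) = 1.
Proof. by rewrite normc_sqrt /= cos2Dsin2 sqrtr1. Qed.

Lemma normc_cpowR (w : C) (a : R) : normc (cpowR w a) = normc w `^ a.
Proof.
rewrite /cpowR normcM normc_real normc_expi mulr1.
by rewrite ger0_norm// powR_ge0.
Qed.

(** The represented kernel, as a function of the product of the conjugate of
    the first variable with the second one. *)
Definition model_kernel (w : C) : C :=
  (cpowR (1 - w) gamma)^-1 * cintegral nu I01 (resolvent w).

Lemma normc_model_kernel w : normc (model_kernel w) =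
  normc (1 - w) `^ (- gamma) * normc (cintegral nu I01 (resolvent w)).
Proof.
rewrite normcM normcV normc_cpowR.
by rewrite powRN.
Qed.

Lemma model_kernel_le w : normc w < 1 ->
  normc (model_kernel w) <= 6 * kernel_profile (normc (1 - w)).
Proof.
move=> w1; rewrite normc_model_kernel mulrCA ler_wpM2l ?powR_ge0//.
exact: cintegral_resolvent_le.
Qed.

Lemma model_kernel_ge w : normc w < 1 ->
  kernel_profile (normc (1 - w)) <= 2 * normc (model_kernel w).
Proof.
move=> w1; rewrite normc_model_kernel mulrCA ler_wpM2l ?powR_ge0//.
exact: cintegral_resolvent_ge.
Qed.

Lemma model_kernel_conj w : normc w < 1 ->
  normc (model_kernel (w^*)%C) = normc (model_kernel w).
Proof.
move=> w1; rewrite !normc_model_kernel.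
have -> : 1 - (w^*)%C = ((1 - w)^*)%C by rewrite rmorphB rmorph1.
rewrite normc_conj; congr (_ * _).
rewrite !normc_sqrt/=; congr (Num.sqrt (_ + _)).
  congr (_ ^+ 2); apply: eq_Rintegral => r _; rewrite !resolventE /=.
  by case: w {w1} => a b /=; rewrite mulrN sqrrN.
rewrite -[LHS]real_normK ?num_real// -[RHS]real_normK ?num_real//.
congr (_ ^+ 2); rewrite !integral_abs_Im ?normc_conj//.
apply: eq_Rintegral => r _; rewrite !resolventE /=.
by case: w {w1} => a b /=; rewrite mulrN sqrrN mulNr normrN.
Qed.

End finite_nu.
End kernel.

Section kernel_measurable.
Context {R : realType}.
Local Notation C := R[i].
Variables (gamma : R) (nu : {measure set R -> \bar R}).
Local Notation I01 := (`[(0:R), (1:R)]%classic : set R).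
Hypothesis nu_fin : (nu I01 < +oo)%E.

Definition pairing (q : C * C) : C := ((q.1)^*)%C * q.2.

Lemma normc_pairing q : (disc `*` disc) q -> normc (pairing q) < 1.
Proof.
move=> -[/= d1 d2]; rewrite /pairing normcM normc_conj.
have := normc_ge0 q.1; have := normc_ge0 q.2; rewrite /disc /= in d1 d2; nra.
Qed.

Lemma measurable_pairing : measurable_fun setT pairing.
Proof.
have m1 : measurable_fun setT (fun q : C * C => complex.Re q.1).
  exact: (measurableT_comp measurable_Re measurable_fst).
have m2 : measurable_fun setT (fun q : C * C => complex.Im q.1).
  exact: (measurableT_comp measurable_Im measurable_fst).
have m3 : measurable_fun setT (fun q : C * C => complex.Re q.2).
  exact: (measurableT_comp measurable_Re measurable_snd).
have m4 : measurable_fun setT (fun q : C * C => complex.Im q.2).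
  exact: (measurableT_comp measurable_Im measurable_snd).
apply: measurable_complex.
  rewrite (_ : (fun _ => _) = (fun q : C * C =>
      complex.Re q.1 * complex.Re q.2 + complex.Im q.1 * complex.Im q.2)).
    by apply: measurable_funD; exact: measurable_funM.
  by apply/funext => -[[a b] [c e]] /=; rewrite mulNr opprK.
rewrite (_ : (fun _ => _) = (fun q : C * C =>
    complex.Re q.1 * complex.Im q.2 - complex.Im q.1 * complex.Re q.2)).
  by apply: measurable_funB; exact: measurable_funM.
by apply/funext => -[[a b] [c e]] /=; rewrite mulNr.
Qed.

Lemma measurable_resolvent_pairing :
  measurable_fun setT (fun q : (C * C) * R => resolvent (pairing q.1) q.2).
Proof.
have mp : measurable_fun setT (fun q : (C * C) * R => pairing q.1).
  exact: (measurableT_comp measurable_pairing measurable_fst).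
have mr : measurable_fun setT (fun q : (C * C) * R => q.2) by exact: measurable_snd.
have mRe : measurable_fun setT
    (fun q : (C * C) * R => q.2 * complex.Re (pairing q.1)).
  apply: measurable_funM => //; exact: (measurableT_comp measurable_Re mp).
have mIm : measurable_fun setT
    (fun q : (C * C) * R => q.2 * complex.Im (pairing q.1)).
  apply: measurable_funM => //; exact: (measurableT_comp measurable_Im mp).
have mN : measurable_fun setT (fun q : (C * C) * R =>
    ((1 - q.2 * complex.Re (pairing q.1)) ^+ 2
     + (q.2 * complex.Im (pairing q.1)) ^+ 2)^-1).
  apply: (measurableT_comp measurable_invr); apply: measurable_funD.
    by apply: measurable_funX; apply: measurable_funB.
  exact: measurable_funX.
apply: measurable_complex.
  rewrite (_ : (fun _ => _) = (fun q : (C * C) * R =>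
    (1 - q.2 * complex.Re (pairing q.1)) *
    ((1 - q.2 * complex.Re (pairing q.1)) ^+ 2
     + (q.2 * complex.Im (pairing q.1)) ^+ 2)^-1)).
    by apply: measurable_funM => //; apply: measurable_funB.
  by apply/funext => q; rewrite resolventE.
rewrite (_ : (fun _ => _) = (fun q : (C * C) * R =>
    (q.2 * complex.Im (pairing q.1)) *
    ((1 - q.2 * complex.Re (pairing q.1)) ^+ 2
     + (q.2 * complex.Im (pairing q.1)) ^+ 2)^-1)).
  exact: measurable_funM.
by apply/funext => q; rewrite resolventE.
Qed.

(** Tonelli's theorem applies to the real part, which is nonnegative, and to the
    absolute value of the imaginary part, which is all that the modulus of the
    integral sees. *)
Lemma measurable_model_kernel : measurable_fun (disc `*` disc)
  (fun q => normc (model_kernel gamma nu (pairing q))).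
Proof.
have mDD : measurable ((@disc R) `*` (@disc R)).
  by apply: measurableX; exact: measurable_disc.
pose A1 (q : C * C) := (\int[nu]_(r in I01) (complex.Re (resolvent (pairing q) r))%:E)%E.
pose A2 (q : C * C) := (\int[nu]_(r in I01) (`|complex.Im (resolvent (pairing q) r)|)%:E)%E.
have mA1 : measurable_fun (disc `*` disc) A1.
  apply: (measurable_integral_param mDD (measurable_itv _) nu_fin
    (F := fun q => (complex.Re (resolvent (pairing q.1) q.2))%:E)).
    apply/measurable_EFinP; apply: measurable_funTS.
    exact: (measurableT_comp measurable_Re measurable_resolvent_pairing).
  move=> [q r] [/= Dq]; rewrite in_itv /= => r01; rewrite lee_fin.
  by apply: resolvent_Re_ge0 => //; exact: normc_pairing.
have mA2 : measurable_fun (disc `*` disc) A2.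
  apply: (measurable_integral_param mDD (measurable_itv _) nu_fin
    (F := fun q => (`|complex.Im (resolvent (pairing q.1) q.2)|)%:E)).
    apply/measurable_EFinP; apply: measurable_funTS.
    apply: measurableT_comp => //.
    exact: (measurableT_comp measurable_Im measurable_resolvent_pairing).
  by move=> [q r] _ /=; rewrite lee_fin.
apply: (@eq_measurable_fun _ _ _ _ _ (fun q => normc (1 - pairing q) `^ (- gamma) *
    Num.sqrt (fine (A1 q) ^+ 2 + fine (A2 q) ^+ 2))).
  move=> q; rewrite inE => Dq; have w1 := normc_pairing Dq.
  rewrite normc_model_kernel normc_sqrt; congr (_ * Num.sqrt (_ + _)).
  by rewrite -[RHS]real_normK ?num_real// /= integral_abs_Im.
apply: measurable_funM.
  apply: measurable_funTS; apply: (measurableT_comp (measurable_powR _)).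
  apply: (measurableT_comp measurable_normc).
  apply: measurable_complex.
    rewrite (_ : (fun _ => _) = (fun q => 1 - complex.Re (pairing q))).
      apply: measurable_funB => //.
      exact: (measurableT_comp measurable_Re measurable_pairing).
    by apply/funext => q; case: (pairing q).
  rewrite (_ : (fun _ => _) = (fun q => 0 - complex.Im (pairing q))).
    apply: measurable_funB => //.
    exact: (measurableT_comp measurable_Im measurable_pairing).
  by apply/funext => q; case: (pairing q).
apply: (measurableT_comp (continuous_measurable_fun (@sqrt_continuous R))).
apply: measurable_funD; apply: measurable_funX.
  exact: (measurableT_comp (fine_measurable measurableT)).
exact: (measurableT_comp (fine_measurable measurableT)).
Qed.

End kernel_measurable.

(** * Dyadic grids of the line *)

Section digits.
Context {R : realType}.
Implicit Types (x y : R) (n j : nat).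

(** The position of [x] modulo 1 among the [2 ^ n] dyadic intervals of level
    [n]. *)
Definition digit n x : nat := Num.truncn (2 ^+ n * (x - (Num.floor x)%:~R)).

Lemma frac_itv x : 0 <= x - (Num.floor x)%:~R < 1.
Proof.
have /andP[h1 h2] := floor_itv x; rewrite subr_ge0 h1 /=.
by rewrite ltrBlDl -intrD1.
Qed.

Lemma digit_itv n x : let k := (Num.floor x)%:~R in
  2 ^+ n * k + (digit n x)%:R <= 2 ^+ n * x < 2 ^+ n * k + (digit n x)%:R + 1.
Proof.
rewrite /=; have /andP[f0 f1] := frac_itv x.
have /truncn_itv : 0 <= 2 ^+ n * (x - (Num.floor x)%:~R).
  by rewrite mulr_ge0// exprn_ge0.
rewrite -/(digit n x) -natr1 => /andP[h1 h2].
rewrite mulrBr in h1 h2; apply/andP; split; lra.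
Qed.

Lemma digit_lt n x : (digit n x < 2 ^ n)%N.
Proof.
have /andP[f0 f1] := frac_itv x.
rewrite truncn_lt_nat ?mulr_ge0 ?exprn_ge0// natrX.
by rewrite gtr_pMr// exprn_gt0.
Qed.

Lemma digitP n x j : (j < 2 ^ n)%N -> (digit n x = j <->
  exists k : int, 2 ^+ n * k%:~R + j%:R <= 2 ^+ n * x < 2 ^+ n * k%:~R + j%:R + 1).
Proof.
move=> jn; split => [<-|[k /andP[h1 h2]]].
  by exists (Num.floor x); exact: digit_itv.
have p0 : (0 : R) < 2 ^+ n by rewrite exprn_gt0.
have kx : Num.floor x = k.
  apply: floor_def; apply/andP; split.
    by rewrite -(ler_pM2l p0); have := ler0n R j; lra.
  rewrite -(ltr_pM2l p0) rmorphD/= mulrDr mulr1; apply: (lt_le_trans h2).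
  rewrite -addrA lerD2l -[2 ^+ n](natrX R 2 n) -[_ + 1](natrD R j 1) ler_nat; lia.
rewrite /digit kx; apply: truncn_def; rewrite -natr1 mulrBr.
apply/andP; split; lra.
Qed.

Lemma digit_int n x (k : int) : digit n (x + k%:~R) = digit n x.
Proof.
apply/(digitP _ (digit_lt n x)); exists (Num.floor x + k).
have /andP[h1 h2] := digit_itv n x.
rewrite rmorphD /= !mulrDr; apply/andP; split; lra.
Qed.

Lemma digit_floor n x y : Num.floor (2 ^+ n * x) = Num.floor (2 ^+ n * y) ->
  digit n x = digit n y.
Proof.
move=> e; apply/esym/(digitP _ (digit_lt n x)); exists (Num.floor x).
have h := digit_itv n x; set k := Num.floor x in h *.
pose z : int := (2 ^ n)%N%:Z * k + (digit n x)%:Z.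
have zE : z%:~R = 2 ^+ n * k%:~R + (digit n x)%:R :> R.
  by rewrite /z rmorphD rmorphM /= -!pmulrn natrX.
have fx : Num.floor (2 ^+ n * x) = z.
  by apply: floor_def; rewrite intrD1 zE.
have := floor_itv (2 ^+ n * y); rewrite -e fx intrD1 zE.
by [].
Qed.

Lemma digit0 x : digit 0 x = 0%N.
Proof. by have := digit_lt 0 x; rewrite expn0 ltnS leqn0 => /eqP. Qed.

Lemma digitS n x : digit n x = (digit n.+1 x %/ 2)%N.
Proof.
have l1 := digit_lt n.+1 x.
apply/digitP; first by rewrite expnS in l1; lia.
exists (Num.floor x); have /andP[h1 h2] := digit_itv n.+1 x.
set d := digit n.+1 x in h1 h2 l1 *; set k := (Num.floor x)%:~R in h1 h2 *.
rewrite exprS -mulrA -mulrA in h1 h2.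
set X := 2 ^+ n * x in h1 h2 *; set K := 2 ^+ n * k in h1 h2 *.
have e1 : (2 * (d %/ 2))%:R <= d%:R :> R by rewrite ler_nat; lia.
have e2 : d%:R + 1 <= (2 * (d %/ 2) + 2)%:R :> R.
  by rewrite -(natrD R d 1) ler_nat; lia.
rewrite natrM in e1; rewrite natrD natrM in e2.
apply/andP; split; lra.
Qed.

Lemma digit_shift n m x : (n <= m)%N -> digit n x = (digit m x %/ 2 ^ (m - n))%N.
Proof.
move=> /subnKC <-; rewrite addKn; elim: (m - n)%N => [|k IH].
  by rewrite addn0 expn0 divn1.
by rewrite IH addnS (digitS (n + k)) -divnMA expnS.
Qed.

Lemma floor_neq_witness (X Y : R) : X <= Y -> Num.floor X != Num.floor Y ->
  exists k : int, X < k%:~R <= Y.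
Proof.
move=> XY ne; exists (Num.floor Y).
have /andP[-> _] := floor_itv Y; rewrite andbT.
have /andP[_ h] := floor_itv X; apply: (lt_le_trans h).
by rewrite ler_int lezD1 lt_neqAle ne le_floor.
Qed.

(** The one-third trick. An endpoint of the grid and an endpoint of the grid
    shifted by a third are at least a third of the mesh apart, because 3 does
    not divide [2 ^ n]; so two closer points are never separated by both. *)
Lemma one_third n x y : `|y - x| < 2 ^- n / 3 ->
  digit n x = digit n y \/ digit n (x + 3^-1) = digit n (y + 3^-1).
Proof.
wlog xy : x y / x <= y.
  move=> wl h; have [xy|xy] := leP x y; first exact: wl.
  rewrite distrC in h; have [->|->] := wl _ _ (ltW xy) h; by [left|right].
rewrite ger0_norm ?subr_ge0// => h.
have p0 : (0 : R) < 2 ^+ n by rewrite exprn_gt0.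
have h2 : 2 ^+ n * y - 2 ^+ n * x < 3^-1.
  rewrite -mulrBr -(ltr_pM2l p0) in h *.
  by rewrite mulrA divff ?gt_eqF// mul1r in h.
have [e|ne] := eqVneq (Num.floor (2 ^+ n * x)) (Num.floor (2 ^+ n * y)).
  by left; exact: digit_floor.
have [e'|ne'] := eqVneq (Num.floor (2 ^+ n * (x + 3^-1)))
    (Num.floor (2 ^+ n * (y + 3^-1))).
  by right; exact: digit_floor.
have [|k /andP[k1 k2]] := floor_neq_witness _ ne; first by rewrite ler_pM2l.
have [|l /andP[l1 l2]] := floor_neq_witness _ ne'.
  by rewrite ler_pM2l// lerD2r.
rewrite mulrDr in l1 l2; rewrite mulrDr in l2.
have a1 : 3 * l%:~R - 3 * k%:~R - 2 ^+ n < 1 :> R by lra.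
have a2 : -1 < 3 * l%:~R - 3 * k%:~R - 2 ^+ n :> R by lra.
have e3 : 3 * l%:~R - 3 * k%:~R - 2 ^+ n = (3 * l - 3 * k - (2 ^ n)%N%:Z)%:~R :> R.
  by rewrite !rmorphB !rmorphM /= -!pmulrn natrX.
rewrite e3 in a1 a2.
have {}a1 : 3 * l - 3 * k - (2 ^ n)%N%:Z < 1.
  by rewrite -(ltr_int R).
have {}a2 : -1 < 3 * l - 3 * k - (2 ^ n)%N%:Z.
  by rewrite -(ltr_int R) rmorphN.
have : (3 %| 2 ^ n)%N by lia.
by rewrite Euclid_dvdX// => /andP[].
Qed.

Lemma measurable_digit n j : measurable [set x : R | digit n x = j].
Proof.
have [jn|jn] := ltnP j (2 ^ n); last first.
  rewrite (_ : [set _ | _] = set0) //; apply/seteqP; split=> // x /= e.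
  by have := digit_lt n x; rewrite e ltnNge jn.
have p0 : (0 : R) < 2 ^+ n by rewrite exprn_gt0.
rewrite (_ : [set _ | _] = \bigcup_(k : int)
  `[(2 ^+ n * k%:~R + j%:R) / 2 ^+ n,
    (2 ^+ n * k%:~R + j%:R + 1) / 2 ^+ n[%classic); last first.
  apply/seteqP; split=> x /=.
    move=> /(digitP _ jn)[k h]; exists k => //=.
    by rewrite in_itv /= ler_pdivrMr// ltr_pdivlMr// [x * _]mulrC.
  move=> [k _]; rewrite /= in_itv /= ler_pdivrMr// ltr_pdivlMr// [x * _]mulrC.
  by move=> h; apply/(digitP _ jn); exists k.
apply: countable_bigcupT_measurable => [|k]; last exact: measurable_itv.
exact: countableP.
Qed.

End digits.

(** * Dyadic squares of the disc *)

Section angle.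
Context {R : realType}.
Local Notation C := R[i].
Implicit Types (z w : C) (x y : R).

Lemma expiD x y : expi (x + y) = expi x * expi y.
Proof.
apply/eqP; rewrite eq_complex /= cosD sinD; apply/andP; split; apply/eqP; ring.
Qed.

Lemma expiN x : expi (- x) = ((expi x)^*)%C.
Proof. by rewrite /expi cosN sinN. Qed.

Lemma expi_period x (k : int) : expi (x + 2 * pi * k%:~R) = expi x.
Proof.
have step y : expi (y + 2 * pi) = expi y.
  rewrite /expi; have -> : 2 * pi = pi *+ 2 :> R by rewrite mulr_natl.
  by rewrite cosD2pi sinD2pi.
have pos (n : nat) y : expi (y + 2 * pi * n%:R) = expi y.
  elim: n y => [|n IH] y; first by rewrite mulr0 addr0.
  by rewrite -(natr1 n) mulrDr mulr1 addrA step.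
case: k => n; first exact: pos.
rewrite NegzE -(pos n.+1); congr expi.
by rewrite rmorphN /= -pmulrn; ring.
Qed.

Lemma reduce_angle x : exists k : int, - pi <= x + 2 * pi * k%:~R <= pi.
Proof.
have p0 : 0 < 2 * pi :> R by rewrite mulr_gt0// pi_gt0.
exists (- Num.floor ((x + pi) / (2 * pi))).
have /andP[h1 h2] := floor_itv ((x + pi) / (2 * pi)).
rewrite intrD1 in h2; rewrite ler_pdivlMr// in h1; rewrite ltr_pdivrMr// in h2.
rewrite rmorphN /=; set k := (Num.floor _)%:~R in h1 h2 *.
rewrite mulrN; have := mulrC (2 * pi) k => ->.
apply/andP; split; lra.
Qed.

Lemma expi_eq1 x : expi x = 1 -> exists k : int, x = 2 * pi * k%:~R.
Proof.
move=> x1; have [k /andP[k1 k2]] := reduce_angle x; exists (- k).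
have : expi (x + 2 * pi * k%:~R) = 1 by rewrite expi_period.
set y := x + _ in k1 k2 *.
case=> cy sy.
have : `|y| = 0.
  apply: cos_inj; rewrite ?in_itv/= ?lexx ?pi_ge0 ?normr_ge0//=.
    by rewrite ler_norml k1 k2.
  by rewrite cos_norm cos0 cy.
move/eqP; rewrite normr_eq0 => /eqP y0.
by rewrite rmorphN /= mulrN; apply/eqP; rewrite -addr_eq0 -/y y0.
Qed.

Lemma expi_inj x y : expi x = expi y -> exists k : int, x = y + 2 * pi * k%:~R.
Proof.
move=> e; have /expi_eq1[k h] : expi (x - y) = 1.
  rewrite expiD e -expiD subrr; apply/eqP.
  by rewrite eq_complex /= cos0 sin0 !eqxx.
by exists k; rewrite -h addrC subrK.
Qed.

Lemma cos_arg_itv z : -1 <= complex.Re z / normc z <= 1.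
Proof.
have [->|z0] := eqVneq (normc z) 0; first by rewrite invr0 mulr0; apply/andP; split; lra.
have zp : 0 < normc z by rewrite lt_neqAle eq_sym z0 normc_ge0.
by rewrite -ler_norml normrM normfV (gtr0_norm zp) ler_pdivrMr// mul1r Re_le_normc.
Qed.

Lemma polar_form z : z = (normc z)%:C%C * expi (carg z).
Proof.
have [z0|z0] := eqVneq (normc z) 0.
  by rewrite z0 mul0r; exact: eq0_normc.
have zp : 0 < normc z by rewrite lt_neqAle eq_sym z0 normc_ge0.
have ca := cos_arg_itv z.
have sq : normc z * Num.sqrt (1 - (complex.Re z / normc z) ^+ 2) = `|complex.Im z|.
  rewrite -{1}[normc z]gtr0_norm// -sqrtr_sqr -sqrtrM ?sqr_ge0//.
  rewrite mulrBr mulr1 -exprMn mulrC divfK// -sqrtr_sqr; congr Num.sqrt.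
  rewrite normc_sqrt sqr_sqrtr ?addr_ge0 ?sqr_ge0//.
  by rewrite addrC addKr.
have cs : cos (carg z) = complex.Re z / normc z.
  by rewrite /carg; case: ifPn => _; rewrite ?cosN acosK.
have sn : normc z * sin (carg z) = complex.Im z.
  rewrite /carg; case: ifPn => h; rewrite ?sinN sin_acos// ?mulrN sq.
    by rewrite ger0_norm.
  by rewrite ltr0_norm ?opprK// ltNge.
apply/eqP; rewrite eq_complex /= cs sn mul0r subr0 mul0r addr0.
by rewrite mulrC divfK// !eqxx.
Qed.

Lemma measurable_acos : measurable_fun `[(-1 : R), 1]%classic (@acos R).
Proof.
have -> : `[(-1 : R), 1]%classic = [set -1] `|` (`]-1, 1[%classic `|` [set 1]) :> set R.
  apply/seteqP; split=> x /=; rewrite !in_itv /=.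
    move=> /andP[h1 h2]; have [->|n1] := eqVneq x (-1); first by left.
    have [->|n2] := eqVneq x 1; first by right; right.
    by right; left; rewrite !lt_neqAle h1 h2 eq_sym n1 n2.
  move=> [->|[/andP[? ?]|->]]; apply/andP; split; lra.
apply/measurable_funU => //.
  by apply: measurableU => //; exact: measurable_itv.
split; first exact: measurable_fun_set1.
apply/measurable_funU => //; split; last exact: measurable_fun_set1.
apply: open_continuous_measurable_fun; first exact: interval_open.
move=> x; rewrite inE /= in_itv /= => h; exact: continuous_acos.
Qed.

Lemma measurable_carg : measurable_fun setT (@carg R).
Proof.
have macos : measurable_fun setT (fun z : C => acos (complex.Re z / normc z)).
  apply: (@measurable_comp _ _ _ _ _ _ `[(-1 : R), 1]%classic (@acos R)) => //.
  - by move=> _ [z _ <-] /=; rewrite in_itv /=; exact: cos_arg_itv.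
  - exact: measurable_acos.
  apply: measurable_funM; first exact: measurable_Re.
  exact: (measurableT_comp measurable_invr measurable_normc).
rewrite /carg; apply: measurable_fun_ifT => //.
  apply: measurable_fun_ler => //; exact: measurable_Im.
by apply: measurableT_comp.
Qed.

Lemma carg_polar (r x : R) : 0 < r ->
  exists k : int, carg (r%:C%C * expi x) = x + 2 * pi * k%:~R.
Proof.
move=> r0; set z := _ * _.
have nz : normc z = r.
  by rewrite /z normcM normc_real normc_expi mulr1 gtr0_norm.
apply: expi_inj.
have := polar_form z; rewrite nz {1}/z => /mulfI -> //.
by rewrite eq_complex /= negb_and gt_eqF.
Qed.

Lemma sin_lip x : `|sin x| <= `|x|.
Proof.
wlog x0 : x / 0 <= x.
  move=> wl; have [|x0] := leP 0 x; first exact: wl.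
  by rewrite -normrN -sinN -[leRHS]normrN wl// oppr_ge0 ltW.
have [|c _] := @MVT_segment R sin cos 0 x x0.
  by apply: continuous_subspaceT => y; exact: continuous_sin.
rewrite sin0 !subr0 => ->; rewrite normrM ler_piMl//.
by rewrite ler_norml cos_le1 cos_geN1.
Qed.

Lemma cos_lip x : `|1 - cos x| <= `|x|.
Proof.
wlog x0 : x / 0 <= x.
  move=> wl; have [|x0] := leP 0 x; first exact: wl.
  by rewrite -cosN -[leRHS]normrN wl// oppr_ge0 ltW.
have [|c _] := @MVT_segment R cos (fun y => - sin y) 0 x x0.
  by apply: continuous_subspaceT => y; exact: continuous_cos.
rewrite cos0 !subr0 distrC => ->; rewrite normrM ler_piMl// normrN.
by rewrite ler_norml sin_le1 sin_geN1.
Qed.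

Lemma chord_le x : normc (1 - expi x) <= 2 * `|x|.
Proof.
apply: (le_trans (normc_le _)); rewrite /= sub0r normrN.
by have := sin_lip x; have := cos_lip x; lra.
Qed.

(** Clear beyond [pi / 2], where the cosine is nonpositive; the duplication
    formula carries the estimate from [2 * x] to [x]. *)
Lemma versine_ge x : `|x| <= pi -> x ^+ 2 / pi ^+ 2 <= 1 - cos x.
Proof.
have pi0 := pi_gt0 R.
wlog x0 : x / 0 < x.
  move=> wl; have [->|x0] := eqVneq x 0.
    by rewrite expr0n /= mul0r cos0 subrr.
  have [h|h] := ltP 0 x; first exact: wl.
  by rewrite -normrN -[cos x]cosN -sqrrN; apply: wl; rewrite oppr_gt0 lt_neqAle x0.
rewrite gtr0_norm//.
have big y : pi / 2 <= y -> y <= pi -> y ^+ 2 / pi ^+ 2 <= 1 - cos y.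
  move=> y1 y2; have c0 : cos y <= 0.
    rewrite -oppr_ge0 -cosDpi -[y + pi](subrK (2 * pi)).
    have -> : 2 * pi = pi *+ 2 :> R by rewrite mulr_natl.
    rewrite cosD2pi; apply: cos_ge0_pihalf; rewrite -mulr_natl.
    apply/andP; split; lra.
  rewrite (@le_trans _ _ 1)//; last by lra.
  rewrite ler_pdivrMr ?exprn_gt0// mul1r ler_sqr// nnegrE; lra.
have [n] : exists n : nat, pi / 2 <= 2 ^+ n * x.
  exists (Num.bound (pi / 2 / x)).
  have h := archi_boundP (ltW (divr_gt0 (divr_gt0 pi0 (ltr0n R 2)) x0)).
  rewrite -ler_pdivrMr//; apply: ltW; apply: (lt_trans h).
  by rewrite -natrX ltr_nat ltn_expl.
elim: n x x0 => [|n IH] x x0 hn hpi; first by apply: big => //; rewrite expr0 mul1r in hn.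
have [hx|hx] := leP (pi / 2) x; first exact: big.
have : (2 * x) ^+ 2 / pi ^+ 2 <= 1 - cos (2 * x).
  apply: IH; [lra| |lra].
  by rewrite mulrCA mulrA -exprS.
have -> : cos (2 * x) = cos x ^+ 2 *+ 2 - 1 by rewrite mulr_natl cos_mulr2n.
rewrite exprMn -mulrA.
have c1 := cos_le1 x; have c2 := cos_geN1 x.
have h : 1 - (cos x ^+ 2 *+ 2 - 1) <= 4 * (1 - cos x).
  by rewrite -mulr_natl; nra.
by move=> h2; lra.
Qed.

(** The argument measured in turns, so that dyadic arcs become dyadic
    intervals. *)
Definition ang z : R := carg z / (2 * pi).

Let tpi : 0 < 2 * pi :> R. Proof. by rewrite mulr_gt0// pi_gt0. Qed.

Lemma ang_scale z w (k : R) :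
  2 * pi * (ang w - ang z + k) = carg w - carg z + 2 * pi * k.
Proof.
rewrite /ang; have tne : 2 * pi != 0 :> R by rewrite gt_eqF.
have h x : 2 * pi * (x / (2 * pi)) = x by rewrite mulrC divfK.
by rewrite mulrDr mulrBr !h.
Qed.

Lemma measurable_ang : measurable_fun setT ang.
Proof. by apply: measurable_funM => //; exact: measurable_carg. Qed.

Definition height n z : Prop := disc z /\ 1 - 2 ^- n <= normc z.

Definition dig (s : R) n z : nat := digit n (ang z + s).

(** The shift [s] rotates the grid. The only square of level 0 is the whole
    disc, with the origin. *)
Definition dyadic_square (s : R) n j : set C :=
  [set z | height n z /\ dig s n z = j].

Lemma invX2_le1 n : (2 ^- n : R) <= 1.
Proof. by rewrite invf_le1 ?exprn_gt0// exprn_ege1// ler1n. Qed.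

Lemma invX2_gt0 n : 0 < (2 ^- n : R).
Proof. by rewrite invr_gt0 exprn_gt0. Qed.

Lemma height_zero n : 1 - 2 ^- n <= (0 : R) -> n = 0%N.
Proof.
case: n => // n; rewrite exprS invfM => h; exfalso; have := invX2_le1 n; lra.
Qed.

Lemma dyadic_square_carleson s n j : (j < 2 ^ n)%N ->
  carleson_square (dyadic_square s n j).
Proof.
move=> jn; have p0 : (0 : R) < 2 ^+ n by rewrite exprn_gt0.
pose a : R := 2 * pi * (j%:R / 2 ^+ n - s).
pose b : R := 2 * pi * ((j%:R + 1) / 2 ^+ n - s).
exists (expi @` [set` Interval (BSide true a) (BSide true b)]), (2 ^- n).
have ba : b - a = 2 * pi * 2 ^- n by rewrite /a /b; ring.
split.
  exists a, b, true, true; split=> //.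
    rewrite -subr_gt0 ba mulr_gt0 ?invX2_gt0//= -lerBlDl ba.
    by rewrite ler_piMr ?invX2_le1// ltW.
  by rewrite ba mulrC mulKf// gt_eqF.
have itvP (x : R) : (x \in Interval (BSide true a) (BSide true b)) =
    (j%:R <= 2 ^+ n * (x / (2 * pi) + s) < j%:R + 1).
  rewrite in_itv /= /a /b.
  have -> : (2 * pi * (j%:R / 2 ^+ n - s) <= x) =
      (j%:R <= 2 ^+ n * (x / (2 * pi) + s)).
    rewrite -ler_pdivlMl// lerBlDr ler_pdivrMr// [x / _]mulrC.
    by rewrite [_ * 2 ^+ n]mulrC.
  have -> // : (x < 2 * pi * ((j%:R + 1) / 2 ^+ n - s)) =
      (2 ^+ n * (x / (2 * pi) + s) < j%:R + 1).
  rewrite -ltr_pdivrMl// ltrBrDr ltr_pdivlMr// [x / _]mulrC.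
  by rewrite [_ * 2 ^+ n]mulrC.
apply/seteqP; split => z /=.
  move=> [[z1 z2] /(digitP _ jn)[k hk]].
  exists (normc z), (expi (carg z)); split; first by rewrite z2.
    exists (carg z - 2 * pi * k%:~R); last first.
      by rewrite -mulrN -rmorphN expi_period.
    rewrite /= itvP mulrBl [2 * pi * _ / _]mulrAC divff ?gt_eqF// mul1r.
    rewrite addrAC mulrBr -/(ang z); move: hk => /andP[hk1 hk2].
    apply/andP; split; lra.
  exact: polar_form.
move=> [r [e [/andP[r1 r2] [x]]]]; rewrite itvP => xab xe ze.
have r0 : 0 <= r by have := invX2_le1 n; lra.
have nz : normc z = r.
  by rewrite ze -xe normcM normc_real normc_expi mulr1 ger0_norm.
split; first by rewrite /height /disc /= nz.
have [r00|rn0] := eqVneq r 0.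
  rewrite r00 in r1; have n0 := height_zero r1.
  by move: jn; rewrite /dig n0 digit0 expn0; case: (j).
have rp : 0 < r by rewrite lt_neqAle eq_sym rn0.
have [k hk] := carg_polar x rp; apply/(digitP _ jn); exists k.
rewrite /ang ze -xe hk mulrDl [2 * pi * _ / _]mulrAC divff ?gt_eqF// mul1r.
rewrite addrAC mulrDr; move: xab => /andP[h1 h2].
by apply/andP; split; lra.
Qed.

Lemma pairing_polar z w : (z^*)%C * w =
  (normc z * normc w)%:C%C * expi (carg w - carg z).
Proof.
transitivity ((((normc z)%:C * expi (carg z))^*)%C *
   ((normc w)%:C%C * expi (carg w))); first by rewrite -!polar_form.
rewrite expiD expiN; move: (normc z) (normc w) (expi (carg z)) (expi (carg w)).
move=> r q [a b] [c d]; apply/eqP; rewrite eq_complex /=.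
by apply/andP; split; apply/eqP; ring.
Qed.

Lemma norm_lt1_mul (a b : R) : 0 <= a < 1 -> 0 <= b < 1 -> 0 <= a * b <= 1.
Proof. by move=> /andP[? ?] /andP[? ?]; apply/andP; split; nra. Qed.

Lemma dyadic_square_dist s n z w : height n z -> height n w ->
  dig s n z = dig s n w -> normc (1 - (z^*)%C * w) <= 32 * 2 ^- n.
Proof.
move=> [z1 z2] [w1 w2] e; have p0 : (0 : R) < 2 ^+ n by rewrite exprn_gt0.
have jn := digit_lt n (ang z + s).
have [k hk] : exists k : int, `|ang w - ang z - k%:~R| <= 2 ^- n.
  have [k1 h1] := (digitP _ jn).1 erefl.
  have [k2 h2] := (digitP _ jn).1 (esym e).
  exists (k2 - k1); rewrite -(ler_pM2l p0) divff ?gt_eqF//.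
  rewrite -[X in X * _]gtr0_norm// -normrM rmorphB.
  move: h1 h2 => /andP[h1 h1'] /andP[h2 h2'].
  by rewrite ler_norml; apply/andP; split; lra.
have {}hk : `|carg w - carg z + 2 * pi * (- k)%:~R| <= 8 * 2 ^- n.
  have -> : carg w - carg z + 2 * pi * (- k)%:~R =
      2 * pi * (ang w - ang z - k%:~R).
    by rewrite rmorphN -ang_scale.
  rewrite normrM gtr0_norm//; apply: ler_pM => //; first exact: ltW.
  by have := @pihalf_lt2 R; lra.
rewrite pairing_polar -(expi_period _ (- k)).
set d := _ + _ * (- k)%:~R in hk *; set rho := normc z * normc w.
have zn := normc_ge0 z; have wn := normc_ge0 w; rewrite /disc /= in z1 w1.
have rho01 : 0 <= rho <= 1 by apply: norm_lt1_mul; rewrite ?zn ?wn.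
have rho1 : 1 - rho <= 2 * 2 ^- n by rewrite /rho; nra.
have -> : 1 - rho%:C%C * expi d = (1 - rho)%:C%C + rho%:C%C * (1 - expi d).
  by rewrite rmorphB rmorph1; ring.
apply: (le_trans (normcD _ _)).
rewrite normcM !normc_real.
move: rho01 => /andP[r0 r1]; rewrite !ger0_norm ?subr_ge0//.
have ch := chord_le d; have := normc_ge0 (1 - expi d) => ch0.
have : rho * normc (1 - expi d) <= normc (1 - expi d) by rewrite ler_piMl.
have := invX2_gt0 n.
lra.
Qed.

Lemma one_sub_norm_le_dist z w : disc z -> disc w ->
  1 - normc z <= normc (1 - (z^*)%C * w) /\ 1 - normc w <= normc (1 - (z^*)%C * w).
Proof.
rewrite /disc /= => z1 w1; have zn := normc_ge0 z; have wn := normc_ge0 w.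
have := normc_dist 1 ((z^*)%C * w).
rewrite normc1 normcM normc_conj => h.
by split; apply: le_trans h; nra.
Qed.

(** Replacing the modulus of [conj z * w] by 1 moves the point by at most its
    distance to 1, so the chord is at most twice that distance; and a chord
    controls the angle by [versine_ge]. *)
Lemma angle_le_dist z w : disc z -> disc w ->
  exists k : int, `|ang w - ang z + k%:~R| <= normc (1 - (z^*)%C * w).
Proof.
move=> z1 w1; have [k hk] := reduce_angle (carg w - carg z); exists k.
have zn := normc_ge0 z; have wn := normc_ge0 w.
have -> : ang w - ang z + k%:~R =
    (carg w - carg z + 2 * pi * k%:~R) / (2 * pi).
  by rewrite -ang_scale [RHS]mulrAC divff ?mul1r ?gt_eqF.
rewrite pairing_polar -(expi_period _ k).
set d := _ + _ * k%:~R in hk *; set rho := normc z * normc w.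
rewrite normrM normfV (gtr0_norm tpi) ler_pdivrMr//.
rewrite /disc /= in z1 w1.
have rho01 : 0 <= rho <= 1 by apply: norm_lt1_mul; rewrite ?zn ?wn.
set t := normc _.
have t1 : 1 - rho <= t.
  have := normc_dist 1 (rho%:C%C * expi d); rewrite -/t.
  rewrite normc1 normcM normc_expi mulr1.
  by rewrite normc_real ger0_norm//; case/andP: rho01.
have t2 : normc (1 - expi d) <= 2 * t.
  have -> : 1 - expi d = (1 - rho%:C%C * expi d) + - ((1 - rho)%:C%C * expi d).
    by rewrite rmorphB rmorph1; ring.
  apply: (le_trans (normcD _ _)).
  rewrite normcN normcM normc_expi mulr1 normc_real -/t.
  rewrite ger0_norm; last by rewrite subr_ge0; case/andP: rho01.
  lra.
have vers := versine_ge (x := d); rewrite ler_norml hk in vers.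
have {}vers := vers erefl.
have pi0 := pi_gt0 R.
have t3 : (`|d| / pi) ^+ 2 <= (2 * t) ^+ 2.
  rewrite expr_div_n real_normK ?num_real//.
  apply: (le_trans vers); apply: (@le_trans _ _ (normc (1 - expi d) ^+ 2)).
    rewrite normc_sqrt /= sqr_sqrtr ?addr_ge0 ?sqr_ge0//.
    by have := cos2Dsin2 d; have := cos_le1 d; nra.
  by rewrite ler_sqr ?nnegrE ?normc_ge0// mulr_ge0// normc_ge0.
rewrite ler_sqr ?nnegrE ?divr_ge0 ?(ltW pi0)// in t3; last first.
  by rewrite mulr_ge0// normc_ge0.
by rewrite ler_pdivrMr// in t3; lra.
Qed.

(** The first level [n] satisfying the inequality works: both points are close
    enough to the circle for the squares of level [n], and their angles differ
    by less than a third of the mesh. *)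
Lemma adjacent_squares z w : disc z -> disc w -> exists n : nat,
  [/\ 2 ^- n <= 8 * normc (1 - (z^*)%C * w), height n z, height n w &
     dig 0 n z = dig 0 n w \/ dig 3^-1 n z = dig 3^-1 n w].
Proof.
move=> z1 w1; set t := normc _.
have [tz tw] := one_sub_norm_le_dist z1 w1; rewrite -/t in tz tw.
have t0 : 0 < t by rewrite /disc /= in z1; lra.
have ex_n : exists n, 2 ^- n <= 8 * t.
  exists (Num.bound (8 * t)^-1).
  rewrite -[leRHS]invrK lef_pV2 ?posrE ?exprn_gt0 ?invr_gt0 ?mulr_gt0//.
  have h8 : 0 <= (8 * t)^-1 by rewrite invr_ge0 mulr_ge0// ltW.
  apply/ltW/(lt_trans (archi_boundP h8)).
  by rewrite -natrX ltr_nat ltn_expl.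
case: (ex_minnP ex_n) => n hn nmin; exists n; case: n hn nmin => [|n] hn nmin.
  split=> //; rewrite /height ?expr0 ?invr1 ?subrr ?normc_ge0//.
  by left; rewrite /dig !digit0.
have big : 8 * t < 2 * 2 ^- n.+1.
  rewrite exprS invfM mulrA divff// mul1r ltNge; apply/negP => /nmin.
  by rewrite ltnn.
split=> //; [split=> //; lra|split=> //; lra|].
have [k hk] := angle_le_dist z1 w1.
have hd : `|(ang w + k%:~R) - ang z| < 2 ^- n.+1 / 3.
  rewrite addrAC; apply: (le_lt_trans hk); rewrite -/t; lra.
rewrite /dig !addr0 -(digit_int _ (ang w) k).
rewrite -(digit_int _ (ang w + 3^-1) k) [ang w + 3^-1 + _]addrAC.
exact: one_third.
Qed.

Lemma measurable_height n : measurable [set z | height n z].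
Proof.
rewrite (_ : [set _ | _] = disc `&` (@normc R) @^-1` `[1 - 2 ^- n, +oo[%classic).
  apply: measurableI; first exact: measurable_disc.
  by rewrite -[X in measurable X]setTI; exact: measurable_normc.
by apply/seteqP; split=> z /=; rewrite /height in_itv /= andbT.
Qed.

Lemma measurable_dig s n j : measurable [set z | dig s n z = j].
Proof.
rewrite (_ : [set _ | _] = (fun z => ang z + s) @^-1` [set x | digit n x = j])//.
rewrite -[X in measurable X]setTI.
suff m : measurable_fun setT (fun z => ang z + s).
  by apply: m => //; exact: measurable_digit.
by apply: measurable_funD => //; exact: measurable_ang.
Qed.

Lemma measurable_dyadic_square s n j : measurable (dyadic_square s n j).
Proof.
by apply: measurableI; [exact: measurable_height|exact: measurable_dig].
Qed.

(** Away from the origin membership is read off the argument, up to the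
    countably many multiples of [2 * pi]; the origin belongs to the square only
    over a full circle. *)
Lemma measurable_carleson_square (S : set C) : carleson_square S -> measurable S.
Proof.
move=> [I [l [[a [b [ca [cb [ab lE IE]]]]] SE]]].
have l1 : l <= 1.
  by rewrite lE ler_pdivrMr// mul1r; case/andP: ab => _; lra.
pose J := Interval (BSide ca a) (BSide cb b).
pose U := \bigcup_(k : int) (fun z => carg z + 2 * pi * k%:~R) @^-1` [set` J].
pose V := (@normc R) @^-1` `[1 - l, 1[%classic.
have mnormc X : measurable X -> measurable ((@normc R) @^-1` X).
  by move=> mX; rewrite -[X in measurable X]setTI; exact: measurable_normc.
have mU : measurable U.
  apply: countable_bigcupT_measurable => [|k]; first exact: countableP.
  rewrite -[X in measurable X]setTI.
  suff m : measurable_fun setT (fun z => carg z + 2 * pi * k%:~R).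
    by apply: m => //; exact: measurable_itv.
  by apply: measurable_funD => //; exact: measurable_carg.
have m0 : measurable [set z : C | normc z = 0].
  by apply: (mnormc [set 0]); exact: measurable_set1.
have V0 : l = 1 -> S 0.
  move=> l1'; rewrite SE /=; exists 0, (expi ((a + b) / 2)); split.
  - by rewrite l1' subrr lexx ltr01.
  - rewrite IE; exists ((a + b) / 2) => //=.
    case/andP: ab => ab _.
    by case: ca {IE J U mU} ; case: cb; rewrite in_itv /=; apply/andP; split; lra.
  - by rewrite mul0r.
have -> : S = (V `&` U `&` [set z | normc z <> 0]) `|`
    (if l == 1 then [set z | normc z = 0] else set0).
  apply/seteqP; split=> z.
    rewrite SE => -[r [e [/andP[r1 r2] Ie ze]]].
    have r0 : 0 <= r by lra.
    move: Ie; rewrite IE => -[x xJ xe].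
    have nz : normc z = r.
      by rewrite ze -xe normcM normc_real normc_expi mulr1 ger0_norm.
    have [r00|rn0] := eqVneq r 0.
      right; rewrite r00 in r1; have -> : l == 1 by rewrite eq_le l1; lra.
      by rewrite /= nz.
    left; split; last by rewrite /= nz; exact/eqP.
    split; first by rewrite /V /= in_itv /= nz r1.
    have rp : 0 < r by rewrite lt_neqAle eq_sym rn0.
    have [k hk] := carg_polar x rp; exists (- k) => //=.
    by rewrite ze -xe hk rmorphN /= mulrN addrK.
  move=> [[[zV [k _ zk]] _]|].
    rewrite SE; exists (normc z), (expi (carg z + 2 * pi * k%:~R)); split.
    - by move: zV; rewrite /V /= in_itv.
    - by rewrite IE; exists (carg z + 2 * pi * k%:~R).
    - by rewrite expi_period; exact: polar_form.
  case: ifPn => // /eqP le1 /eq0_normc ->.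
  exact: V0.
apply: measurableU; last by case: ifP.
apply: measurableI.
  by apply: measurableI => //; apply: mnormc; exact: measurable_itv.
rewrite (_ : [set z | normc z <> 0] = ~` [set z | normc z = 0])//.
exact: measurableC.
Qed.

Lemma carleson_square_disc (S : set C) : carleson_square S -> S `<=` disc.
Proof.
move=> [I [l [[a [b [ca [cb [ab lE IE]]]]] ->]]] z /= [r [e [/andP[r1 r2] Ie ->]]].
have l1 : l <= 1.
  by rewrite lE ler_pdivrMr// mul1r; case/andP: ab => _; lra.
move: Ie; rewrite IE => -[x _ <-].
change (normc (r%:C%C * expi x) < 1).
rewrite normcM normc_real normc_expi mulr1 ger0_norm//.
by lra.
Qed.

End angle.

(** * The forest of dyadic squares *)

Section nodes.
Variable N : nat.

(** [(n, j)] is the [j]-th square of level [n]. The bound [2 ^ N] on the second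
    component is common to all levels, at the price of empty squares for
    [j >= 2 ^ n]. *)
Definition node := ('I_N.+1 * 'I_(2 ^ N))%type.

Definition ancestor : rel node := fun i j =>
  (i.1 <= j.1)%N && (i.2 == j.2 %/ 2 ^ (j.1 - i.1) :> nat)%N.

Lemma ancestor_refl : reflexive ancestor.
Proof. by move=> i; rewrite /ancestor leqnn subnn expn0 divn1 eqxx. Qed.

Lemma ancestor_trans : transitive ancestor.
Proof.
move=> j i k /andP[ij /eqP e1] /andP[jk /eqP e2].
rewrite /ancestor (leq_trans ij jk)/= e1 e2 -divnMA -expnD.
by apply/eqP; congr (_ %/ 2 ^ _)%N; lia.
Qed.

Lemma ancestor_anti : antisymmetric ancestor.
Proof.
move=> [i1 i2] [j1 j2] /= /andP[/andP[/= ij /eqP e1] /andP[/= ji /eqP e2]].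
have e : i1 = j1 :> nat by lia.
move: e1; rewrite e subnn expn0 divn1 => e1.
by congr pair; exact: val_inj.
Qed.

Lemma ancestor_chain (i j x : node) :
  ancestor i x -> ancestor j x -> ancestor i j || ancestor j i.
Proof.
wlog ij : i j / (i.1 <= j.1)%N.
  move=> wl ix jx; have [h|/ltnW h] := leqP i.1 j.1; first exact: wl.
  by rewrite orbC wl.
move=> /andP[ix /eqP e1] /andP[jx /eqP e2].
apply/orP; left; rewrite /ancestor ij/= e1 e2 -divnMA -expnD.
by apply/eqP; congr (_ %/ 2 ^ _)%N; lia.
Qed.

End nodes.

Section atoms.
Context {R : realType}.
Local Notation C := R[i].
Variables (s : R) (N : nat).
Local Notation node := (node N).

Lemma height_mono n m (z : C) : (n <= m)%N -> height m z -> height n z.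
Proof.
move=> nm [dz h]; split=> //; apply: le_trans h.
by rewrite lerD2l lerN2 lef_pV2 ?posrE ?exprn_gt0// ler_weXn2l// ler1n.
Qed.

Lemma height0 (z : C) : disc z -> height 0 z.
Proof. by split=> //; rewrite expr0 invr1 subrr normc_ge0. Qed.

Definition square (i : node) : set C := dyadic_square s i.1 i.2.

(** The part of a square that meets no square of the next level, or the whole
    square at the last level [N]. Every square of level at most [N] is a union
    of atoms. *)
Definition atom (i : node) : set C :=
  square i `\` [set z | (i.1 < N)%N /\ height i.1.+1 z].

Lemma measurable_square i : measurable (square i).
Proof. exact: measurable_dyadic_square. Qed.

Lemma measurable_atom i : measurable (atom i).
Proof.
apply: measurableD; first exact: measurable_square.
case: (i.1 < N)%N.
  rewrite (_ : [set _ | _] = [set z | height i.1.+1 z]).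
    exact: measurable_height.
  by apply/seteqP; split=> z //= -[].
by rewrite (_ : [set _ | _] = set0)//; apply/seteqP; split=> z //= -[].
Qed.

Lemma square_disc i : square i `<=` disc.
Proof. by move=> z [] []. Qed.

Lemma atom_disc i : atom i `<=` disc.
Proof. by move=> z [] /square_disc. Qed.

Lemma atom_exists (z : C) : disc z -> exists x, atom x z.
Proof.
move=> dz; pose P n := `[< height n z >] && (n <= N)%N.
have ex : exists n, P n by exists 0%N; rewrite /P leq0n andbT; apply/asboolP/height0.
have ub n : P n -> (n <= N)%N by case/andP.
case: (ex_maxnP ex ub) => n /andP[/asboolP hn nN] nmax.
have dn : (dig s n z < 2 ^ N)%N.
  by apply: (leq_trans (digit_lt _ _)); rewrite leq_pexp2l.
exists (Ordinal (nN : (n < N.+1)%N), Ordinal dn); split; first by split.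
move=> [/= nN' hS]; suff : (n.+1 <= n)%N by rewrite ltnn.
by apply: nmax; rewrite /P nN' andbT; exact/asboolP.
Qed.

Lemma atom_height x (z : C) n : (n <= N)%N -> atom x z ->
  height n z <-> (n <= x.1)%N.
Proof.
move=> nN [[hx _] hS]; split => [hn|nx]; last exact: height_mono hx.
rewrite leqNgt; apply/negP => xn; apply: hS; split; first exact: leq_trans nN.
exact: height_mono hn.
Qed.

Lemma atom_square x i (z : C) : atom x z -> square i z <-> ancestor i x.
Proof.
move=> ax; have iN : (i.1 <= N)%N by rewrite -ltnS.
have [h1 h2] := atom_height iN ax; have [[hx dx] _] := ax.
split => [[hi di]|/andP[ix /eqP e]].
  have ix := h1 hi; rewrite /ancestor ix/=.
  by apply/eqP; rewrite -di -dx; exact: digit_shift.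
split; first exact: h2.
by rewrite e -dx; exact: digit_shift.
Qed.

Lemma atom_uniq x y (z : C) : atom x z -> atom y z -> x = y.
Proof.
move=> ax ay; apply: (@ancestor_anti N); apply/andP; split.
  by apply/(atom_square _ ay); case: ax.
by apply/(atom_square _ ax); case: ay.
Qed.

Lemma trivIset_atom P : trivIset P atom.
Proof.
by move=> x y _ _ [z [ax ay]]; exact: atom_uniq ax ay.
Qed.

Lemma square_atoms i : square i = \bigcup_(x in [set x | ancestor i x]) atom x.
Proof.
apply/seteqP; split=> z.
  move=> sz; have [x ax] := atom_exists (square_disc sz).
  by exists x => //=; exact/(atom_square _ ax).
by move=> [x /= ix ax]; exact/(atom_square _ ax).
Qed.

Lemma disc_atoms : disc = \bigcup_(x in [set: node]) atom x.
Proof.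
apply/seteqP; split=> z; first by move=> /atom_exists[x]; exists x.
by move=> [x _ /atom_disc].
Qed.

Section integrals.
Variable mu : {measure set C -> \bar R}.
Variable f : C -> \bar R.
Hypothesis mf : measurable_fun disc f.
Hypothesis f0 : forall z, disc z -> (0 <= f z)%E.

Lemma integral_atoms (P : pred node) :
  (\int[mu]_(z in \bigcup_(x in [set x | P x]) atom x) f z =
   \sum_(x | P x) \int[mu]_(z in atom x) f z)%E.
Proof.
rewrite (_ : \bigcup_(x in _) _ = \big[setU/set0]_(x <- enum P) atom x); last first.
  rewrite -bigcup_seq; apply: eq_bigcupl; split => x /=; rewrite mem_enum//.
rewrite ge0_integral_bigsetU//.
- by rewrite big_enum.
- by move=> x; exact: measurable_atom.
- exact: enum_uniq.
- exact: trivIset_atom.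
- apply: measurable_funS mf; first exact: measurable_disc.
  by move=> z; rewrite -bigcup_seq => -[x _ /atom_disc].
- by move=> z; rewrite -bigcup_seq => -[x _ /atom_disc] /f0.
Qed.

Lemma integral_square i : (\int[mu]_(z in square i) f z =
   \sum_(x | ancestor i x) \int[mu]_(z in atom x) f z)%E.
Proof. by rewrite square_atoms integral_atoms. Qed.

Lemma integral_disc :
  (\int[mu]_(z in disc) f z = \sum_x \int[mu]_(z in atom x) f z)%E.
Proof.
by rewrite {1}disc_atoms -integral_atoms; congr (integral _ _ _); apply: eq_bigcupl; split.
Qed.

End integrals.
End atoms.

(** * Positive operators and dyadic kernels *)

#[local] Hint Extern 0 (measurable disc) => (exact: measurable_disc) : core.

Section positive_functions.
Context {R : realType}.
Local Notation C := R[i].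
Variable mu : {measure set C -> \bar R}.

Definition posfun (f : C -> R) : Prop :=
  measurable_fun disc f /\ forall z, disc z -> 0 <= f z.

Definition summable_on (f : C -> R) : Prop :=
  (\int[mu]_(z in disc) (f z)%:E < +oo)%E.

Definition integ (A : set C) (f : C -> R) : R :=
  fine (\int[mu]_(z in A) (f z)%:E)%E.

Lemma posfunE (f : C -> R) : posfun f ->
  measurable_fun disc (EFin \o f) /\ forall z, disc z -> (0 <= (f z)%:E)%E.
Proof. by move=> [mf f0]; split; [exact/measurable_EFinP|]. Qed.

Lemma integ_ge0 A f : posfun f -> A `<=` disc -> 0 <= integ A f.
Proof.
move=> [_ f0] AD; rewrite fine_ge0// integral_ge0// => z /AD /f0.
by rewrite lee_fin.
Qed.

Lemma le_integral_subset (A : set C) (f : C -> R) : posfun f -> measurable A ->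
  A `<=` disc -> (\int[mu]_(z in A) (f z)%:E <= \int[mu]_(z in disc) (f z)%:E)%E.
Proof.
move=> pf mA AD; have [mf f0] := posfunE pf.
by apply: ge0_subset_integral => //; exact: measurable_disc.
Qed.

Lemma integE A f : posfun f -> summable_on f -> measurable A -> A `<=` disc ->
  (integ A f)%:E = (\int[mu]_(z in A) (f z)%:E)%E.
Proof.
move=> pf sf mA AD; rewrite fineK// ge0_fin_numE.
  exact: le_lt_trans (le_integral_subset pf mA AD) sf.
by apply: integral_ge0 => z /AD Dz; rewrite lee_fin; exact: pf.2.
Qed.

Lemma posfunM f g : posfun f -> posfun g -> posfun (fun z => f z * g z).
Proof.
move=> [mf f0] [mg g0]; split; first exact: measurable_funM.
by move=> z Dz; rewrite mulr_ge0 ?f0 ?g0.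
Qed.

Lemma posfun_indic A : measurable A -> posfun (\1_A : C -> R).
Proof. by move=> mA; split=> //; apply: measurable_funTS. Qed.

Lemma posfun_powR f r : posfun f -> posfun (fun z => f z `^ r).
Proof.
move=> [mf f0]; split=> [|z _]; last exact: powR_ge0.
exact: (measurableT_comp (measurable_powR r)).
Qed.

Lemma integral_indic_mul A f : A `<=` disc ->
  (\int[mu]_(z in disc) (\1_A z * f z)%:E = \int[mu]_(z in A) (f z)%:E)%E.
Proof.
move=> AD; rewrite -{2}(setIidr AD) integral_mkcondr.
apply: eq_integral => z _; rewrite patchE indicE.
by case: ifPn => _; rewrite ?mul1r ?mul0r.
Qed.

Definition positive_op (k : C -> C -> R) (f : C -> R) (z : C) : \bar R :=
  (\int[mu]_(w in disc) (k z w * f w)%:E)%E.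

Definition poskernel (k : C -> C -> R) : Prop :=
  measurable_fun (disc `*` disc) (fun q : C * C => k q.1 q.2) /\
  forall z w, disc z -> disc w -> 0 <= k z w.

Lemma measurable_slice k z : poskernel k -> disc z -> measurable_fun disc (k z).
Proof.
move=> [mk _] dz mD A mA.
have mDD : measurable ((@disc R) `*` (@disc R)) by exact: measurableX.
have := mk mDD A mA.
move=> /(measurable_xsection z); rewrite (_ : xsection _ _ = disc `&` k z @^-1` A)//.
apply/seteqP; split=> w; rewrite /xsection /= inE /=; first by case=> -[].
by case.
Qed.

Lemma posfun_slice k z : poskernel k -> disc z -> posfun (k z).
Proof.
move=> pk dz; split; first exact: measurable_slice.
by move=> w; exact: pk.2.
Qed.

Lemma positive_op_ge0 k f z : poskernel k -> posfun f -> disc z ->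
  (0 <= positive_op k f z)%E.
Proof.
move=> pk [_ f0] dz; apply: integral_ge0 => w Dw; rewrite lee_fin mulr_ge0 ?f0//.
exact: pk.2.
Qed.

Lemma measurable_positive_op k f : (mu disc < +oo)%E -> poskernel k -> posfun f ->
  measurable_fun disc (positive_op k f).
Proof.
move=> muD [mk k0] [mf f0].
apply: (measurable_integral_param measurable_disc measurable_disc muD
  (F := fun q => (k q.1 q.2 * f q.2)%:E)).
  apply/measurable_EFinP; apply: measurable_funM => //.
  move=> mDD A mA.
  have h : measurable ((setT : set C) `*` (disc `&` f @^-1` A)).
    by apply: measurableX => //; exact: mf measurable_disc A mA.
  rewrite (_ : _ `&` _ = (disc `*` disc) `&` (setT `*` (disc `&` f @^-1` A))).
    by apply: measurableI.
  by apply/seteqP; split=> -[z w] /= [[? ?]]; [|case=> _ []].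
by move=> [z w] /= [dz dw]; rewrite lee_fin mulr_ge0 ?k0 ?f0.
Qed.

Lemma le_positive_op k k' f f' z : poskernel k -> poskernel k' -> posfun f ->
  posfun f' -> disc z -> (forall w, disc w -> k z w * f w <= k' z w * f' w) ->
  (positive_op k f z <= positive_op k' f' z)%E.
Proof.
move=> pk pk' pf pf' dz h; apply: ge0_le_integral.
- exact: measurable_disc.
- by move=> w Dw; rewrite lee_fin mulr_ge0 ?pf.2 ?pk.2.
- by apply/measurable_EFinP; apply: measurable_funM; [exact: measurable_slice|exact: pf.1].
- by apply/measurable_EFinP; apply: measurable_funM; [exact: measurable_slice|exact: pf'.1].
by move=> w Dw; rewrite lee_fin h.
Qed.

End positive_functions.

Section grid.
Context {R : realType}.
Local Notation C := R[i].
Variable mu : {measure set C -> \bar R}.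
Hypothesis mu_fin : (mu disc < +oo)%E.
Variables (s : R) (N : nat) (al : nat -> R).
Hypothesis al_ge0 : forall n, 0 <= al n.
Local Notation node := (node N).
Local Notation square := (@square R s N).
Local Notation atom := (@atom R s N).
Local Notation anc := (@ancestor N).
Local Notation integ := (integ mu).
Local Notation summable := (summable_on mu).

Definition grid_kernel (z w : C) : R :=
  \sum_(i : node) al i.1 * \1_(square i) z * \1_(square i) w.

Lemma poskernel_grid : poskernel grid_kernel.
Proof.
split=> [|z w _ _]; last by apply: sumr_ge0 => i _; rewrite !mulr_ge0.
apply: measurable_funTS; apply: measurable_sum => i.
apply: measurable_funM; first apply: measurable_funM => //.
  by apply: measurableT_comp measurable_fst; apply: measurable_indic; exact: measurable_square.
by apply: measurableT_comp measurable_snd; apply: measurable_indic; exact: measurable_square.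
Qed.

Lemma indic_atom x i (z : C) : atom x z -> \1_(square i) z = (anc i x)%:R :> R.
Proof.
move=> ax; rewrite indicE; congr (_%:R); congr nat_of_bool.
apply/idP/idP; rewrite inE.
  by move/(atom_square _ ax).
by move=> h; exact/(atom_square _ ax).
Qed.

(** The dyadic kernel is constant on atoms, hence so is the image of any
    function. *)
Lemma grid_op_atom x z (f : C -> R) : atom x z -> posfun f -> summable f ->
  positive_op mu grid_kernel f z =
  (\sum_(i | anc i x) al i.1 * integ (square i) f)%:E.
Proof.
move=> ax pf sf; have [mf f0] := posfunE pf.
transitivity (\int[mu]_(w in disc) (\sum_(i : node)
    (al i.1 * (anc i x)%:R)%:E * (\1_(square i) w * f w)%:E))%E.
  apply: eq_integral => w _; rewrite /grid_kernel mulr_suml -sumEFin.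
  by apply: eq_bigr => i _; rewrite (indic_atom _ ax) -EFinM mulrA.
have pif i : posfun (fun w => \1_(square i) w * f w).
  by apply: posfunM => //; apply: posfun_indic; exact: measurable_square.
have c0 (i : node) : 0 <= al i.1 * (anc i x)%:R by rewrite mulr_ge0.
rewrite ge0_integral_sum//.
- rewrite -sumEFin [in RHS]big_mkcond; apply: eq_bigr => i _.
  have [m1 p1] := posfunE (pif i).
  rewrite ge0_integralZl_EFin//.
  rewrite integral_indic_mul; last exact: square_disc.
  rewrite -integE//; [|exact: measurable_square|exact: square_disc].
  by case: ifPn => _; rewrite ?mulr1 ?mulr0 ?mul0e.
- by move=> i; apply: measurable_funeM; have [] := posfunE (pif i).
- by move=> i w Dw; rewrite mule_ge0// lee_fin//; exact: (pif i).2.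
Qed.

Lemma integ_square f i : posfun f -> summable f ->
  integ (square i) f = mass anc (fun x => integ (atom x) f) i.
Proof.
move=> pf sf; have [mf f0] := posfunE pf; apply: EFin_inj.
rewrite integE//; [|exact: measurable_square|exact: square_disc].
rewrite integral_square// /mass -sumEFin; apply: eq_bigr => x _.
by rewrite integE//; [exact: measurable_atom|exact: atom_disc].
Qed.

Section bound.
Variables (p q : R).
Hypotheses (p_gt1 : 1 < p) (q_gt1 : 1 < q) (pq : p^-1 + q^-1 = 1).
Variables (sg u : C -> R).
Hypotheses (psg : posfun sg) (pu : posfun u) (ssg : summable sg) (su : summable u).

(** On an atom below [i], the sum over the squares inside [square i] is at most
    the dyadic operator applied to the truncation of [sg] to [square i], hence
    at most a multiple of the operator with kernel [b]. *)
Lemma grid_testing (b : C -> C -> R) (c C0 : R) : poskernel b -> 0 <= c -> 0 <= C0 ->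
  (forall z w, disc z -> disc w -> grid_kernel z w <= c * b z w) ->
  (forall i : node, (\int[mu]_(z in disc)
      (positive_op mu b (fun w => \1_(square i) w * sg w)%R z `^ p * (u z)%:E)
    <= (C0 `^ p)%:E * \int[mu]_(z in square i) (sg z)%:E)%E) ->
  testing_on anc p (fun i => al i.1) (fun x => integ (atom x) sg)
    (fun x => integ (atom x) u) (c * C0).
Proof.
move=> pb c0 C00 kb test i.
have p0 : 0 < p := lt_trans ltr01 p_gt1.
have [mu' u0] := posfunE pu.
pose f w := \1_(square i) w * sg w.
have pf : posfun f.
  by apply: posfunM => //; apply: posfun_indic; exact: measurable_square.
have sf : summable f.
  rewrite /summable_on integral_indic_mul; last exact: square_disc.
  apply: le_lt_trans ssg.
  by apply: le_integral_subset => //; [exact: measurable_square|exact: square_disc].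
pose A x := \sum_(j | anc j x) al j.1 * integ (square j) f.
have A0 x : 0 <= A x.
  apply: sumr_ge0 => j _; rewrite mulr_ge0// integ_ge0//; exact: square_disc.
pose P z := positive_op mu b f z.
have mP : measurable_fun disc P by exact: measurable_positive_op.
have P0 z : disc z -> (0 <= P z)%E by exact: positive_op_ge0.
pose G z := (c%:E * P z)%E.
have G0 z : disc z -> (0 <= G z)%E by move=> Dz; rewrite mule_ge0 ?lee_fin ?P0.
have mG : measurable_fun disc G by exact: measurable_funeM.
have mGp : measurable_fun disc (fun z => (G z `^ p)%E).
  exact: (measurableT_comp (measurable_poweR p)).
have mGpu : measurable_fun disc (fun z => (G z `^ p * (u z)%:E)%E).
  exact: emeasurable_funM.
have AG x z : atom x z -> ((A x)%:E <= G z)%E.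
  move=> ax; rewrite -(grid_op_atom ax pf sf) /G /P /positive_op.
  have Dz := atom_disc ax.
  have [mbf bf0] : posfun (fun w => b z w * f w).
    by apply: posfunM => //; exact: posfun_slice.
  rewrite -ge0_integralZl_EFin//; last exact/measurable_EFinP.
  apply: ge0_le_integral => //.
  - move=> w Dw; rewrite lee_fin mulr_ge0 ?pf.2//.
    exact: poskernel_grid.2.
  - apply/measurable_EFinP; apply: measurable_funM; last exact: pf.1.
    exact: measurable_slice poskernel_grid _.
  - by apply: measurable_funeM; exact/measurable_EFinP.
  - by move=> w Dw; rewrite -EFinM lee_fin [leRHS]mulrA ler_wpM2r ?kb// pf.2.
have step : ((\sum_(x | anc i x) integ (atom x) u * A x `^ p)%:E <=
    \int[mu]_(z in disc) (G z `^ p * (u z)%:E))%E.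
  rewrite -sumEFin (integral_disc s N)//; last first.
    by move=> z Dz; rewrite mule_ge0 ?poweR_ge0// u0.
  rewrite big_mkcond; apply: lee_sum => x _.
  have mx := measurable_atom s x.
  have dx := @atom_disc R s N x.
  have h0 : (0 <= \int[mu]_(z in atom x) (G z `^ p * (u z)%:E))%E.
    by apply: integral_ge0 => z /dx Dz; rewrite mule_ge0 ?poweR_ge0// u0.
  case: ifPn => // _.
  rewrite mulrC EFinM integE// -ge0_integralZl_EFin//; last 3 first.
  - by move=> z /dx; exact: u0.
  - by apply: measurable_funS mu' => //; exact: measurable_disc.
  - exact: powR_ge0.
  apply: ge0_le_integral => //.
  - by move=> z /dx Dz; rewrite mule_ge0 ?lee_fin ?powR_ge0//; exact: pu.2.
  - apply: measurable_funeM.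
    by apply: measurable_funS mu' => //; exact: measurable_disc.
  - by apply: measurable_funS mGpu => //; exact: measurable_disc.
  move=> z ax; rewrite lee_wpmul2r ?u0//; first exact: dx.
  rewrite -poweR_EFin gt0_ler_poweR ?(ltW p0)// ?in_itv/= ?leey ?andbT ?lee_fin//.
    by apply: G0; exact: dx.
  exact: AG.
have GE : (\int[mu]_(z in disc) (G z `^ p * (u z)%:E) =
    (c `^ p)%:E * \int[mu]_(z in disc) (P z `^ p * (u z)%:E))%E.
  rewrite -ge0_integralZl_EFin ?powR_ge0//.
  - apply: eq_integral => z; rewrite inE => Dz.
    by rewrite /G poweRM ?P0 ?lee_fin// poweR_EFin muleA.
  - by move=> z Dz; rewrite mule_ge0 ?poweR_ge0// u0.
  apply: emeasurable_funM => //.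
  exact: (measurableT_comp (measurable_poweR p)).
have main : \sum_(x | anc i x) integ (atom x) u * A x `^ p <=
    (c * C0) `^ p * integ (square i) sg.
  rewrite -lee_fin; apply: (le_trans step); rewrite GE powRM//.
  rewrite !EFinM integE//; [|exact: measurable_square|exact: square_disc].
  by rewrite -muleA lee_wpmul2l ?lee_fin ?powR_ge0// test.
rewrite -(integ_square _ psg ssg).
apply: le_trans main; apply: ler_sum => x ix; rewrite ler_wpM2l//.
  by apply: integ_ge0 => //; exact: atom_disc.
have sub : \sum_(j | anc i j && anc j x)
    al j.1 * mass anc (fun x => integ (atom x) sg) j <= A x.
  rewrite /A big_mkcond [leRHS]big_mkcond; apply: ler_sum => j _.
  case: ifPn => [/andP[ij jx]|_]; last first.
    case: ifP => // _; rewrite mulr_ge0// integ_ge0//; exact: square_disc.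
  rewrite jx -integ_square// ler_wpM2l// le_eqVlt; apply/orP; left; apply/eqP.
  congr fine; apply: eq_integral => z; rewrite inE => jz.
  rewrite /f indicE mem_set ?mul1r//.
  have [y ay] := atom_exists s N (square_disc jz).
  apply/(atom_square _ ay); apply: (ancestor_trans ij).
  exact/(atom_square _ ay).
apply: ge0_ler_powR => //; rewrite ?(ltW p0)// nnegrE ?A0//.
apply: sumr_ge0 => j _; rewrite mulr_ge0// -integ_square// integ_ge0//.
exact: square_disc.
Qed.

(** The operator is constant on atoms and depends only on the masses of [phi] on
    them: this is the inequality on the forest of squares. *)
Lemma grid_bound (phi e : C -> R) (C1 C2 : R) :
  0 < C1 -> 0 < C2 ->
  testing_on anc p (fun i => al i.1) (fun x => integ (atom x) sg)
    (fun x => integ (atom x) u) C1 ->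
  testing_on anc q (fun i => al i.1) (fun x => integ (atom x) u)
    (fun x => integ (atom x) sg) C2 ->
  posfun phi -> summable phi -> posfun e -> summable e ->
  (forall x, integ (atom x) phi `^ p <=
     integ (atom x) e * integ (atom x) sg `^ (p - 1)) ->
  (\int[mu]_(z in disc) (positive_op mu grid_kernel phi z `^ p * (u z)%:E)
    <= ((2 * (form_cst p q * (C1 + C2))) `^ p)%:E *
       \int[mu]_(z in disc) (e z)%:E)%E.
Proof.
move=> C10 C20 t1 t2 pphi sphi pe se he.
have [mu' u0] := posfunE pu.
have atom0 f x : posfun f -> 0 <= integ (atom x) f.
  by move=> pf; apply: integ_ge0 => //; exact: atom_disc.
have := @forest_two_weight R node anc (@ancestor_refl N) (@ancestor_trans N)
  (@ancestor_anti N) (@ancestor_chain N) p q (fun i => al i.1)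
  (fun x => integ (atom x) sg) (fun x => integ (atom x) u) C1 C2 p_gt1 q_gt1 pq
  C10 C20 (fun i => al_ge0 _) (fun x => atom0 _ x psg) (fun x => atom0 _ x pu)
  t1 t2 (fun x => integ (atom x) phi) (fun x => integ (atom x) e)
  (fun x => atom0 _ x pphi) (fun x => atom0 _ x pe) he.
rewrite -lee_fin EFinM -[X in (_ <= _ * X)%E]sumEFin -sumEFin.
have -> : (\sum_x (integ (atom x) e)%:E = \int[mu]_(z in disc) (e z)%:E)%E.
  have [me e0] := posfunE pe; rewrite (integral_disc s N)//.
  apply: eq_bigr => x _; rewrite integE//; [exact: measurable_atom|exact: atom_disc].
apply: le_trans; rewrite (integral_disc s N); last 2 first.
- apply: emeasurable_funM => //; apply: (measurableT_comp (measurable_poweR p)).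
  by apply: measurable_positive_op => //; exact: poskernel_grid.
- by move=> z Dz; rewrite mule_ge0 ?poweR_ge0// u0.
apply: lee_sum => x _; have mx := measurable_atom s x.
have dx := @atom_disc R s N x.
rewrite (@eq_integral _ _ _ _ _ (fun z => (((\sum_(i | anc i x)
    al i.1 * mass anc (fun y => integ (atom y) phi) i) `^ p)%:E * (u z)%:E)%E)).
  rewrite ge0_integralZl_EFin ?powR_ge0//; last 2 first.
  - by move=> z /dx; exact: u0.
  - by apply: measurable_funS mu' => //; exact: measurable_disc.
  by rewrite EFinM integE// muleC.
move=> z; rewrite inE => az; rewrite (grid_op_atom az pphi sphi) poweR_EFin.
by congr ((_ `^ p)%:E * _)%E; apply: eq_bigr => i _; rewrite integ_square.
Qed.

End bound.
End grid.

Section grid_kernel_levels.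
Context {R : realType}.
Local Notation C := R[i].
Variables (s : R) (al : nat -> R).
Hypothesis al_ge0 : forall n, 0 <= al n.

Definition same_square n (z w : C) : bool :=
  [&& `[< height n z >], `[< height n w >] & dig s n z == dig s n w].

(** At each level at most one square contains both points. *)
Lemma grid_kernelE N z w :
  grid_kernel s N al z w = \sum_(n < N.+1 | same_square n z w) al n.
Proof.
rewrite /grid_kernel -(pair_bigA _ (fun (n : 'I_N.+1) (j : 'I_(2 ^ N)) =>
  al n * \1_(square s (n, j)) z * \1_(square s (n, j)) w))/=.
rewrite [RHS]big_mkcond; apply: eq_bigr => n _.
have indE (j : 'I_(2 ^ N)) y : \1_(square s (n, j)) y =
    (`[< height n y >] && (dig s n y == j :> nat))%:R :> R.
  rewrite indicE; congr (_%:R); congr nat_of_bool; apply/idP/idP; rewrite inE.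
    by move=> [h d]; apply/andP; split; [exact/asboolP|exact/eqP].
  by move=> /andP[/asboolP h /eqP d]; split.
case: ifPn => [/and3P[hz hw /eqP e]|h].
  have lt : (dig s n z < 2 ^ N)%N.
    by apply: (leq_trans (digit_lt _ _)); rewrite leq_pexp2l// -ltnS.
  rewrite (bigD1 (Ordinal lt))//= big1 ?addr0.
    by rewrite !indE hz hw /= -e !eqxx !mulr1.
  move=> j; rewrite !indE hz hw /= -e -val_eqE/= eq_sym => /negPf ->.
  by rewrite mulr0.
apply: big1 => j _; rewrite !indE.
case hz : `[< height n z >] => /=; last by rewrite mulr0 mul0r.
case hw : `[< height n w >] => /=; last by rewrite !mulr0.
case: eqP => /= dz; last by rewrite mulr0 mul0r.
case: eqP => /= dw; last by rewrite mulr0.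
by case/negP: h; rewrite /same_square hz hw dz dw eqxx.
Qed.

Lemma grid_kernel_nd N M z w : (N <= M)%N ->
  grid_kernel s N al z w <= grid_kernel s M al z w.
Proof.
move=> NM; rewrite !grid_kernelE.
have e K : \sum_(n < K.+1 | same_square n z w) al n =
    \sum_(0 <= n < K.+1 | same_square n z w) al n by rewrite big_mkord.
rewrite !e (big_cat_nat (n := N.+1) (p := M.+1))//= lerDl sumr_ge0//.
Qed.

Lemma le_grid_kernel N n z w : (n <= N)%N -> same_square n z w ->
  al n <= grid_kernel s N al z w.
Proof.
move=> nN snzw; rewrite grid_kernelE (bigD1 (Ordinal (nN : (n < N.+1)%N)))//=.
by rewrite lerDl sumr_ge0.
Qed.

(** The deepest common square accounts for half of the sum. *)
Lemma grid_kernel_le N z w (K : R) : 0 <= K ->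
  (forall m, \sum_(n < m.+1) al n <= 2 * al m) ->
  (forall n, same_square n z w -> al n <= K) ->
  grid_kernel s N al z w <= 2 * K.
Proof.
move=> K0 geo alK; elim: N => [|N IH].
  rewrite grid_kernelE big_mkcond big_ord1 /=; case: ifP => [/alK h|_]; last lra.
  by have := al_ge0 0; lra.
case sN : (same_square N.+1 z w); last first.
  suff -> : grid_kernel s N.+1 al z w = grid_kernel s N al z w by [].
  by rewrite !grid_kernelE big_mkcond big_ord_recr/= sN addr0 -big_mkcond.
have := alK _ sN; have := geo N.+1; rewrite grid_kernelE => h1 h2.
apply: (@le_trans _ _ (2 * al N.+1)); last by lra.
apply: (le_trans _ h1); rewrite big_mkcond; apply: ler_sum => n _.
by case: ifP.
Qed.

End grid_kernel_levels.

Section holder.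
Context {R : realType}.
Variables (p q : R).
Hypotheses (p_gt1 : 1 < p) (q_gt1 : 1 < q) (pq : p^-1 + q^-1 = 1).

Let p0 : 0 < p. Proof. exact: lt_trans p_gt1. Qed.
Let q0 : 0 < q. Proof. exact: lt_trans q_gt1. Qed.

Lemma conj_mul : p * q = p + q.
Proof.
have : (p^-1 + q^-1) * (p * q) = p * q by rewrite pq mul1r.
by have -> : (p^-1 + q^-1) * (p * q) = p + q by field; rewrite !gt_eqF.
Qed.

(** Young's inequality for the factors [l * phi * v `^ p^-1] and
    [l^-1 * v `^ (- p^-1)] of [phi]; the dual weight is the power [q] of the
    second one. *)
Lemma weighted_young (phi v l : R) : 0 <= phi -> 0 < v -> 0 < l ->
  phi <= l `^ p * (phi `^ p * v) + l `^ (- q) * v `^ (1 - q).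
Proof.
move=> phi0 v0 l0.
have v1 : v `^ p^-1 != 0 by rewrite gt_eqF// powR_gt0.
have := @young _ (l * phi * v `^ p^-1) (l^-1 * v `^ (- p^-1)) p q.
rewrite !mulr_ge0 ?powR_ge0 ?invr_ge0 ?(ltW l0)// => /(_ isT isT p0 q0 pq).
have -> : l * phi * v `^ p^-1 * (l^-1 * v `^ (- p^-1)) = phi.
  by rewrite powRN; field; rewrite v1 gt_eqF.
rewrite powRM ?mulr_ge0 ?powR_ge0 ?(ltW l0)// powRM ?(ltW l0)//.
rewrite powRM ?powR_ge0 ?invr_ge0 ?(ltW l0)// -!powRrM mulVf ?gt_eqF//.
rewrite powRr1 ?(ltW v0)// mulrA.
have -> : l^-1 `^ q = l `^ (- q) by rewrite -powR_inv1 ?(ltW l0)// -powRrM mulN1r.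
have -> // : - p^-1 * q = 1 - q.
by have -> : p^-1 = 1 - q^-1 by [rewrite -pq addrK]; field; rewrite gt_eqF.
Qed.

Lemma small_all_zero (a K : R) : 0 <= a -> 0 <= K ->
  (forall t, 0 < t -> a <= t * K) -> a = 0.
Proof.
move=> a0 K0 h; apply/eqP; rewrite eq_le a0 andbT leNgt; apply/negP => ap.
have k : 0 < 2 * (K + 1) by lra.
have := h (a / (2 * (K + 1))); rewrite divr_gt0// => /(_ isT).
by rewrite mulrAC ler_pdivlMr//; nra.
Qed.

(** Young's inequality at the best scale is Hoelder's inequality, up to a
    factor [2 `^ p]. If [e] or [s] vanishes the scale is sent to an end of the
    half-line. *)
Lemma holder_of_young (a e s : R) : 0 <= a -> 0 <= e -> 0 <= s ->
  (forall l, 0 < l -> a <= l `^ p * e + l `^ (- q) * s) ->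
  a `^ p <= 2 `^ p * e * s `^ (p - 1).
Proof.
move=> a0 e0 s0 h.
have rhs0 : 0 <= 2 `^ p * e * s `^ (p - 1) by rewrite !mulr_ge0 ?powR_ge0.
have a0' : a = 0 -> a `^ p <= 2 `^ p * e * s `^ (p - 1).
  by move=> ->; rewrite powR0 ?gt_eqF.
have [e1|e1] := eqVneq e 0.
  apply: a0'; apply: (small_all_zero a0 s0) => t t0.
  have := h (t `^ (- q^-1)); rewrite powR_gt0// => /(_ isT).
  by rewrite e1 mulr0 add0r -powRrM mulrNN mulVf ?gt_eqF// powRr1 ?(ltW t0).
have [s1|s1] := eqVneq s 0.
  apply: a0'; apply: (small_all_zero a0 e0) => t t0.
  have := h (t `^ (p^-1)); rewrite powR_gt0// => /(_ isT).
  by rewrite s1 mulr0 addr0 -powRrM mulVf ?gt_eqF// powRr1 ?(ltW t0).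
have ep : 0 < e by rewrite lt_neqAle eq_sym e1.
have sp : 0 < s by rewrite lt_neqAle eq_sym s1.
have pq0 : p * q != 0 by rewrite mulf_neq0// gt_eqF.
(* This scale makes the two terms equal. *)
have := h ((s / e) `^ (p * q)^-1); rewrite powR_gt0 ?divr_gt0// => /(_ isT).
rewrite -!powRrM.
have -> : (p * q)^-1 * p = q^-1 by field; rewrite !gt_eqF.
have -> : (p * q)^-1 * - q = - p^-1 by field; rewrite !gt_eqF.
have E1 : (s / e) `^ q^-1 * e = s `^ q^-1 * e `^ p^-1.
  rewrite powRM ?invr_ge0// -[e^-1]powR_inv1// -powRrM mulN1r -mulrA.
  by rewrite -{2}(powRr1 e0) -powRD ?e1 ?implybT// -pq addrCA addNr addr0.
have E2 : (s / e) `^ (- p^-1) * s = s `^ q^-1 * e `^ p^-1.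
  rewrite powRM ?invr_ge0// -[e^-1]powR_inv1// -powRrM mulN1r opprK mulrAC.
  by rewrite -{2}(powRr1 s0) -powRD ?s1 ?implybT// -pq addKr.
rewrite E1 E2 => h2; have {}h2 : a <= 2 * (s `^ q^-1 * e `^ p^-1) by lra.
apply: (@le_trans _ _ ((2 * (s `^ q^-1 * e `^ p^-1)) `^ p)).
  by rewrite ge0_ler_powR ?(ltW p0)// nnegrE !mulr_ge0 ?powR_ge0.
rewrite powRM ?mulr_ge0 ?powR_ge0// powRM ?powR_ge0// -!powRrM.
rewrite mulVf ?gt_eqF// powRr1// [_ * e]mulrC mulrA.
have -> // : q^-1 * p = p - 1.
have -> : q^-1 = 1 - p^-1 by rewrite -pq addrC addKr.
by field; rewrite gt_eqF.
Qed.

End holder.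

(** * Two-weight bounds from testing on Carleson squares *)

Section ereal_powers.
Context {R : realType}.
Local Open Scope ereal_scope.

Lemma le_poweR (r : R) (x y : \bar R) : (0 <= r)%R -> 0 <= x -> x <= y ->
  x `^ r <= y `^ r.
Proof.
move=> r0 x0 xy; apply: gt0_ler_poweR => //; rewrite in_itv /= leey andbT//.
exact: le_trans xy.
Qed.

Lemma poweRK (r : R) (x : \bar R) : (r != 0)%R -> 0 <= x -> (x `^ r) `^ r^-1 = x.
Proof. by move=> r0 x0; rewrite -poweRrM divff// poweRe1. Qed.

Lemma poweRVK (r : R) (x : \bar R) : (r != 0)%R -> 0 <= x -> (x `^ r^-1) `^ r = x.
Proof. by move=> r0 x0; rewrite -poweRrM mulVf// poweRe1. Qed.

Lemma poweRD_le (r : R) (x y : \bar R) : (0 < r)%R -> 0 <= x -> 0 <= y ->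
  (x + y) `^ r <= (2 `^ r)%:E * (x `^ r + y `^ r).
Proof.
move=> r0; wlog xy : x y / x <= y.
  move=> wl x0 y0; have [xy|/ltW yx] := leP x y; first exact: wl.
  by rewrite addeC [x `^ r + _]addeC; exact: wl.
move=> x0 y0; apply: (@le_trans _ _ ((2%:E * y) `^ r)).
  apply: le_poweR; [exact: ltW|exact: adde_ge0|].
  by rewrite (_ : 2%:E = 1 + 1) // ge0_muleDl// !mul1e leeD2r.
rewrite poweRM// poweR_EFin lee_wpmul2l ?lee_fin ?powR_ge0// leeDr//.
exact: poweR_ge0.
Qed.

Lemma ereal_nondecreasing_limn_ge (x : (\bar R)^nat) n :
  nondecreasing_seq x -> x n <= limn x.
Proof.
move=> ndx; apply: lime_ge; first exact: ereal_nondecreasing_is_cvgn.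
by near=> m; apply: ndx; near: m; exact: nbhs_infty_ge.
Unshelve. all: by end_near. Qed.

(** Taking roots of the terms reduces the claim to the monotonicity of powers. *)
Lemma poweR_limn_le (r : R) (x : (\bar R)^nat) : (0 < r)%R ->
  (forall n, 0 <= x n) -> nondecreasing_seq x ->
  (limn x) `^ r <= limn (fun n => x n `^ r).
Proof.
move=> r0 x0 ndx; have rn0 : (r != 0)%R by rewrite gt_eqF.
have ndp : nondecreasing_seq (fun n => x n `^ r).
  by move=> n m nm; apply: le_poweR => //; [exact: ltW|exact: ndx].
have cp := ereal_nondecreasing_is_cvgn ndp.
have cx := ereal_nondecreasing_is_cvgn ndx.
set L := limn (fun n => x n `^ r).
have Lge n : x n `^ r <= L.
  exact: (@ereal_nondecreasing_limn_ge (fun n => x n `^ r)).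
have L0 : 0 <= L by apply: le_trans (Lge 0%N); exact: poweR_ge0.
rewrite -(poweRVK rn0 L0); apply: le_poweR; first exact: ltW.
  by apply: lime_ge => //; near=> n.
apply: lime_le => //; near=> n.
rewrite -(poweRK rn0 (x0 n)); apply: le_poweR => //.
  by rewrite invr_ge0 ltW.
exact: poweR_ge0.
Unshelve. all: by end_near. Qed.

End ereal_powers.

Section sufficiency.
Context {R : realType}.
Local Notation C := R[i].
Variable mu : {measure set C -> \bar R}.
Hypothesis mu_fin : (mu disc < +oo)%E.
Variables (p q : R).
Hypotheses (p_gt1 : 1 < p) (q_gt1 : 1 < q) (pq : p^-1 + q^-1 = 1).
Variables (b : C -> C -> R) (al : nat -> R) (c : R).
Hypothesis pb : poskernel b.
Hypothesis c_gt0 : 0 < c.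
Hypothesis al_ge0 : forall n, 0 <= al n.
Hypothesis al_sum : forall m, \sum_(n < m.+1) al n <= 2 * al m.
Hypothesis al_le : forall s n z w, same_square s n z w -> al n <= c * b z w.
Hypothesis b_le : forall z w, disc z -> disc w -> exists n,
  b z w <= c * al n /\ (same_square 0 n z w \/ same_square 3^-1 n z w).
Local Notation op := (positive_op mu).
Local Notation summable := (summable_on mu).
Local Notation cut A f := (fun w : C => \1_A w * f w)%R.

Let p0 : 0 < p. Proof. exact: lt_trans p_gt1. Qed.
Let q0 : 0 < q. Proof. exact: lt_trans q_gt1. Qed.

(** The testing condition with integrals valued in the extended reals: where the
    operator diverges it counts as infinite. *)
Definition carleson_testing (r : R) (sg u : C -> R) (K : R) : Prop :=
  forall S, carleson_square S ->
  (\int[mu]_(z in disc) (op b (cut S sg) z `^ r * (u z)%:E)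
    <= (K `^ r)%:E * \int[mu]_(z in S) (sg z)%:E)%E.

Lemma op_cut_set0 f z : op b (cut set0 f) z = 0%E.
Proof.
by rewrite /positive_op integral0_eq// => w _; rewrite indicE in_set0 mul0r mulr0.
Qed.

Lemma carleson_testing_square r sg u K s N : 0 < r ->
  carleson_testing r sg u K -> forall i : node N,
  (\int[mu]_(z in disc) (op b (cut (square s i) sg) z `^ r * (u z)%:E)
    <= (K `^ r)%:E * \int[mu]_(z in square s i) (sg z)%:E)%E.
Proof.
move=> r0 test [n j]; have [jn|jn] := ltnP j (2 ^ n).
  by apply: test; exact: dyadic_square_carleson.
have -> : square s (n, j) = set0.
  apply/seteqP; split=> // z [_ /= d].
  by have := digit_lt n (ang z + s); rewrite -/(dig s n z) d ltnNge jn.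
rewrite integral0_eq ?integral_set0 ?mule0// => z _.
by rewrite op_cut_set0 poweR0r ?gt_eqF// mul0e.
Qed.

Lemma grid_kernel_le_b s N z w : disc z -> disc w ->
  grid_kernel s N al z w <= 2 * c * b z w.
Proof.
move=> Dz Dw; rewrite -mulrA; apply: grid_kernel_le => //.
  by rewrite mulr_ge0 ?(ltW c_gt0)//; exact: pb.2.
by move=> n; exact: al_le.
Qed.

Variables (v u : C -> R).
Hypotheses (mv : measurable_fun disc v) (v_gt0 : forall z, disc z -> 0 < v z).
Hypotheses (pu : posfun u) (su : summable u).
Let sg z := v z `^ (1 - q).
Hypothesis ssg : summable sg.
Variables (C0 C0s : R).
Hypotheses (C0_gt0 : 0 < C0) (C0s_gt0 : 0 < C0s).
Hypothesis test : carleson_testing p sg u C0.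
Hypothesis test' : carleson_testing q u sg C0s.
Variable phi : C -> R.
Hypothesis pphi : posfun phi.
Let e z := phi z `^ p * v z.
Hypothesis se : summable e.

Let pv : posfun v. Proof. by split=> // z /v_gt0/ltW. Qed.
Let psg : posfun sg. Proof. exact: posfun_powR. Qed.
Let pe : posfun e. Proof. by apply: posfunM => //; exact: posfun_powR. Qed.

Lemma young_integral A (l : R) : measurable A -> A `<=` disc -> 0 < l ->
  (\int[mu]_(z in A) (phi z)%:E <= (l `^ p)%:E * \int[mu]_(z in A) (e z)%:E
   + (l `^ (- q))%:E * \int[mu]_(z in A) (sg z)%:E)%E.
Proof.
move=> mA AD l0.
have mono (f : C -> R) : posfun f -> measurable_fun A (EFin \o f).
  move=> [mf _]; apply/measurable_EFinP.
  exact: measurable_funS mf.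
have f0 (f : C -> R) : posfun f -> forall z, A z -> (0 <= (f z)%:E)%E.
  by move=> [_ h] z /AD; rewrite lee_fin; exact: h.
rewrite -!ge0_integralZl_EFin ?powR_ge0//; [|exact: f0|exact: mono|exact: f0|exact: mono].
rewrite -ge0_integralD//; last 4 first.
- by move=> z Az; rewrite mule_ge0 ?lee_fin ?powR_ge0//; exact: pe.2 (AD _ Az).
- by apply: measurable_funeM; exact: mono.
- by move=> z Az; rewrite mule_ge0 ?lee_fin ?powR_ge0//; exact: psg.2 (AD _ Az).
- by apply: measurable_funeM; exact: mono.
apply: ge0_le_integral => //.
- exact: f0.
- exact: mono.
- by apply: emeasurable_funD; apply: measurable_funeM; exact: mono.
move=> z /AD Dz; rewrite -!EFinM -EFinD lee_fin.
by apply: weighted_young => //; [exact: pphi.2|exact: v_gt0].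
Qed.

Lemma summable_phi : summable phi.
Proof.
apply: (le_lt_trans (@young_integral disc 1 measurable_disc (@subset_refl _ _) ltr01)).
by rewrite !powR1 !mul1e lte_add_pinfty.
Qed.

Lemma holder_atom s N (x : node N) : integ mu (atom s x) phi `^ p <=
  integ mu (atom s x) (fun z => 2 `^ p * e z) * integ mu (atom s x) sg `^ (p - 1).
Proof.
have mx := measurable_atom s x; have dx := @atom_disc R s N x.
have -> : integ mu (atom s x) (fun z => 2 `^ p * e z) =
    2 `^ p * integ mu (atom s x) e.
  rewrite /integ; under eq_integral do rewrite EFinM.
  rewrite ge0_integralZl_EFin ?powR_ge0//.
  - by rewrite -(integE pe)// -EFinM.
  - by move=> z /dx Dz; rewrite lee_fin pe.2.
  - by apply/measurable_EFinP; exact: measurable_funS pe.1.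
apply: (@holder_of_young R p q) => //; try exact: integ_ge0.
move=> l l0; have := young_integral mx dx l0.
rewrite -(integE pphi summable_phi)// -(integE pe)// -(integE psg)//.
Qed.

Let F := form_cst p q.
Let E := (\int[mu]_(z in disc) (e z)%:E)%E.

Lemma one_grid s N :
  (\int[mu]_(z in disc) (op (grid_kernel s N al) phi z `^ p * (u z)%:E)
   <= ((8 * c * F * (C0 + C0s)) `^ p)%:E * E)%E.
Proof.
have c20 : 0 <= 2 * c by rewrite mulr_ge0// ltW.
have qp : q^-1 + p^-1 = 1 by rewrite addrC.
have t1 := @grid_testing R mu mu_fin s N al al_ge0 p p_gt1 sg u psg pu
  ssg su b (2 * c) C0 pb c20 (ltW C0_gt0)
  (fun z w Dz Dw => @grid_kernel_le_b s N z w Dz Dw)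
  (@carleson_testing_square p sg u C0 s N p0 test).
have t2 := @grid_testing R mu mu_fin s N al al_ge0 q q_gt1 u sg pu psg
  su ssg b (2 * c) C0s pb c20 (ltW C0s_gt0)
  (fun z w Dz Dw => @grid_kernel_le_b s N z w Dz Dw)
  (@carleson_testing_square q u sg C0s s N q0 test').
have pe2 : posfun (fun z => 2 `^ p * e z).
  apply: posfunM; last exact: pe.
  by split=> [|z _]; [exact: measurable_cst|exact: powR_ge0].
have E2 : (\int[mu]_(z in disc) (2 `^ p * e z)%:E = (2 `^ p)%:E * E)%E.
  under eq_integral do rewrite EFinM.
  have [me e0] := posfunE pe.
  by rewrite ge0_integralZl_EFin ?powR_ge0.
have se2 : summable (fun z => 2 `^ p * e z).
  by rewrite /summable_on E2 lte_mul_pinfty ?lee_fin ?powR_ge0.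
have := @grid_bound R mu mu_fin s N al al_ge0 p q p_gt1 q_gt1 pq sg u psg pu su
  phi (fun z => 2 `^ p * e z) (2 * c * C0) (2 * c * C0s).
have cc0 : 0 < 2 * c * C0 by rewrite !mulr_gt0.
have cc1 : 0 < 2 * c * C0s by rewrite !mulr_gt0.
move=> /(_ cc0 cc1 t1 t2 pphi summable_phi pe2 se2 (@holder_atom s N)).
rewrite E2 muleA -EFinM -powRM ?mulr_ge0 ?(ltW (form_cst_gt0 _ _))// -/F; last first.
  by rewrite addr_ge0 ?mulr_ge0// ltW.
by have -> : 2 * (F * (2 * c * C0 + 2 * c * C0s)) * 2 = 8 * c * F * (C0 + C0s) by ring.
Qed.

Definition two_grids N (z w : C) : R :=
  c * (grid_kernel 0 N al z w + grid_kernel 3^-1 N al z w).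

Lemma poskernel_two_grids N : poskernel (two_grids N).
Proof.
have [m1 g1] := @poskernel_grid R 0 N al al_ge0.
have [m2 g2] := @poskernel_grid R 3^-1 N al al_ge0.
split=> [|z w Dz Dw]; last by rewrite mulr_ge0 ?(ltW c_gt0)// addr_ge0 ?g1 ?g2.
by apply: measurable_funM => //; exact: measurable_funD.
Qed.

Lemma two_grids_op N z : disc z -> op (two_grids N) phi z =
  (c%:E * (op (grid_kernel 0 N al) phi z + op (grid_kernel 3^-1 N al) phi z))%E.
Proof.
move=> Dz; rewrite /positive_op.
have pk s : posfun (fun w => grid_kernel s N al z w * phi w).
  by apply: posfunM => //; apply: posfun_slice => //; exact: poskernel_grid.
have [m1 g1] := posfunE (pk 0); have [m2 g2] := posfunE (pk 3^-1).
rewrite -ge0_integralD// -ge0_integralZl_EFin//; last 3 first.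
- by move=> w Dw; rewrite adde_ge0 ?g1 ?g2.
- exact: emeasurable_funD.
- exact: ltW.
apply: eq_integral => w _; rewrite -EFinD -EFinM /two_grids.
by congr EFin; ring.
Qed.

(** Each of the two grids obeys the same bound; the remaining factors come from
    the inequality [(x + y)^p <= 2^p (x^p + y^p)]. *)
Lemma two_grids_bound N :
  (\int[mu]_(z in disc) (op (two_grids N) phi z `^ p * (u z)%:E)
   <= ((32 * c ^+ 2 * F * (C0 + C0s)) `^ p)%:E * E)%E.
Proof.
have [mu' u0] := posfunE pu.
have pg s := @poskernel_grid R s N al al_ge0.
have mP s : measurable_fun disc (fun z =>
    (op (grid_kernel s N al) phi z `^ p * (u z)%:E)%E).
  apply: emeasurable_funM => //; apply: (measurableT_comp (measurable_poweR p)).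
  exact: measurable_positive_op.
have P0 s z : disc z -> (0 <= op (grid_kernel s N al) phi z `^ p * (u z)%:E)%E.
  by move=> Dz; rewrite mule_ge0 ?poweR_ge0// u0.
have c2 : 0 <= 2 * c by rewrite mulr_ge0// ltW.
apply: (@le_trans _ _ (((2 * c) `^ p)%:E *
    (\int[mu]_(z in disc) (op (grid_kernel 0 N al) phi z `^ p * (u z)%:E)
     + \int[mu]_(z in disc) (op (grid_kernel 3^-1 N al) phi z `^ p * (u z)%:E)))%E).
  rewrite -ge0_integralD//; [|exact: P0|exact: P0].
  rewrite -ge0_integralZl_EFin ?powR_ge0//; last 2 first.
  - by move=> z Dz; rewrite adde_ge0// P0.
  - exact: emeasurable_funD.
  apply: ge0_le_integral => //.
  - by move=> z Dz; rewrite mule_ge0 ?poweR_ge0// u0.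
  - apply: emeasurable_funM => //; apply: (measurableT_comp (measurable_poweR p)).
    by apply: measurable_positive_op => //; exact: poskernel_two_grids.
  - by apply: measurable_funeM; exact: emeasurable_funD.
  move=> z Dz; rewrite two_grids_op//.
  set X := op _ _ _; set Y := op _ _ _.
  have X0 : (0 <= X)%E by exact: positive_op_ge0.
  have Y0 : (0 <= Y)%E by exact: positive_op_ge0.
  rewrite -ge0_muleDl ?poweR_ge0// muleA lee_wpmul2r ?u0//.
  have XY0 : (0 <= X + Y)%E by exact: adde_ge0.
  clearbody X Y; rewrite poweRM ?lee_fin ?(ltW c_gt0)// poweR_EFin.
  rewrite powRM ?(ltW c_gt0)// [2 `^ p * _]mulrC EFinM -muleA.
  by rewrite lee_wpmul2l ?lee_fin ?powR_ge0// poweRD_le.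
have F0 : 0 < F by exact: form_cst_gt0.
have S0 : 0 <= 8 * c * F * (C0 + C0s).
  by rewrite !mulr_ge0 ?(ltW c_gt0) ?(ltW F0)// addr_ge0// ltW.
have E0 : (0 <= E)%E by apply: integral_ge0 => z Dz; rewrite lee_fin; exact: pe.2.
apply: (@le_trans _ _ (((2 * c) `^ p)%:E * (2%:E * (((8 * c * F * (C0 + C0s)) `^ p)%:E * E)))%E).
  rewrite lee_wpmul2l ?lee_fin ?powR_ge0//.
  rewrite (_ : 2%:E = 1 + 1)%E// ge0_muleDl// !mul1e.
  by apply: leeD; exact: one_grid.
have -> : 32 * c ^+ 2 * F * (C0 + C0s) = 2 * c * (2 * (8 * c * F * (C0 + C0s))).
  by ring.
have h2 : 0 <= 2 :> R by [].
rewrite (powRM p c2 (mulr_ge0 h2 S0)) (powRM p h2 S0).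
rewrite !EFinM -!muleA lee_wpmul2l ?lee_fin ?powR_ge0//.
rewrite lee_wpmul2r ?mule_ge0 ?lee_fin ?powR_ge0//.
by rewrite le1r_powR ?ler1n// ltW.
Qed.

Lemma two_grids_nd N M z w : (N <= M)%N -> two_grids N z w <= two_grids M z w.
Proof.
by move=> NM; rewrite ler_wpM2l ?(ltW c_gt0)// lerD// grid_kernel_nd.
Qed.

Lemma eventually_two_grids z w : disc z -> disc w ->
  exists n, forall N, (n <= N)%N -> b z w <= two_grids N z w.
Proof.
move=> Dz Dw; have [n [bn ss]] := b_le Dz Dw; exists n => N nN.
apply: (le_trans bn); rewrite ler_wpM2l ?(ltW c_gt0)//.
have g0 s : 0 <= grid_kernel s N al z w by exact: (poskernel_grid s N al_ge0).2.
case: ss => ss; have := le_grid_kernel al_ge0 nN ss.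
  by move=> h; apply: (le_trans h); rewrite lerDl.
by move=> h; apply: (le_trans h); rewrite lerDr.
Qed.

(** At each pair of points the two-grid kernel dominates [b] from some level on,
    and it increases with the level, so that monotone convergence applies. *)
Lemma op_le_limn z : disc z -> (op b phi z <= limn (fun N => op (two_grids N) phi z))%E.
Proof.
move=> Dz; have pt N := poskernel_two_grids N.
have pf N : posfun (fun w => two_grids N z w * phi w).
  by apply: posfunM => //; exact: posfun_slice.
rewrite /positive_op -monotone_convergence//; last 3 first.
- by move=> N; have [] := posfunE (pf N).
- by move=> N w Dw; rewrite lee_fin; exact: (pf N).2.
- move=> w Dw N M NM; rewrite lee_fin ler_wpM2r ?two_grids_nd//; exact: pphi.2.
have ndw w : disc w -> nondecreasing_seq (fun N => (two_grids N z w * phi w)%:E).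
  by move=> Dw N M NM; rewrite lee_fin ler_wpM2r ?two_grids_nd//; exact: pphi.2.
apply: ge0_le_integral => //.
- by move=> w Dw; rewrite lee_fin mulr_ge0 ?pb.2 ?pphi.2.
- by apply/measurable_EFinP; apply: measurable_funM; [exact: measurable_slice|exact: pphi.1].
- apply: (emeasurable_fun_cvg (fun N w => (two_grids N z w * phi w)%:E)).
    by move=> N; have [] := posfunE (pf N).
  by move=> w Dw; apply: ereal_nondecreasing_is_cvgn; exact: ndw.
move=> w Dw; have [n bn] := eventually_two_grids Dz Dw.
apply: (@le_trans _ _ (two_grids n z w * phi w)%:E).
  by rewrite lee_fin ler_wpM2r ?bn//; exact: pphi.2.
exact: (@ereal_nondecreasing_limn_ge _ (fun N => (two_grids N z w * phi w)%:E) n (ndw _ Dw)).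
Qed.

Theorem two_weight_sufficiency :
  (\int[mu]_(z in disc) (op b phi z `^ p * (u z)%:E)
   <= ((32 * c ^+ 2 * F * (C0 + C0s)) `^ p)%:E * E)%E.
Proof.
have [mu' u0] := posfunE pu.
pose W N z := op (two_grids N) phi z.
have W0 N z : disc z -> (0 <= W N z)%E.
  by move=> Dz; apply: positive_op_ge0 => //; exact: poskernel_two_grids.
have ndW z : disc z -> nondecreasing_seq (W^~ z).
  move=> Dz N M NM; apply: le_positive_op => //; try exact: poskernel_two_grids.
  by move=> w Dw; rewrite ler_wpM2r ?two_grids_nd//; exact: pphi.2.
pose G N z := (W N z `^ p * (u z)%:E)%E.
have mW N : measurable_fun disc (W N).
  by apply: measurable_positive_op => //; exact: poskernel_two_grids.
have mG N : measurable_fun disc (G N).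
  apply: emeasurable_funM => //; exact: (measurableT_comp (measurable_poweR p)).
have ndWp z : disc z -> nondecreasing_seq (fun N => (W N z `^ p)%E).
  by move=> Dz N M NM; apply: le_poweR; [exact: ltW|exact: W0|exact: ndW].
have ndG z : disc z -> nondecreasing_seq (G^~ z).
  by move=> Dz N M NM; rewrite lee_wpmul2r ?u0// ndWp.
apply: (@le_trans _ _ (\int[mu]_(z in disc) limn (G^~ z))%E).
  apply: ge0_le_integral => //.
  - by move=> z Dz; rewrite mule_ge0 ?poweR_ge0// u0.
  - apply: emeasurable_funM => //; apply: (measurableT_comp (measurable_poweR p)).
    exact: measurable_positive_op.
  - apply: (emeasurable_fun_cvg G) => // z Dz.
    by apply: ereal_nondecreasing_is_cvgn; exact: ndG.
  move=> z Dz; rewrite /G.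
  apply: (@le_trans _ _ ((limn (fun N => W N z `^ p)) * (u z)%:E)%E).
    rewrite lee_wpmul2r ?u0//.
    apply: (@le_trans _ _ ((limn (W^~ z)) `^ p)%E).
      apply: le_poweR; [exact: ltW|exact: positive_op_ge0|exact: op_le_limn].
    by apply: poweR_limn_le => // [n|]; [exact: W0|exact: ndW].
  rewrite muleC -limeMl//; last by apply: ereal_nondecreasing_is_cvgn; exact: ndWp.
  by under eq_fun do rewrite muleC.
rewrite monotone_convergence//; last first.
  by move=> N z Dz; rewrite mule_ge0 ?poweR_ge0// u0.
apply: lime_le; last first.
  by apply: nearW => N; exact: two_grids_bound.
apply: ereal_nondecreasing_is_cvgn => N M NM; apply: ge0_le_integral => //.
- by move=> z Dz; rewrite mule_ge0 ?poweR_ge0// u0.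
- by move=> z Dz; exact: ndG.
Qed.

End sufficiency.

(** * Comparison of the Bergman kernel with dyadic kernels *)

(** The properties of the kernel on which the theorem rests: comparability with
    the kernels of the dyadic grids, symmetry, local boundedness. The last field
    isolates the case of a measure [nu] without mass on the unit interval. *)
Record dyadic_kernel (R : realType) (b : R[i] -> R[i] -> R) (al : nat -> R)
    (c : R) : Prop := DyadicKernel {
  dk_pos : poskernel b;
  dk_sym : forall z w, disc z -> disc w -> b z w = b w z;
  dk_c : 0 < c;
  dk_coef : forall n, 0 <= al n;
  dk_sum : forall m, \sum_(n < m.+1) al n <= 2 * al m;
  dk_lower : forall s n z w, same_square s n z w -> al n <= c * b z w;
  dk_upper : forall z w, disc z -> disc w -> exists n,
    b z w <= c * al n /\ (same_square 0 n z w \/ same_square 3^-1 n z w);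
  dk_local : forall z, disc z -> exists M, forall w, disc w -> b z w <= M;
  dk_zero : al 0%N = 0 -> forall z w, disc z -> disc w -> b z w = 0 }.

Section kernel_of_representation.
Context {R : realType}.
Local Notation C := R[i].
Variables (gamma : R) (nu : {measure set R -> \bar R}).
Local Notation I01 := (`[(0:R), (1:R)]%classic : set R).
Hypothesis gamma_ge1 : 1 <= gamma.
Hypothesis nu_fin : (nu I01 < +oo)%E.
Local Notation kap := (kernel_profile gamma nu).
Local Notation al := (dyadic_coef gamma nu).
Local Notation b := (fun z w : C => normc (model_kernel gamma nu (pairing (z, w)))).

Let cst : R := 6 * 32 `^ (gamma + 1).

Let cst_gt0 : 0 < cst. Proof. by rewrite mulr_gt0// powR_gt0. Qed.

Lemma two_le_cst : 2 * 32 `^ (gamma + 1) <= cst.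
Proof. by rewrite ler_wpM2r ?powR_ge0// ler_nat. Qed.

Lemma six_le_cst : 6 * 8 `^ (gamma + 1) <= cst.
Proof.
rewrite ler_wpM2l// ge0_ler_powR ?nnegrE ?ler_nat//.
by rewrite addr_ge0// (le_trans _ gamma_ge1).
Qed.

Lemma pairing_lt1 (z w : C) : disc z -> disc w -> normc (pairing (z, w)) < 1.
Proof. by move=> Dz Dw; exact: normc_pairing. Qed.

Lemma pairing_conj (z w : C) : pairing (w, z) = ((pairing (z, w))^*)%C.
Proof.
case: z => a e; case: w => d f; rewrite /pairing /=.
by apply/eqP; rewrite eq_complex /=; apply/andP; split; apply/eqP; ring.
Qed.

Lemma profile_le_coef t n : 0 < t -> 2 ^- n <= 8 * t ->
  kap t <= 8 `^ (gamma + 1) * al n.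
Proof.
move=> t0 h.
apply: (le_trans (kernel_profile_dilate gamma_ge1 nu_fin t0 (l := 8) _)).
  by rewrite ler1n.
rewrite ler_wpM2l ?powR_ge0//.
by apply: kernel_profile_anti => //; rewrite invX2_gt0.
Qed.

Lemma dyadic_kernel_model : dyadic_kernel b al cst.
Proof.
split.
- by split; [exact: measurable_model_kernel|move=> z w _ _; exact: normc_ge0].
- move=> z w Dz Dw; rewrite [in RHS]pairing_conj.
  exact: esym (model_kernel_conj _ nu_fin (pairing_lt1 Dz Dw)).
- exact: cst_gt0.
- exact: dyadic_coef_ge0.
- exact: sum_dyadic_coef.
- move=> s n z w /and3P[/asboolP hz /asboolP hw /eqP e].
  have w1 := pairing_lt1 hz.1 hw.1.
  have d0 := dist1_gt0 w1.
  have dd : normc (1 - pairing (z, w)) <= 32 * 2 ^- n.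
    exact: dyadic_square_dist e.
  have i0 := @invX2_gt0 R n.
  have k1 := @kernel_profile_dilate _ gamma nu gamma_ge1 nu_fin (2 ^- n) 32 i0.
  rewrite ler1n in k1; have {}k1 := k1 erefl.
  have k2 : kap (32 * 2 ^- n) <= kap (normc (1 - pairing (z, w))).
    exact: kernel_profile_anti.
  have k3 := model_kernel_ge gamma nu_fin w1.
  have P0 : 0 <= 32 `^ (gamma + 1) :> R by exact: powR_ge0.
  apply: (le_trans k1); apply: (le_trans (ler_wpM2l P0 (le_trans k2 k3))).
  rewrite mulrA ler_wpM2r ?normc_ge0// mulrC; exact: two_le_cst.
- move=> z w Dz Dw; have [n [hn hz hw ss]] := adjacent_squares Dz Dw.
  have w1 := pairing_lt1 Dz Dw; exists n; split; last first.
    by case: ss => /eqP ss; [left|right]; apply/and3P; split=> //; exact/asboolP.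
  apply: (le_trans (model_kernel_le gamma nu_fin w1)).
  have k := profile_le_coef (dist1_gt0 w1) hn.
  have A0 : 0 <= al n by exact: dyadic_coef_ge0.
  apply: (@le_trans _ _ (6 * (8 `^ (gamma + 1) * al n))); first by rewrite ler_pM2l.
  by rewrite mulrA ler_wpM2r// six_le_cst.
- move=> z Dz; have dz : 0 < 1 - normc z by rewrite subr_gt0.
  exists (6 * kap (1 - normc z)) => w Dw; have w1 := pairing_lt1 Dz Dw.
  apply: (le_trans (model_kernel_le gamma nu_fin w1)); rewrite ler_pM2l//.
  apply: kernel_profile_anti => //.
  by have [] := one_sub_norm_le_dist Dz Dw.
move=> al0 z w Dz Dw; have w1 := pairing_lt1 Dz Dw.
apply/eqP; rewrite eq_le normc_ge0 andbT.
apply: (le_trans (model_kernel_le gamma nu_fin w1)).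
suff h : kap (normc (1 - pairing (z, w))) <= 0 by rewrite pmulr_rle0.
set t := normc _; have t0 : 0 < t := dist1_gt0 w1.
have t2 : t <= 2 := dist1_le2 w1.
have l1 : 1 <= 2 / t by rewrite ler_pdivlMr// mul1r.
apply: (le_trans (kernel_profile_dilate gamma_ge1 nu_fin t0 l1)).
rewrite divfK ?gt_eqF//.
suff : kap 2 <= 0 by move=> k0; rewrite mulr_ge0_le0// powR_ge0.
have : al 0%N = kap 1 by rewrite /dyadic_coef expr0 invr1.
rewrite al0 => ->; apply: kernel_profile_anti => //.
by rewrite ler1n.
Qed.

End kernel_of_representation.

Section bergman_kernel.
Context {R : realType}.
Local Notation C := R[i].

Lemma dyadic_kernel_ext (b b' : C -> C -> R) al c :
  (forall z w, disc z -> disc w -> b z w = b' z w) ->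
  dyadic_kernel b al c -> dyadic_kernel b' al c.
Proof.
move=> e [[mb b0] sym c0 a0 asum low up loc zero]; split=> //.
- split; last by move=> z w Dz Dw; rewrite -e//; exact: b0.
  apply: eq_measurable_fun mb => -[z w]; rewrite inE => -[/= Dz Dw].
  exact: e.
- by move=> z w Dz Dw; rewrite -!e//; exact: sym.
- move=> s n z w ss; rewrite -e; first exact: low ss.
    by case/and3P: ss => /asboolP[].
  by case/and3P: ss => _ /asboolP[].
- by move=> z w Dz Dw; rewrite -e//; exact: up.
- by move=> z Dz; have [M h] := loc _ Dz; exists M => w Dw; rewrite -e//; exact: h.
- by move=> al0 z w Dz Dw; rewrite -e//; exact: zero.
Qed.

(** At the origin the representation says that [nu] has finite mass. *)
Lemma representation_dyadic (B : C -> C -> C) : kernel_representation B ->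
  exists al c, dyadic_kernel (fun z w => normc (B z w)) al c.
Proof.
move=> [gamma [nu [g1 _ rep]]].
have D0 : disc (0 : C) by rewrite /disc /= expr0n /= addr0 sqrtr0.
have nu_fin : (nu (`[(0:R)%R, (1:R)%R]%classic : set R) < +oo)%E.
  have [[int0 _] _] := rep 0 0 D0 D0.
  have : nu.-integrable `[0, 1]%classic (EFin \o (fun _ : R => 1 : R)).
    apply: eq_integrable int0 => //.
    by move=> r _ /=; congr EFin; field.
  move=> /integrableP[_]; under eq_integral do rewrite /= normr1.
  by rewrite integral_cst ?mul1e//; exact: measurable_itv.
exists (dyadic_coef gamma nu), (6 * 32 `^ (gamma + 1)).
apply: dyadic_kernel_ext (dyadic_kernel_model g1 nu_fin) => z w Dz Dw.
have [_ ->] := rep z w Dz Dw.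
suff e : resolvent (pairing (z, w)) = fun r => (1 - r%:C%C * (z^*)%C * w)^-1.
  by rewrite /model_kernel e.
by apply/funext => r; rewrite /resolvent mulrA.
Qed.

End bergman_kernel.

(** * Testing conditions for the maximal projection *)

Section translation.
Context {R : realType}.
Local Notation C := R[i].
Variable omega : {finite_measure set R -> \bar R}.
Variable B : C -> C -> C.
Local Notation mu := (omega_m omega).
Local Notation b := (fun z w : C => normc (B z w)).
Local Notation op := (positive_op mu b).
Local Notation cut A f := (fun w : C => \1_A w * f w)%R.

Lemma omega_m_disc_fin : (mu disc < +oo)%E.
Proof.
have mcell : measurable (@polar_cell R).
  by apply: measurableX; exact: measurable_itv.
have mD : measurable (polar_cell `&` (@polar R) @^-1` disc).
  apply: measurableI => //; rewrite -[X in measurable X]setTI.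
  exact: measurable_polar.
apply: (@le_lt_trans _ _ ((omega \x (@lebesgue_measure R))%E polar_cell)).
  rewrite /= /omega_m -[leRHS]mul1e -integral_cst//.
  apply: (@le_trans _ _ (\int[omega \x (@lebesgue_measure R)]_(q in
      polar_cell `&` (@polar R) @^-1` disc) 1)%E).
    apply: ge0_le_integral => //.
    - move=> [r t] [[/= rt _] _]; rewrite lee_fin.
      by move: rt; rewrite in_itv /= => /andP[].
    - by apply/measurable_EFinP; apply: measurable_funTS; exact: measurable_fst.
    - move=> [r t] [[/= rt _] _]; rewrite lee_fin.
      by move: rt; rewrite in_itv /= => /andP[_ /ltW].
  by apply: ge0_subset_integral => //; exact: subIsetl.
rewrite /polar_cell product_measure1E; try exact: measurable_itv.
rewrite lte_mul_pinfty ?measure_ge0//.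
  by rewrite fin_num_measure//; exact: measurable_itv.
have := @lebesgue_measure_itv R (`[0, 2 * pi[).
rewrite /= => e; apply: (@eq_ind_r _ _ (fun x => (x < +oo)%E) _ _ e).
by case: ifP => _; rewrite ?ltry.
Qed.

(** Where the integral diverges both sides are 0 by convention. *)
Lemma maxproj_real (g : C -> R) (f : C -> C) z :
  (forall w, disc w -> f w = (g w)%:C%C) ->
  maxproj omega B f z = (fine (op g z))%:C%C.
Proof.
move=> fg; apply/eqP; rewrite eq_complex /=; apply/andP; split; apply/eqP.
  congr fine; apply: eq_integral => w; rewrite inE => Dw.
  by rewrite /maxproj_integrand (fg _ Dw) /= mul0r subr0 mulrC.
apply: (@etrans _ _ (\int[mu]_(w in disc) (0 : R))%R); last by rewrite Rintegral_cst// mul0r.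
apply: eq_Rintegral => w; rewrite inE => Dw.
by rewrite /maxproj_integrand (fg _ Dw) /= mulr0 mul0r addr0.
Qed.

Lemma poweR_inv_le (r K : R) (x y : \bar R) : 0 < r -> 0 <= K ->
  (0 <= x)%E -> (0 <= y)%E ->
  ((x `^ r^-1 <= K%:E * y `^ r^-1) <-> (x <= (K `^ r)%:E * y))%E.
Proof.
move=> r0 K0 x0 y0; have rn : r != 0 by rewrite gt_eqF.
have e : ((K%:E * y `^ r^-1) `^ r = (K `^ r)%:E * y)%E.
  by rewrite poweRM ?lee_fin ?poweR_ge0// poweRVK.
split=> h.
  rewrite -e -[leLHS](poweRVK rn x0); apply: le_poweR => //; first exact: ltW.
  exact: poweR_ge0.
have -> : (K%:E * y `^ r^-1 = ((K `^ r)%:E * y) `^ r^-1)%E.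
  by rewrite -e poweRK// mule_ge0 ?lee_fin ?poweR_ge0.
by apply: le_poweR => //; rewrite invr_ge0 ltW.
Qed.

Lemma op_ge0 g z : posfun g -> disc z -> (0 <= op g z)%E.
Proof.
move=> [_ g0] _; apply: integral_ge0 => w Dw.
by rewrite lee_fin mulr_ge0 ?normc_ge0// g0.
Qed.

Section testing_forms.
Variables (r r' : R) (a bw : C -> R) (K : R).
Hypotheses (r_gt1 : 1 < r) (rr' : r^-1 + r'^-1 = 1).
Hypotheses (a0 : forall z, disc z -> 0 <= a z).
Hypotheses (mb : measurable_fun disc bw) (bw0 : forall z, disc z -> 0 < bw z).
Hypothesis K0 : 0 <= K.

Let r0 : 0 < r. Proof. exact: lt_trans r_gt1. Qed.
Let pbw : posfun bw. Proof. by split=> // z /bw0/ltW. Qed.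

Definition test_input (S : set C) : C -> C :=
  mulop (fun z => bw z `^ r'^-1) (fun z => (\1_S z * bw z `^ r^-1)%:C%C).

Lemma test_inputE S w : disc w -> test_input S w = (\1_S w * bw w)%:C%C.
Proof.
move=> Dw; rewrite /test_input /mulop -rmorphM /=; congr (_%:C)%C.
rewrite mulrCA -powRD ?(gt_eqF (bw0 Dw)) ?implybT//.
by rewrite addrC rr' powRr1// ltW// bw0.
Qed.

Lemma wnorm_input S : S `<=` disc ->
  wnorm omega r (cst 1) (fun z => (\1_S z * bw z `^ r^-1)%:C%C) =
  ((\int[mu]_(z in S) (bw z)%:E) `^ r^-1)%E.
Proof.
move=> SD; rewrite /wnorm -(integral_indic_mul mu _ SD); congr (_ `^ _)%E.
apply: eq_integral => z; rewrite inE => Dz; congr EFin.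
rewrite /cst mulr1 normc_real ger0_norm ?mulr_ge0 ?powR_ge0//.
rewrite powRM ?powR_ge0// -powRrM mulVf ?gt_eqF// powRr1 ?(ltW (bw0 Dz))//.
by rewrite indicE; case: (_ \in _); rewrite ?powR1// powR0// gt_eqF.
Qed.

Lemma wnorm_output f : wnorm omega r (cst 1) (mulop (fun z => a z `^ r^-1) f) =
  wnorm omega r a f.
Proof.
rewrite /wnorm; congr (_ `^ _)%E.
apply: eq_integral => z; rewrite inE => Dz; congr EFin.
rewrite /cst /mulop mulr1 normcM normc_real.
rewrite ger0_norm ?powR_ge0// powRM ?powR_ge0 ?normc_ge0//.
by rewrite -powRrM mulVf ?gt_eqF// powRr1 ?a0// mulrC.
Qed.

Lemma wnorm_maxproj S : S `<=` disc -> measurable S ->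
  wnorm omega r a (maxproj omega B (test_input S)) =
  ((\int[mu]_(z in disc) (fine (op (cut S bw) z) `^ r * a z)%:E) `^ r^-1)%E.
Proof.
move=> SD mS; rewrite /wnorm; apply: (f_equal (fun x => x `^ r^-1)%E).
apply: eq_integral => z; rewrite inE => Dz; congr EFin.
rewrite (maxproj_real (g := cut S bw)); last exact: test_inputE.
rewrite normc_real ger0_norm// fine_ge0// op_ge0//.
by apply: posfunM => //; exact: posfun_indic.
Qed.

(** On the disc the two powers of [bw] in the test function multiply to [bw],
    and the factor [a `^ r^-1] moves into the weight of the norm; what remains
    is to take powers of both sides. *)
Lemma testing_iff : testing omega B r r' a bw K <->
  forall S, carleson_square S ->
  (\int[mu]_(z in disc) (fine (op (cut S bw) z) `^ r * a z)%:E
   <= (K `^ r)%:E * \int[mu]_(z in S) (bw z)%:E)%E.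
Proof.
have side S : carleson_square S ->
   (0 <= \int[mu]_(z in disc) (fine (op (cut S bw) z) `^ r * a z)%:E)%E /\
   (0 <= \int[mu]_(z in S) (bw z)%:E)%E.
  move=> cS; split; apply: integral_ge0 => z Dz; rewrite lee_fin.
    by rewrite mulr_ge0 ?powR_ge0// a0.
  by apply/ltW/bw0; exact: carleson_square_disc cS _ Dz.
split=> test S cS; have mS := measurable_carleson_square cS;
  have SD := carleson_square_disc cS; have [h1 h2] := side S cS.
  have := test S cS; rewrite /= -/(test_input S) wnorm_input// wnorm_output.
  by rewrite wnorm_maxproj// => /(poweR_inv_le r0 K0 h1 h2).1.
rewrite /= -/(test_input S) wnorm_input// wnorm_output wnorm_maxproj//.
by apply/(poweR_inv_le r0 K0 h1 h2); exact: test.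
Qed.

End testing_forms.

Section finite_ops.
Variables (al : nat -> R) (c : R).
Hypothesis dk : dyadic_kernel b al c.

Lemma op_fin g z : posfun g -> summable_on mu g -> disc z -> (op g z < +oo)%E.
Proof.
move=> pg sg Dz; have [M hM] := dk_local dk Dz.
have M0 : 0 <= M by apply: le_trans (hM _ Dz); exact: normc_ge0.
apply: (@le_lt_trans _ _ (M%:E * \int[mu]_(w in disc) (g w)%:E)%E); last first.
  by rewrite lte_mul_pinfty.
have [mg g0] := posfunE pg.
rewrite -ge0_integralZl_EFin//; apply: ge0_le_integral => //.
- by move=> w Dw; rewrite lee_fin mulr_ge0 ?normc_ge0// pg.2.
- apply/measurable_EFinP; apply: measurable_funM; last exact: pg.1.
  exact: measurable_slice (dk_pos dk) Dz.
- exact: measurable_funeM.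
by move=> w Dw; rewrite -EFinM lee_fin ler_wpM2r ?hM// pg.2.
Qed.

Lemma summable_cut S g : measurable S -> S `<=` disc -> posfun g ->
  (\int[mu]_(z in S) (g z)%:E < +oo)%E -> summable_on mu (cut S g).
Proof.
by move=> mS SD pg sg; rewrite /summable_on (integral_indic_mul mu _ SD).
Qed.

Lemma fine_opE S r (a bw : C -> R) : carleson_square S -> posfun bw ->
  (\int[mu]_(z in S) (bw z)%:E < +oo)%E ->
  (\int[mu]_(z in disc) (fine (op (cut S bw) z) `^ r * a z)%:E =
   \int[mu]_(z in disc) (op (cut S bw) z `^ r * (a z)%:E))%E.
Proof.
move=> cS pbw sbw; apply: eq_integral => z; rewrite inE => Dz.
have mS := measurable_carleson_square cS; have SD := carleson_square_disc cS.
have pc : posfun (cut S bw) by apply: posfunM => //; exact: posfun_indic.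
have f := op_fin pc (summable_cut mS SD pbw sbw) Dz.
by rewrite EFinM -poweR_EFin fineK// ge0_fin_numE ?op_ge0.
Qed.

Lemma testing_carleson r r' (a bw : C -> R) K : 1 < r -> r^-1 + r'^-1 = 1 ->
  posfun a -> measurable_fun disc bw -> (forall z, disc z -> 0 < bw z) ->
  summable_on mu bw -> 0 <= K ->
  testing omega B r r' a bw K <-> carleson_testing mu b r bw a K.
Proof.
move=> r1 rr' [ma a0] mb bw0 sbw K0.
have pbw : posfun bw by split=> // z /bw0/ltW.
have fS S : carleson_square S -> (\int[mu]_(z in S) (bw z)%:E < +oo)%E.
  move=> cS; have mS := measurable_carleson_square cS.
  have h := le_integral_subset mu pbw mS (carleson_square_disc cS). exact: le_lt_trans h sbw.
apply: (iff_trans (testing_iff r1 rr' a0 mb bw0 K0)).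
by split=> test S cS; have := test S cS; rewrite fine_opE//; exact: fS.
Qed.

End finite_ops.
End translation.

(** * Sufficiency of the testing conditions *)

Section backward.
Context {R : realType}.
Local Notation C := R[i].
Variable omega : {finite_measure set R -> \bar R}.
Variable B : C -> C -> C.
Local Notation mu := (omega_m omega).
Local Notation b := (fun z w : C => normc (B z w)).
Local Notation op := (positive_op mu b).
Local Notation cut A f := (fun w : C => \1_A w * f w)%R.
Variables (al : nat -> R) (c : R).
Hypothesis dk : dyadic_kernel b al c.

Lemma carleson_square_full : carleson_square (@disc R).
Proof.
have <- : dyadic_square 0 0 0 = @disc R.
  apply/seteqP; split=> z; first by case=> -[].
  by move=> Dz; split; [exact: height0|rewrite /dig digit0].
by apply: dyadic_square_carleson; rewrite expn0.
Qed.

Lemma kernel_lower (z w : C) : disc z -> disc w -> al 0%N / c <= b z w.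
Proof.
move=> Dz Dw; rewrite ler_pdivrMr ?(dk_c dk)// mulrC.
apply: (dk_lower dk (s := 0)); rewrite /same_square /dig !digit0 eqxx andbT.
by apply/andP; split; apply/asboolP; exact: height0.
Qed.

Lemma op_zero f z : al 0%N = 0 -> disc z -> op f z = 0%E.
Proof.
move=> al0 Dz; apply: integral0_eq => w Dw.
by rewrite (dk_zero dk al0 Dz Dw) mul0r.
Qed.

Lemma weight_pos v : weight omega v ->
  [/\ forall z, disc z -> 0 < v z, measurable_fun disc v, posfun v & summable_on mu v].
Proof.
move=> [v0 iv]; have mv : measurable_fun disc v.
  by apply/measurable_EFinP; exact: measurable_int iv.
split=> //; first by split=> // z /v0/ltW.
have := integrableP _ _ _ iv => -[_]; apply: le_lt_trans.
apply: ge0_le_integral => //.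
- by move=> z /v0/ltW; rewrite lee_fin.
- exact/measurable_EFinP.
- by apply: measurableT_comp => //; exact/measurable_EFinP.
by move=> z Dz; exact: lee_abs.
Qed.

Lemma null_disc (u : C -> R) : (forall z, disc z -> 0 < u z) -> measurable_fun disc u ->
  (\int[mu]_(z in disc) (u z)%:E = 0)%E -> mu disc = 0%E.
Proof.
move=> u0 mu' h.
have : (\int[mu]_(z in disc) `|(u z)%:E| = 0)%E.
  rewrite -[RHS]h; apply: eq_integral => z; rewrite inE => Dz.
  by rewrite gee0_abs// lee_fin ltW// u0.
have me : measurable_fun disc (EFin \o u) by exact/measurable_EFinP.
move/(ae_eq_integral_abs mu measurable_disc me).1 => [N [mN N0 sub]].
apply/eqP; rewrite eq_le measure_ge0 andbT -N0; apply: le_measure; rewrite ?inE//.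
move=> z Dz; apply: sub => /= /(_ Dz) [] uz.
by have := u0 _ Dz; rewrite uz ltxx.
Qed.

(** The kernel is bounded below on the disc, so the image of [u] is at least a
    positive constant there, and its test on the whole disc bounds the integral
    of [v]; if [u] has no mass, then the disc is a null set. *)
Lemma dual_weight_summable q (v u : C -> R) K : 1 < q -> 0 <= K -> 0 < al 0%N ->
  weight omega u -> posfun v -> carleson_testing mu b q u v K ->
  summable_on mu v.
Proof.
move=> q1 K0 al0 wu pv test.
have [u0 mu' pu su] := weight_pos wu.
have q0 : 0 < q := lt_trans ltr01 q1.
pose U := integ mu disc u.
have UE : (U%:E = \int[mu]_(z in disc) (u z)%:E)%E by rewrite /U integE.
have U0 : 0 <= U by exact: integ_ge0.
have [U00|Une] := eqVneq U 0.
  have m0 : mu disc = 0%E by apply: (null_disc u0) => //; rewrite -UE U00.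
  rewrite /summable_on null_set_integral//.
  by case: pv => mv _; exact/measurable_EFinP.
have Up : 0 < U by rewrite lt_neqAle eq_sym Une.
pose d := al 0%N / c * U.
have d0 : 0 < d by rewrite mulr_gt0// divr_gt0// (dk_c dk).
have [mv v0] := posfunE pv.
have pcu : posfun (cut disc u).
  by apply: posfunM => //; exact: posfun_indic.
have low z : disc z -> (d%:E <= op (cut disc u) z)%E.
  move=> Dz; rewrite /d EFinM UE.
  have [mue u0e] := posfunE pu.
  rewrite -ge0_integralZl_EFin//; last by rewrite divr_ge0 ?(ltW al0) ?(ltW (dk_c dk)).
  apply: ge0_le_integral => //.
  - move=> w Dw; rewrite -EFinM lee_fin mulr_ge0 ?(ltW (u0 _ _))//.
    by rewrite divr_ge0 ?(ltW al0) ?(ltW (dk_c dk)).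
  - exact: measurable_funeM.
  - apply/measurable_EFinP; apply: measurable_funM; last exact: pcu.1.
    exact: measurable_slice (dk_pos dk) Dz.
  move=> w Dw; rewrite -EFinM lee_fin indicE mem_set// mul1r ler_wpM2r//.
    by rewrite ltW// u0.
  exact: kernel_lower.
have dq : (0 < (d `^ q)%:E)%E by rewrite lte_fin powR_gt0.
have : ((d `^ q)%:E * \int[mu]_(z in disc) (v z)%:E < +oo)%E.
  apply: (@le_lt_trans _ _ ((K `^ q)%:E * U%:E)%E); last by rewrite -EFinM ltry.
  rewrite UE; apply: le_trans (test _ carleson_square_full).
  rewrite -ge0_integralZl_EFin ?powR_ge0//; apply: ge0_le_integral => //.
  - by move=> z Dz; rewrite mule_ge0 ?lee_fin ?powR_ge0//; exact: pv.2.
  - exact: measurable_funeM.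
  - apply: emeasurable_funM => //; apply: (measurableT_comp (measurable_poweR q)).
    apply: measurable_positive_op => //; last exact: dk_pos dk.
    exact: omega_m_disc_fin.
  move=> z Dz; rewrite lee_wpmul2r ?v0// -poweR_EFin; apply: le_poweR.
  - exact: ltW.
  - by rewrite lee_fin ltW.
  - exact: low.
rewrite /summable_on; case: (integral _ _ _) => [x||]; rewrite ?ltry//.
by rewrite gt0_muley.
Qed.

Section bound_to_norm.
Variables (p : R) (v u : C -> R) (M : R).
Hypothesis p_gt1 : 1 < p.
Hypotheses (wv : weight omega v) (wu : weight omega u).
Hypothesis M0 : 0 <= M.
Hypothesis bound : forall phi, posfun phi ->
  summable_on mu (fun z => phi z `^ p * v z) ->
  (\int[mu]_(z in disc) (op phi z `^ p * (u z)%:E)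
   <= (M `^ p)%:E * \int[mu]_(z in disc) (phi z `^ p * v z)%:E)%E.

Let p0 : 0 < p. Proof. exact: lt_trans p_gt1. Qed.

Lemma maxproj_integrand_Re f z w : complex.Re (maxproj_integrand B f z w) =
  b z w * complex.Re (f w).
Proof. by rewrite /maxproj_integrand; case: (f w) => x y /=; rewrite mulr0 subr0 mulrC. Qed.

Lemma maxproj_integrand_Im f z w : complex.Im (maxproj_integrand B f z w) =
  b z w * complex.Im (f w).
Proof. by rewrite /maxproj_integrand; case: (f w) => x y /=; rewrite mulr0 add0r mulrC. Qed.

Lemma signed_integrable (g : C -> R) phi z : measurable_fun disc g -> posfun phi ->
  (forall w, disc w -> `|g w| <= phi w) -> disc z -> (op phi z < +oo)%E ->
  mu.-integrable disc (fun w => (b z w * g w)%:E).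
Proof.
move=> mg pphi gphi Dz fin; apply/integrableP.
have ms := measurable_slice (dk_pos dk) Dz; split.
  by apply/measurable_EFinP; exact: measurable_funM.
apply: le_lt_trans fin; apply: ge0_le_integral => //.
- apply: measurableT_comp => //; apply/measurable_EFinP; exact: measurable_funM.
- by apply/measurable_EFinP; apply: measurable_funM => //; exact: pphi.1.
move=> w Dw; rewrite /= lee_fin normrM ger0_norm ?normc_ge0//.
by rewrite ler_wpM2l ?normc_ge0// gphi.
Qed.

Lemma signed_integral_le (g : C -> R) phi z : measurable_fun disc g -> posfun phi ->
  (forall w, disc w -> `|g w| <= phi w) -> disc z -> (op phi z < +oo)%E ->
  (`|\int[mu]_(w in disc) (b z w * g w)|%:E <= op phi z)%E.
Proof.
move=> mg pphi gphi Dz fin.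
have ig := signed_integrable mg pphi gphi Dz fin.
apply: (@le_trans _ _ (\int[mu]_(w in disc) `|(b z w * g w)%:E|)%E).
  have fi := integrable_fin_num measurable_disc ig.
  rewrite /Rintegral -abse_EFin fineK//.
  by apply: le_abse_integral => //; exact: measurable_int ig.
apply: ge0_le_integral => //.
- by apply: measurableT_comp => //; exact: measurable_int ig.
- apply/measurable_EFinP; apply: measurable_funM; last exact: pphi.1.
  exact: measurable_slice (dk_pos dk) Dz.
move=> w Dw; rewrite /= lee_fin normrM ger0_norm ?normc_ge0//.
by rewrite ler_wpM2l ?normc_ge0// gphi.
Qed.

Lemma measurable_signed_op (g : C -> R) : measurable_fun disc g ->
  measurable_fun disc (fun z => \int[mu]_(w in disc) (b z w * g w)).
Proof.
move=> mg.
have mpos (h : C -> R) : measurable_fun disc h ->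
    measurable_fun disc (op (fun w => Num.max (h w) 0)).
  move=> mh; apply: measurable_positive_op.
  - exact: omega_m_disc_fin.
  - exact: dk_pos dk.
  split=> [|w _]; last by rewrite le_max lexx orbT.
  exact: measurable_maxr.
pose gp w := Num.max (g w) 0; pose gm w := Num.max (- g w) 0.
apply: (@eq_measurable_fun _ _ _ _ _ (fun z => fine (op gp z - op gm z)%E)).
  move=> z; rewrite inE => Dz; rewrite /Rintegral [in RHS]integralE.
  congr (fine (_ - _)); apply: eq_integral => w _.
    by rewrite funeposE /= -EFin_max maxr_pMr ?normc_ge0// mulr0.
  by rewrite funenegE /= -EFin_max -mulrN /gm maxr_pMr ?normc_ge0// mulr0.
apply: measurableT_comp => //.
apply: emeasurable_funB; apply: mpos => //.
exact: measurableT_comp.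
Qed.

(** The positive operator applied to [|f|] dominates real and imaginary part,
    whence the factor 2; its finite norm and the positivity of [u] give absolute
    convergence almost everywhere. *)
Lemma maxproj_boundP : maxproj_bound omega B p v u (2 * M).
Proof.
have [v0 mv pv sv] := weight_pos wv; have [u0 mu' pu su] := weight_pos wu.
split; first by rewrite mulr_ge0.
move=> f [mf nf].
pose phi z := normc (f z).
have pphi : posfun phi.
  split=> [|z _]; last exact: normc_ge0.
  exact: measurableT_comp (@measurable_normc R) mf.
have mRe : measurable_fun disc (fun w => complex.Re (f w)).
  exact: measurableT_comp (@measurable_Re R) mf.
have mIm : measurable_fun disc (fun w => complex.Im (f w)).
  exact: measurableT_comp (@measurable_Im R) mf.
have gRe w : disc w -> `|complex.Re (f w)| <= phi w by move=> _; exact: Re_le_normc.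
have gIm w : disc w -> `|complex.Im (f w)| <= phi w by move=> _; exact: Im_le_normc.
have pi0 : p^-1 != 0 by rewrite invr_neq0// gt_eqF.
have sphi : summable_on mu (fun z => phi z `^ p * v z).
  exact: lty_poweRy nf.
have bd := bound pphi sphi.
have P0 z : disc z -> (0 <= op phi z)%E by exact: op_ge0.
have mP : measurable_fun disc (op phi).
  by apply: measurable_positive_op => //; [exact: omega_m_disc_fin|exact: dk_pos dk].
have [mue u0e] := posfunE pu.
have mPu : measurable_fun disc (fun z => op phi z `^ p * (u z)%:E)%E.
  by apply: emeasurable_funM => //; apply: (measurableT_comp (measurable_poweR p)).
have Pu0 z : disc z -> (0 <= op phi z `^ p * (u z)%:E)%E.
  by move=> Dz; rewrite mule_ge0 ?poweR_ge0// u0e.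
have finE : (\int[mu]_(z in disc) (op phi z `^ p * (u z)%:E) < +oo)%E.
  by apply: (le_lt_trans bd); rewrite lte_mul_pinfty ?lee_fin ?powR_ge0.
have aefin : {ae mu, forall z, disc z -> (op phi z < +oo)%E}.
  have : mu.-integrable disc (fun z => op phi z `^ p * (u z)%:E)%E.
    apply/integrableP; split=> //; apply: le_lt_trans finE.
    apply: ge0_le_integral => //; first exact: measurableT_comp.
    by move=> z Dz; rewrite gee0_abs// Pu0.
  move=> /(integrable_ae measurable_disc); apply: filterS => z h Dz.
  have := h Dz; rewrite ltey; apply: contraTneq => ->.
  by rewrite poweRyr ?gt_eqF// gt0_mulye// lte_fin u0.
have le2 z : disc z -> ((normc (maxproj omega B f z))%:E <= 2%:E * op phi z)%E.
  move=> Dz; have [fin|] := boolP (op phi z < +oo)%E; last first.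
    by rewrite -leNgt leye_eq => /eqP ->; rewrite gt0_muley ?leey.
  apply: (@le_trans _ _ (`|\int[mu]_(w in disc) (b z w * complex.Re (f w))|%:E +
      `|\int[mu]_(w in disc) (b z w * complex.Im (f w))|%:E)%E).
    rewrite -EFinD lee_fin (le_trans (normc_le _))//= lerD//.
      rewrite le_eqVlt; apply/orP; left; apply/eqP; congr `|_|.
      by apply: eq_Rintegral => w _; rewrite maxproj_integrand_Re.
    rewrite le_eqVlt; apply/orP; left; apply/eqP; congr `|_|.
    by apply: eq_Rintegral => w _; rewrite maxproj_integrand_Im.
  rewrite (_ : 2%:E = 1 + 1)%E// ge0_muleDl// !mul1e; apply: leeD.
    exact: signed_integral_le gRe Dz fin.
  exact: signed_integral_le gIm Dz fin.
have mmax : measurable_fun disc (maxproj omega B f).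
  apply: measurable_complex.
    apply: eq_measurable_fun (measurable_signed_op mRe) => z _ /=.
    by apply: eq_Rintegral => w _; rewrite maxproj_integrand_Re.
  apply: eq_measurable_fun (measurable_signed_op mIm) => z _ /=.
  by apply: eq_Rintegral => w _; rewrite maxproj_integrand_Im.
have normle : (wnorm omega p u (maxproj omega B f) <= (2 * M)%:E * wnorm omega p v f)%E.
  apply/(poweR_inv_le p0 _ _ _).
  - by rewrite mulr_ge0.
  - apply: integral_ge0 => z Dz; rewrite lee_fin mulr_ge0 ?powR_ge0//.
    by rewrite ltW// u0.
  - apply: integral_ge0 => z Dz; rewrite lee_fin mulr_ge0 ?powR_ge0//.
    by rewrite ltW// v0.
  apply: (@le_trans _ _ ((2 `^ p)%:E * \int[mu]_(z in disc) (op phi z `^ p * (u z)%:E))%E).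
    rewrite -ge0_integralZl_EFin ?powR_ge0//; apply: ge0_le_integral => //.
    - by move=> z Dz; rewrite lee_fin mulr_ge0 ?powR_ge0// ltW// u0.
    - apply/measurable_EFinP; apply: measurable_funM => //.
      apply: (measurableT_comp (measurable_powR p)).
      exact: measurableT_comp (@measurable_normc R) mmax.
    - exact: measurable_funeM.
    move=> z Dz; rewrite EFinM muleA lee_wpmul2r ?u0e//.
    rewrite -!poweR_EFin -poweRM ?P0//; apply: le_poweR; first exact: ltW.
      by rewrite lee_fin normc_ge0.
    exact: le2.
  rewrite powRM// EFinM -muleA lee_wpmul2l ?lee_fin ?powR_ge0//.
split=> //.
- apply: filterS aefin => z h Dz; have fin := h Dz; split.
    have := signed_integrable mRe pphi gRe Dz fin; apply: eq_integrable => // w _.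
    by rewrite maxproj_integrand_Re.
  have := signed_integrable mIm pphi gIm Dz fin; apply: eq_integrable => // w _.
  by rewrite maxproj_integrand_Im.
split=> //; apply: (le_lt_trans normle).
by rewrite lte_mul_pinfty ?lee_fin ?mulr_ge0.
Qed.

End bound_to_norm.

(** Both testing conditions are restated with infinite values allowed, which
    requires the summability of the dual weight: it is a consequence of the
    second condition unless the kernel vanishes. *)
Theorem testing_sufficient p q (v u : C -> R) C0 C0s :
  1 < p -> 1 < q -> p^-1 + q^-1 = 1 -> weight omega v -> weight omega u ->
  0 < C0 -> 0 < C0s ->
  testing omega B p q u (fun z => v z `^ (1 - q)) C0 ->
  testing omega B q p (fun z => v z `^ (1 - q)) u C0s ->
  maxproj_bound omega B p v u (2 * (32 * c ^+ 2 * form_cst p q * (C0 + C0s))).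
Proof.
move=> p1 q1 pq wv wu C00 C0s0 test test'.
have [v0 mv pv sv] := weight_pos wv; have [u0 mu' pu su] := weight_pos wu.
have c0 := dk_c dk.
have p0 : 0 < p := lt_trans ltr01 p1.
have M0 : 0 <= 32 * c ^+ 2 * form_cst p q * (C0 + C0s).
  rewrite !mulr_ge0 ?exprn_ge0 ?(ltW c0)//; last by rewrite addr_ge0// ltW.
  exact/ltW/form_cst_gt0.
apply: maxproj_boundP => // phi pphi se.
pose sg z := v z `^ (1 - q).
have psg : posfun sg by exact: posfun_powR.
have qp : q^-1 + p^-1 = 1 by rewrite addrC.
have ct' : carleson_testing mu b q u sg C0s.
  exact: (testing_carleson dk q1 qp psg mu' u0 su (ltW C0s0)).1 test'.
have [al0|al0] := eqVneq (al 0%N) 0.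
  rewrite integral0_eq; last first.
    by move=> z Dz; rewrite op_zero// poweR0r ?gt_eqF// mul0e.
  rewrite mule_ge0 ?lee_fin ?powR_ge0// integral_ge0// => z Dz.
  by rewrite lee_fin mulr_ge0 ?powR_ge0// ltW// v0.
have alp : 0 < al 0%N by rewrite lt_neqAle eq_sym al0 (dk_coef dk).
have ssg : summable_on mu sg.
  exact: dual_weight_summable q1 (ltW C0s0) alp wu psg ct'.
have sg0 z : disc z -> 0 < sg z by move=> Dz; rewrite powR_gt0// v0.
have ct : carleson_testing mu b p sg u C0.
  exact: (testing_carleson dk p1 pq pu psg.1 sg0 ssg (ltW C00)).1 test.
exact: (two_weight_sufficiency (omega_m_disc_fin omega) p1 q1 pq (dk_pos dk) c0
  (dk_coef dk) (dk_sum dk) (dk_lower dk) (dk_upper dk) mv v0 pu su ssg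
  C00 C0s0 ct ct' pphi se).
Qed.

End backward.

(** * Necessity of the testing conditions *)

Section necessity.
Context {R : realType}.
Local Notation C := R[i].
Variable omega : {finite_measure set R -> \bar R}.
Variable B : C -> C -> C.
Local Notation mu := (omega_m omega).
Local Notation b := (fun z w : C => normc (B z w)).
Local Notation op := (positive_op mu b).
Local Notation cut A f := (fun w : C => \1_A w * f w)%R.
Variables (al : nat -> R) (c : R).
Hypothesis dk : dyadic_kernel b al c.
Variables (p q : R).
Hypotheses (p_gt1 : 1 < p) (q_gt1 : 1 < q) (pq : p^-1 + q^-1 = 1).
Variables (v u : C -> R) (K : R).
Hypotheses (wv : weight omega v) (wu : weight omega u).
Hypothesis bnd : maxproj_bound omega B p v u K.

Let p0 : 0 < p. Proof. exact: lt_trans p_gt1. Qed.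
Let q0 : 0 < q. Proof. exact: lt_trans q_gt1. Qed.
Let v0 : forall z, disc z -> 0 < v z. Proof. exact: wv.1. Qed.
Let u0 : forall z, disc z -> 0 < u z. Proof. exact: wu.1. Qed.
Let pv : posfun v. Proof. by have [] := weight_pos wv. Qed.
Let pu : posfun u. Proof. by have [] := weight_pos wu. Qed.
Lemma u_summable : summable_on mu u. Proof. by have [] := weight_pos wu. Qed.
Let sg z := v z `^ (1 - q).
Let psg : posfun sg. Proof. exact: posfun_powR. Qed.
Let sg0 z : disc z -> 0 < sg z. Proof. by move=> Dz; rewrite powR_gt0// v0. Qed.
Let K0 : 0 <= K. Proof. by case: bnd. Qed.

Let measurable_op f : posfun f -> measurable_fun disc (op f).
Proof.
move=> pf; apply: measurable_positive_op => //; first exact: omega_m_disc_fin.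
exact: dk_pos dk.
Qed.

Lemma wnorm_real r (a g : C -> R) : posfun g ->
  wnorm omega r a (fun w => (g w)%:C%C) =
  ((\int[mu]_(z in disc) (g z `^ r * a z)%:E) `^ r^-1)%E.
Proof.
move=> pg; rewrite /wnorm; apply: (f_equal (fun x => x `^ r^-1)%E).
apply: eq_integral => z; rewrite inE => Dz.
by rewrite normc_real (ger0_norm (pg.2 z Dz)).
Qed.

Lemma op_fin_of_cintegrable (g : C -> R) z : posfun g -> disc z ->
  cintegrable mu disc (maxproj_integrand B (fun w => (g w)%:C%C) z) ->
  (op g z < +oo)%E.
Proof.
move=> pg Dz [/integrableP[_ fin] _].
suff <- : (\int[mu]_(w in disc)
   `|(complex.Re (maxproj_integrand B (fun w => (g w)%:C%C) z w))%:E| = op g z)%E by [].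
apply: eq_integral => w; rewrite inE => Dw.
by rewrite maxproj_integrand_Re gee0_abs// lee_fin mulr_ge0 ?normc_ge0 ?(pg.2 w Dw).
Qed.

(** The projection is 0 by convention where its integral diverges; absolute
    convergence almost everywhere identifies it with the positive operator. *)
Lemma bound_on_posfun g : posfun g -> summable_on mu (fun z => g z `^ p * v z) ->
  (\int[mu]_(z in disc) (op g z `^ p * (u z)%:E)
   <= (K `^ p)%:E * \int[mu]_(z in disc) (g z `^ p * v z)%:E)%E.
Proof.
move=> pg sgv; have [mu' u0e] := posfunE pu.
have pfop : posfun (fun z => fine (op g z)).
  split=> [|z Dz]; last by rewrite fine_ge0// op_ge0.
  by apply: measurableT_comp => //; exact: measurable_op.
have pfpu := posfunM (posfun_powR p pfop) pu.
have [mfpu fpu0] := posfunE pfpu.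
have gv0 := (posfunE (posfunM (posfun_powR p pg) pv)).2.
have mopu : measurable_fun disc (fun z => op g z `^ p * (u z)%:E)%E.
  apply: emeasurable_funM => //.
  exact: measurableT_comp (measurable_poweR p) (measurable_op pg).
have opu0 z : disc z -> (0 <= op g z `^ p * (u z)%:E)%E.
  by move=> Dz; apply: mule_ge0; [exact: poweR_ge0|exact: u0e].
have inf : in_Lp omega p v (fun w => (g w)%:C%C).
  split; first by apply: measurable_complex; [exact: pg.1|exact: measurable_cst].
  by rewrite wnorm_real//; exact: poweR_lty.
have [aec _] := bnd.2 _ inf.
have -> : maxproj omega B (fun w => (g w)%:C%C) = fun z => (fine (op g z))%:C%C.
  by apply/funext => z; exact: maxproj_real.
rewrite (wnorm_real _ _ pfop) (wnorm_real _ _ pg).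
move=> /(poweR_inv_le p0 K0 (integral_ge0 mu fpu0) (integral_ge0 mu gv0)).1.
apply: le_trans; rewrite le_eqVlt; apply/orP; left; apply/eqP.
apply: (ge0_ae_eq_integral measurable_disc mopu mfpu opu0 fpu0).
apply: filterS aec => z h Dz.
have opf := op_fin_of_cintegrable pg Dz (h Dz).
have op0 := op_ge0 omega B pg Dz.
rewrite /= EFinM -poweR_EFin; congr (_ `^ _ * _)%E.
by rewrite fineK// ge0_fin_numE.
Qed.

Lemma op_scale (g : C -> R) z (k : R) : posfun g -> disc z -> 0 <= k ->
  (k%:E * op g z = \int[mu]_(w in disc) (b z w * g w * k)%:E)%E.
Proof.
move=> pg Dz k0.
have [mbg bg0] := posfunE (posfunM (posfun_slice (dk_pos dk) Dz) pg).
rewrite /positive_op -(ge0_integralZl_EFin mu measurable_disc bg0 mbg k0).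
by apply: eq_integral => w _; rewrite -EFinM mulrC.
Qed.

(** [p * (1 - q) + 1 = 1 - q] for conjugate exponents. *)
Lemma dual_power z : disc z -> sg z `^ p * v z = sg z.
Proof.
move=> Dz; have vz := v0 Dz; rewrite /sg -powRrM.
rewrite -{2}(powRr1 (ltW vz)) -powRD ?(gt_eqF vz) ?implybT//.
congr (_ `^ _); have := conj_mul p_gt1 q_gt1 pq.
by rewrite mulrBl mul1r [q * p]mulrC => ->; ring.
Qed.

Lemma indic_powR (A : set C) z : (\1_A z : R) `^ p = \1_A z.
Proof. by rewrite indicE; case: (_ \in _); rewrite ?powR1// powR0// gt_eqF. Qed.

(** The bound is applied to the dual weight cut off to the square; adding 1 to
    [K] makes the right-hand side infinite when this weight is not summable. *)
Lemma first_testing : testing omega B p q u sg (K + 1).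
Proof.
have K1 : 0 <= K + 1 by rewrite addr_ge0.
have ue z : disc z -> 0 <= u z by move=> Dz; rewrite ltW// u0.
apply/(testing_iff omega B p_gt1 pq ue psg.1 sg0 K1) => S cS.
have mS := measurable_carleson_square cS; have SD := carleson_square_disc cS.
have K1p : (0 < ((K + 1) `^ p)%:E)%E by rewrite lte_fin powR_gt0// ltr_wpDl.
have [fin|] := boolP (\int[mu]_(z in S) (sg z)%:E < +oo)%E; last first.
  by rewrite -leNgt leye_eq => /eqP ->; rewrite gt0_muley ?leey.
have pc : posfun (cut S sg) by apply: posfunM => //; exact: posfun_indic.
have E : (\int[mu]_(z in disc) ((\1_S z * sg z) `^ p * v z)%:E =
    \int[mu]_(z in S) (sg z)%:E)%E.
  rewrite -(integral_indic_mul mu _ SD); apply: eq_integral => z; rewrite inE => Dz.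
  by rewrite powRM ?(ltW (sg0 Dz))// indic_powR -mulrA dual_power.
have := bound_on_posfun pc; rewrite /summable_on E => /(_ fin).
rewrite (fine_opE dk p u cS psg fin) => /le_trans; apply.
rewrite lee_wpmul2r//.
  by apply: integral_ge0 => z /SD Dz; rewrite lee_fin; exact: psg.2.
rewrite lee_fin ge0_ler_powR ?nnegrE ?(ltW p0)//.
by rewrite lerDl.
Qed.

Section dual.
Variable S : set C.
Hypothesis cS : carleson_square S.

Let mS : measurable S. Proof. exact: measurable_carleson_square. Qed.
Let SD : S `<=` disc. Proof. exact: carleson_square_disc. Qed.
Let gS : C -> R := cut S u.
Let pgS : posfun gS. Proof. by apply: posfunM => //; exact: posfun_indic. Qed.
Let U : R := integ mu S u.
Lemma cut_massE : (U%:E = \int[mu]_(z in S) (u z)%:E)%E. Proof. exact: (integE pu u_summable mS SD). Qed.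
Lemma cut_summable : summable_on mu gS.
Proof. by rewrite /summable_on /gS (integral_indic_mul mu _ SD) -cut_massE ltry. Qed.
Let G z : R := fine (op gS z).
Let GE z : disc z -> (G z)%:E = op gS z.
Proof. by move=> Dz; rewrite fineK// ge0_fin_numE ?op_ge0//; exact: (op_fin dk pgS cut_summable Dz). Qed.
Let pG : posfun G.
Proof.
split=> [|z Dz]; last by rewrite fine_ge0// op_ge0.
by apply: measurableT_comp => //; exact: measurable_op.
Qed.

Definition low_set (n : nat) : set C := disc `&` [set z | sg z <= n%:R].

Lemma measurable_low_set n : measurable (low_set n).
Proof.
rewrite (_ : low_set n = disc `&` sg @^-1` `]-oo, n%:R]%classic).
  by apply: psg.1.
by apply/seteqP; split=> z [Dz] /=; rewrite in_itv.
Qed.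

Definition truncated (n : nat) (z : C) : R := Num.min (G z) n%:R.

(** The function [G `^ (q - 1) * sg], extremal in the duality that expresses the
    norm of [G] in [L^q(sg)] through [L^p(v)], truncated so as to have a finite
    norm. *)
Definition extremal (n : nat) (z : C) : R :=
  truncated n z `^ (q - 1) * sg z * \1_(low_set n) z.

Definition truncated_power (n : nat) (z : C) : R :=
  truncated n z `^ q * sg z * \1_(low_set n) z.

Lemma pos_truncated n : posfun (truncated n).
Proof.
split=> [|z Dz]; last by rewrite le_min pG.2//=.
by apply: measurable_minr => //; exact: pG.1.
Qed.

Lemma pos_extremal n : posfun (extremal n).
Proof.
apply: posfunM; last exact/posfun_indic/measurable_low_set.
by apply: posfunM => //; apply: posfun_powR; exact: pos_truncated.
Qed.

Lemma pos_truncated_power n : posfun (truncated_power n).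
Proof.
apply: posfunM; last exact/posfun_indic/measurable_low_set.
by apply: posfunM => //; apply: posfun_powR; exact: pos_truncated.
Qed.

Lemma extremal_power n z : disc z ->
  extremal n z `^ p * v z = truncated_power n z.
Proof.
move=> Dz; have s0 := ltW (sg0 Dz).
rewrite /extremal /truncated_power powRM ?mulr_ge0 ?powR_ge0//.
rewrite powRM ?powR_ge0// indic_powR -powRrM.
have -> : (q - 1) * p = q by rewrite mulrBl mul1r mulrC (conj_mul p_gt1 q_gt1 pq) addrAC subrr add0r.
by rewrite [LHS]mulrAC -[X in X * _ = _]mulrA dual_power.
Qed.

Lemma truncated_power_le n z : disc z -> truncated_power n z <= G z * extremal n z.
Proof.
move=> Dz; have t0 := (pos_truncated n).2 z Dz.
rewrite /extremal /truncated_power -(mulr_powRB1 t0 q0) -!mulrA ler_wpM2r//.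
  by rewrite !mulr_ge0 ?powR_ge0// ltW// sg0.
by rewrite ge_min lexx.
Qed.

Lemma truncated_power_fin n : summable_on mu (truncated_power n).
Proof.
apply: (@le_lt_trans _ _ ((n%:R `^ q * n%:R)%:E * mu disc)%E); last first.
  by rewrite lte_mul_pinfty ?lee_fin ?mulr_ge0 ?powR_ge0//; exact: omega_m_disc_fin.
rewrite -integral_cst//; have [mt t0] := posfunE (pos_truncated_power n).
apply: ge0_le_integral => //.
move=> z Dz; rewrite lee_fin /truncated_power indicE.
have [|_] := boolP (z \in _); last by rewrite mulr0 mulr_ge0 ?powR_ge0.
rewrite inE => -[_ /= sn]; rewrite mulr1 ler_pM ?powR_ge0 ?(ltW (sg0 Dz))//.
rewrite ge0_ler_powR ?(ltW q0)// ?nnegrE ?(pos_truncated n).2//.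
by rewrite ge_min lexx orbT.
Qed.

(** The operator is self-adjoint: the kernel is symmetric. *)
Lemma pairing_swap n :
  (\int[mu]_(z in disc) (G z * extremal n z)%:E =
   \int[mu]_(w in disc) ((gS w)%:E * op (extremal n) w))%E.
Proof.
have pk := dk_pos dk; have pe := pos_extremal n.
pose F (x : C * C) := (b x.1 x.2 * gS x.2 * extremal n x.1)%:E.
have mfst (h : C -> R) : posfun h ->
    measurable_fun (disc `*` disc) (fun x : C * C => h x.1).
  move=> [mh _] mDD A mA.
  rewrite (_ : _ `&` _ = (disc `&` h @^-1` A) `*` disc).
    by apply: measurableX => //; exact: mh.
  by apply/seteqP; split=> -[z w] /=; [case=> -[]|case=> -[]].
have msnd (h : C -> R) : posfun h ->
    measurable_fun (disc `*` disc) (fun x : C * C => h x.2).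
  move=> [mh _] mDD A mA.
  rewrite (_ : _ `&` _ = disc `*` (disc `&` h @^-1` A)).
    by apply: measurableX => //; exact: mh.
  by apply/seteqP; split=> -[z w] /=; [case=> -[]|case=> ? []].
have mF : measurable_fun (disc `*` disc) F.
  apply/measurable_EFinP; apply: measurable_funM; last exact: mfst.
  by apply: measurable_funM; [exact: pk.1|exact: msnd].
have F0 x : (disc `*` disc) x -> (0 <= F x)%E.
  move=> [D1 D2]; rewrite lee_fin; apply: mulr_ge0; last exact: pe.2.
  by apply: mulr_ge0; [exact: normc_ge0|exact: pgS.2].
have fin := omega_m_disc_fin omega.
have ton := tonelli_on measurable_disc measurable_disc fin fin mF F0.
transitivity (\int[mu]_(z in disc) \int[mu]_(w in disc) F (z, w))%E.
  apply: eq_integral => z; rewrite inE => Dz.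
  rewrite EFinM (GE Dz) muleC (op_scale pgS Dz (pe.2 z Dz)).
  by apply: eq_integral.
rewrite ton; apply: eq_integral => w; rewrite inE => Dw.
rewrite (op_scale pe Dw (pgS.2 w Dw)).
apply: eq_integral => z; rewrite inE => Dz.
by rewrite /F (dk_sym dk Dz Dw); congr EFin; rewrite mulrAC.
Qed.

(** The scale at which the term of [extremal_pairing_le] containing the operator
    is at most half of the truncated power. *)
Let l : R := (2 * (K + 1) `^ p) `^ (- p^-1).

Let K1 : 0 < K + 1. Proof. by rewrite ltr_wpDl. Qed.

Let l0 : 0 < l. Proof. by rewrite powR_gt0// mulr_gt0// powR_gt0. Qed.

Let lK : l `^ p * (K + 1) `^ p = 2^-1.
Proof.
have k0 : 0 < (K + 1) `^ p by rewrite powR_gt0.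
rewrite /l -powRrM mulNr mulVf ?gt_eqF// powR_inv1 ?mulr_ge0 ?(ltW k0)//.
by field; rewrite gt_eqF.
Qed.

Lemma extremal_pairing_le n :
  (\int[mu]_(w in disc) ((gS w)%:E * op (extremal n) w) <=
   (l `^ p)%:E * \int[mu]_(w in disc) (op (extremal n) w `^ p * (u w)%:E)
   + (l `^ (- q) * U)%:E)%E.
Proof.
have pe := pos_extremal n; have mop := measurable_op pe.
have [mgS gS0] := posfunE pgS; have [mu' u0e] := posfunE pu.
have mpow : measurable_fun disc (fun w => op (extremal n) w `^ p * (u w)%:E)%E.
  by apply: emeasurable_funM => //; exact: measurableT_comp (measurable_poweR p) mop.
have -> : ((l `^ (- q) * U)%:E = (l `^ (- q))%:E * \int[mu]_(w in disc) (gS w)%:E)%E.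
  by rewrite EFinM cut_massE -(integral_indic_mul mu _ SD).
have h0 w : disc w -> (0 <= op (extremal n) w `^ p * (u w)%:E)%E.
  by move=> Dw; rewrite mule_ge0 ?poweR_ge0// u0e.
rewrite -!ge0_integralZl_EFin ?powR_ge0// -ge0_integralD//; last 4 first.
- by move=> w Dw; rewrite mule_ge0 ?lee_fin ?powR_ge0// h0.
- exact: measurable_funeM.
- by move=> w Dw; apply: mule_ge0; [rewrite lee_fin powR_ge0|exact: gS0].
- exact: measurable_funeM.
apply: ge0_le_integral => //.
- by move=> w Dw; apply: mule_ge0; [exact: gS0|exact: op_ge0].
- exact: emeasurable_funM.
- by apply: emeasurable_funD; exact: measurable_funeM.
move=> w Dw; have X0 := op_ge0 omega B pe Dw.
rewrite /gS indicE; have [wS|_] := boolP (w \in S); last first.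
  by rewrite mul0r mul0e mule0 adde0 mule_ge0 ?lee_fin ?powR_ge0// h0.
rewrite mul1r; case: (op _ _) X0 => [x||//] X0; last first.
  have uw : (0 < (u w)%:E)%E by rewrite lte_fin u0.
  have lp : (0 < (l `^ p)%:E)%E by rewrite lte_fin powR_gt0.
  rewrite poweRyr ?gt_eqF// (gt0_mulye uw) (gt0_muley uw) (gt0_muley lp).
  by rewrite -EFinM addye// leey.
rewrite lee_fin in X0; rewrite poweR_EFin -!EFinM -EFinD lee_fin.
rewrite [u w * x]mulrC mulrA -mulrDl ler_wpM2r ?(ltW (u0 Dw))//.
have := weighted_young p_gt1 q_gt1 pq X0 ltr01 l0.
by rewrite powR1 !mulr1.
Qed.

(** Half of the truncated power is absorbed in itself; this uses that the
    truncation is finite. *)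
Lemma truncated_power_bound n :
  (\int[mu]_(z in disc) (truncated_power n z)%:E <= (2 * l `^ (- q) * U)%:E)%E.
Proof.
have st := truncated_power_fin n; have pt := pos_truncated_power n.
have pe := pos_extremal n; have [mt t0] := posfunE pt.
pose W := integ mu disc (truncated_power n).
have WE : (W%:E = \int[mu]_(z in disc) (truncated_power n z)%:E)%E by rewrite /W integE.
have W0 : 0 <= W by exact: integ_ge0.
have eE : (\int[mu]_(z in disc) (extremal n z `^ p * v z)%:E = W%:E)%E.
  by rewrite WE; apply: eq_integral => z; rewrite inE => Dz; rewrite extremal_power.
have h1 : (W%:E <= \int[mu]_(w in disc) ((gS w)%:E * op (extremal n) w))%E.
  rewrite -pairing_swap WE; apply: ge0_le_integral => //.
    by have [] := posfunE (posfunM pG pe).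
  by move=> z Dz; rewrite lee_fin truncated_power_le.
have h2 : (\int[mu]_(w in disc) (op (extremal n) w `^ p * (u w)%:E)
    <= ((K + 1) `^ p * W)%:E)%E.
  have := bound_on_posfun pe; rewrite /summable_on eE => /(_ (ltry _)) /le_trans.
  apply; rewrite -EFinM lee_fin ler_wpM2r// ge0_ler_powR ?nnegrE ?(ltW p0) ?(ltW K1)//.
  by rewrite lerDl.
have h3 : W <= l `^ p * ((K + 1) `^ p * W) + l `^ (- q) * U.
  rewrite -lee_fin EFinD [X in (_ <= X + _)%E]EFinM.
  apply: (le_trans h1); apply: (le_trans (extremal_pairing_le n)).
  by rewrite leeD2r// lee_wpmul2l// lee_fin powR_ge0.
rewrite mulrA lK in h3; rewrite -WE lee_fin.
by rewrite -mulrA; lra.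
Qed.

Lemma dual_bound : (\int[mu]_(z in disc) (op gS z `^ q * (sg z)%:E) <=
  (2 * l `^ (- q))%:E * \int[mu]_(z in S) (u z)%:E)%E.
Proof.
have nd z : disc z -> nondecreasing_seq (fun n => (truncated_power n z)%:E).
  move=> Dz n m nm; rewrite lee_fin.
  have nmR : (n%:R : R) <= m%:R by rewrite ler_nat.
  apply: ler_pM; rewrite ?mulr_ge0 ?powR_ge0 ?(ltW (sg0 Dz))//.
    rewrite ler_wpM2r ?(ltW (sg0 Dz))// ge0_ler_powR ?(ltW q0)// ?nnegrE.
    - exact: (pos_truncated n).2.
    - exact: (pos_truncated m).2.
    - by rewrite le_min !ge_min lexx /= nmR orbT.
  rewrite !indicE ler_nat; case: (boolP (z \in low_set n)) => //=.
  rewrite inE => -[_ /= sn]; rewrite mem_set//; split=> //=.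
  exact: le_trans nmR.
have mt n : measurable_fun disc (fun z => (truncated_power n z)%:E).
  by have [] := posfunE (pos_truncated_power n).
apply: (@le_trans _ _ (\int[mu]_(z in disc)
    limn (fun n => (truncated_power n z)%:E))%E).
  apply: ge0_le_integral => //.
  - by move=> z Dz; rewrite mule_ge0 ?poweR_ge0// lee_fin ltW// sg0.
  - apply: emeasurable_funM; last by apply/measurable_EFinP; exact: psg.1.
    by apply: measurableT_comp (measurable_poweR q) _; exact: measurable_op.
  - apply: (emeasurable_fun_cvg (fun n z => (truncated_power n z)%:E)) => // z Dz.
    by apply: ereal_nondecreasing_is_cvgn; exact: nd.
  move=> z Dz; rewrite -GE// poweR_EFin -EFinM.
  pose m := Num.bound (G z + sg z).
  have Gz := pG.2 z Dz; have sz := ltW (sg0 Dz).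
  have mb : G z + sg z < m%:R by apply: archi_boundP; exact: addr_ge0.
  apply: le_trans (@ereal_nondecreasing_limn_ge _ _ m (nd _ Dz)).
  rewrite lee_fin /truncated_power /truncated.
  have Gm : G z <= m%:R by lra.
  by rewrite (min_idPl Gm) indicE mem_set ?mulr1//; split=> //=; lra.
rewrite monotone_convergence//; last first.
  by move=> n z Dz; have [_ ] := posfunE (pos_truncated_power n); exact.
apply: lime_le; last first.
  by apply: nearW => n; apply: (le_trans (truncated_power_bound n)); rewrite EFinM cut_massE.
apply: ereal_nondecreasing_is_cvgn => n m nm; apply: ge0_le_integral => //.
- by have [_ ] := posfunE (pos_truncated_power n).
- by move=> z Dz; exact: nd.
Qed.

End dual.

Theorem testing_necessary : exists D D' : R, [/\ 0 < D, 0 < D',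
  testing omega B p q u sg D & testing omega B q p sg u D'].
Proof.
have K1 : 0 < K + 1 by rewrite ltr_wpDl.
pose m := 2 * (2 * (K + 1) `^ p) `^ (- p^-1) `^ (- q).
have m0 : 0 < m by rewrite mulr_gt0// !powR_gt0// mulr_gt0// powR_gt0.
exists (K + 1), (m `^ q^-1); split=> //; first exact: powR_gt0.
  exact: first_testing.
have qp : q^-1 + p^-1 = 1 by rewrite addrC.
apply/(testing_carleson dk q_gt1 qp psg pu.1 u0 u_summable (powR_ge0 _ _)) => S cS.
by rewrite -powRrM mulVf ?gt_eqF// powRr1 ?(ltW m0)//; exact: dual_bound.
Qed.

End necessity.

(** * The theorem *)

Theorem theorem4 (R : realType) (p p' : R)
    (omega : {finite_measure set R -> \bar R}) (B : R[i] -> R[i] -> R[i])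
    (p_gt1 : 1 < p) (pp' : p^-1 + p'^-1 = 1)
    (omega_supp : omega (~` `[0, 1]%classic) = 0%E)
    (B_kernel : reproducing_kernel omega B)
    (B_repr : kernel_representation B) :
  (forall v u : R[i] -> R, weight omega v -> weight omega u ->
    let sigma := fun z => v z `^ (1 - p') in
    maxproj_bounded omega B p v u <->
    exists C0 C0s : R, [/\ 0 < C0, 0 < C0s,
      testing omega B p p' u sigma C0 & testing omega B p' p sigma u C0s]) /\
  (exists2 C1 : R, 0 < C1 &
    forall v u : R[i] -> R, weight omega v -> weight omega u ->
    let sigma := fun z => v z `^ (1 - p') in
    forall C0 C0s : R, 0 < C0 -> 0 < C0s ->
      testing omega B p p' u sigma C0 -> testing omega B p' p sigma u C0s ->
      (maxproj_norm omega B p v u <= (C1 * (C0 + C0s))%:E)%E).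
Proof.
have p'_gt1 : 1 < p'.
  have p0 : 0 < p := lt_trans ltr01 p_gt1.
  have pi1 : p^-1 < 1 by rewrite invf_lt1.
  have pi0 : 0 < p^-1 by rewrite invr_gt0.
  have qi0 : 0 < p'^-1 by lra.
  have q0 : 0 < p' by rewrite -invr_gt0.
  by rewrite -(invf_lt1 q0); lra.
have [al [c dk]] := representation_dyadic B_repr.
split=> [v u wv wu sigma|].
  split=> [[K bnd]|[C0 [C0s [C00 C0s0 test test']]]].
    exact: (testing_necessary dk p_gt1 p'_gt1 pp' wv wu bnd).
  exists (2 * (32 * c ^+ 2 * form_cst p p' * (C0 + C0s))).
  exact: (testing_sufficient dk p_gt1 p'_gt1 pp' wv wu C00 C0s0 test test').
exists (2 * (32 * c ^+ 2 * form_cst p p')).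
  by rewrite !mulr_gt0 ?form_cst_gt0// ?exprn_gt0// (dk_c dk).
move=> v u wv wu sigma C0 C0s C00 C0s0 test test'.
apply: ereal_inf_lbound; exists (2 * (32 * c ^+ 2 * form_cst p p' * (C0 + C0s))).
  exact: (testing_sufficient dk p_gt1 p'_gt1 pp' wv wu C00 C0s0 test test').
by rewrite !mulrA.
Qed.
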